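(* Let $f(z)=\sum_{n=0}^{\infty}a_nz^n$ be analytic in $\mathbb{D}$ with $|f(z)|\le 1$ for all $z\in\mathbb{D}$. Then, for every $z\in\mathbb{D}$ with $|z|=r\le \frac{\sqrt{17}-3}{4}$, $$\mathcal{A}_f(r):=|f(z)|+|f'(z)|\,r+B_2(f,r)+A(f_0,r)+\frac{221-43\sqrt{17}}{64}\left(\frac{S_r}{\pi}\right)+\lambda\left(\frac{S_r}{\pi}\right)^2\le 1,$$ where $$\lambda=\frac{A_1(a_* )}{128(1+a_* )^3A_2(a_* )}=18.0215\ldots,$$ with $$\begin{aligned}A_1(a)=\;&128(-6311+1521\sqrt{17})+32(-459367+111409\sqrt{17})a\\&+48(368037-89251\sqrt{17})a^2+16(6825181-1655339\sqrt{17})a^3\\&+1280(-44509+10795\sqrt{17})a^4+6(-46228497+11212055\sqrt{17})a^5\\&+7(-2654823+643889\sqrt{17})a^6+32(7818303-1896217\sqrt{17})a^7\\&+36(4165553-1010295\sqrt{17})a^8,\end{aligned}$$ $$A_2(a)=(2008-488\sqrt{17})+(33442-8110\sqrt{17})a+3(-36847+8937\sqrt{17})a^2+(79457-19271\sqrt{17})a^3,$$ and $a_*\approx 0.600976$ is the unique root in the interval $(0,1)$ of the equation $\Psi_1^*(t)=0$, where $$\begin{aligned}\Psi_1^*(t)=\;&2048(-169479+41105\sqrt{17})+64(-74661865+18108159\sqrt{17})t\\&-64(-470704167+114162545\sqrt{17})t^2+16(-698169901+169331035\sqrt{17})t^3\\&+16(-9949839967+2413190649\sqrt{17})t^4-172(-914721543+221852561\sqrt{17})t^5\\&+(298599878708-72421108204\sqrt{17})t^6+(-277864274087+67391985393\sqrt{17})t^7\\&+(-376869563493+91404295139\sqrt{17})t^8-4(-40230249983+9757268825\sqrt{17})t^9\\&+(363756131186-88223820638\sqrt{17})t^{10}+2(-35641396573+8644308395\sqrt{17})t^{11}\\&+(-94566008398+22935625954\sqrt{17})t^{12}.\end{aligned}$$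 Equality is achieved for a function $f_a(z)=\frac{a-z}{1-az}$, $a\in[0,1)$; that is, there exist $a\in[0,1)$ and $z$ with $|z|=r\le\frac{\sqrt{17}-3}{4}$ such that for $f=f_a$ the left-hand side above equals $1$.
   Context: $\mathbb{D}=\{z\in\mathbb{C}:|z|<1\}$ and $\mathbb{D}_r=\{z\in\mathbb{C}:|z|<r\}$. For $f(z)=\sum_{n=0}^\infty a_nz^n$ analytic in $\mathbb{D}$ with $|f|\le 1$, and $0\le r<1$: - $f_0(z):=f(z)-f(0)$ and $\|f_0\|_r^2:=\sum_{n=1}^{\infty}|a_n|^2r^{2n}$. - $B_2(f,r):=\sum_{n=2}^{\infty}|a_n|r^n$. - $A(f_0,r):=\left(\frac{1}{1+|a_0|}+\frac{r}{1-r}\right)\|f_0\|_r^2$. - $S_r=S_r(f):=\int_{\mathbb{D}_r}|f'(z)|^2\,dA(z)$, where $dA$ is planar Lebesgue measure; equivalently $S_r=\pi\sum_{n=1}^\infty n|a_n|^2r^{2n}$.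
   Formalization: The printed value λ = 18.0215… is incorrect for the displayed formula, which gives λ = 18.02140…; the formal theorem states instead |λ − 18.0215| < 0.0001, and uses the exact λ everywhere else. *)

(* Defs.v *)
From HB Require Import structures.
From mathcomp Require Import all_boot all_order all_algebra.
From mathcomp Require Import complex.
From mathcomp Require Import all_classical all_reals all_analysis.

Set Implicit Arguments.
Unset Strict Implicit.
Unset Printing Implicit Defensive.

Import Order.TTheory GRing.Theory Num.Theory numFieldNormedType.Exports.

Local Open Scope classical_set_scope.
Local Open Scope complex_scope.
Local Open Scope ring_scope.

(* The modulus as an element of R; the library's `|z| lives in R[i]. *)
Notation cabs := ComplexField.Normc.normc.

(* The topology and normed-module structure used on R[i] is that of the regular
   module R[i]^o over the numFieldType R[i]; derive1 is then the complex
   derivative. *)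
Definition power_series_in_disc (R : realType) (a : nat -> R[i])
    (f : R[i] -> R[i]) : Prop :=
  forall z : R[i], cabs z < 1 ->
    series (fun n => a n * z ^+ n : R[i]^o) @ \oo --> (f z : R[i]^o).

Definition cderiv (R : realType) (f : R[i] -> R[i]) (z : R[i]) : R[i] :=
  derive1 (f : R[i] -> R[i]^o) z.

(* Series and the area integral of nonnegative terms are taken in \bar R, so
   that no convergence is presupposed: a bound by 1 entails finiteness. *)
Definition B2 (R : realType) (a : nat -> R[i]) (r : R) : \bar R :=
  (\sum_(2 <= n <oo) (cabs (a n) * r ^+ n)%:E)%E.

Definition sqnorm_f0 (R : realType) (a : nat -> R[i]) (r : R) : \bar R :=
  (\sum_(1 <= n <oo) (cabs (a n) ^+ 2 * r ^+ (2 * n))%:E)%E.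

Definition A_f0 (R : realType) (a : nat -> R[i]) (r : R) : \bar R :=
  (((1 + cabs (a 0%N))^-1 + r / (1 - r))%:E * sqnorm_f0 a r)%E.

Definition area (R : realType) (f : R[i] -> R[i]) (r : R) : \bar R :=
  (\int[@lebesgue_measure R \x @lebesgue_measure R]_(p in
     [set p : R * R | (cabs (p.1 +i* p.2) < r)%R])
     (cabs (cderiv f (p.1 +i* p.2)) ^+ 2)%:E)%E.

Definition bohr_sum (R : realType) (lam : R) (a : nat -> R[i])
    (f : R[i] -> R[i]) (z : R[i]) : \bar R :=
  let r := cabs z in
  let Spi := (area f r * (pi^-1)%:E)%E in
  ((cabs (f z) + cabs (cderiv f z) * r)%:E + B2 a r + A_f0 a r
   + ((221 - 43 * Num.sqrt 17) / 64)%:E * Spi + lam%:E * (Spi * Spi))%E.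

Definition mobius (R : realType) (b : R) (z : R[i]) : R[i] :=
  (b%:C - z) / (1 - b%:C * z).

(* Coefficients above 5000 must be entered as naturals followed by %:R: a bare
   ring_scope numeral would be expanded into a unary natural, whereas in
   nat_scope it is kept as Nat.of_num_uint (understood by ring, field, lra). *)
Definition A1 (R : realType) (a : R) : R :=
  let s : R := Num.sqrt 17 in
    128 * (- 6311%:R + 1521%:R * s)
  + 32 * (- 459367%:R + 111409%:R * s) * a
  + 48 * (368037%:R - 89251%:R * s) * a ^+ 2
  + 16 * (6825181%:R - 1655339%:R * s) * a ^+ 3
  + 1280%:R * (- 44509%:R + 10795%:R * s) * a ^+ 4
  + 6 * (- 46228497%:R + 11212055%:R * s) * a ^+ 5
  + 7 * (- 2654823%:R + 643889%:R * s) * a ^+ 6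
  + 32 * (7818303%:R - 1896217%:R * s) * a ^+ 7
  + 36 * (4165553%:R - 1010295%:R * s) * a ^+ 8.

Definition A2 (R : realType) (a : R) : R :=
  let s : R := Num.sqrt 17 in
    (2008%:R - 488%:R * s)
  + (33442%:R - 8110%:R * s) * a
  + 3 * (- 36847%:R + 8937%:R * s) * a ^+ 2
  + (79457%:R - 19271%:R * s) * a ^+ 3.

Definition lambda_of (R : realType) (a : R) : R :=
  A1 a / (128 * (1 + a) ^+ 3 * A2 a).

Definition Psi1 (R : realType) (t : R) : R :=
  let s : R := Num.sqrt 17 in
    2048%:R * (- 169479%:R + 41105%:R * s)
  + 64 * (- 74661865%:R + 18108159%:R * s) * t
  - 64 * (- 470704167%:R + 114162545%:R * s) * t ^+ 2
  + 16 * (- 698169901%:R + 169331035%:R * s) * t ^+ 3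
  + 16 * (- 9949839967%:R + 2413190649%:R * s) * t ^+ 4
  - 172 * (- 914721543%:R + 221852561%:R * s) * t ^+ 5
  + (298599878708%:R - 72421108204%:R * s) * t ^+ 6
  + (- 277864274087%:R + 67391985393%:R * s) * t ^+ 7
  + (- 376869563493%:R + 91404295139%:R * s) * t ^+ 8
  - 4 * (- 40230249983%:R + 9757268825%:R * s) * t ^+ 9
  + (363756131186%:R - 88223820638%:R * s) * t ^+ 10
  + 2 * (- 35641396573%:R + 8644308395%:R * s) * t ^+ 11
  + (- 94566008398%:R + 22935625954%:R * s) * t ^+ 12.

(* Main.v *)
Require Import Defs.
From HB Require Import structures.
From mathcomp Require Import all_boot all_order all_algebra.
From mathcomp Require Import complex cyclic separable cyclotomic.
From mathcomp Require Import all_classical all_reals all_analysis.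
From mathcomp Require Import measurable_realfun.
From mathcomp Require Import ring lra zify.
Import Order.TTheory GRing.Theory Num.Theory numFieldNormedType.Exports.
Local Open Scope complex_scope.
Local Open Scope ring_scope.
Set Implicit Arguments.
Unset Strict Implicit.
Unset Printing Implicit Defensive.

(** Let r0 = (sqrt 17 - 3) / 4, the positive root of 2 r^2 + 3 r = 1, and write al = |a_0|.

    Everything that is needed about a function f bounded by 1 is contained in one fact: the lower
    triangular Toeplitz matrices of its coefficients are contractions ([bounded_schur]). For
    polynomials this is an average over roots of unity ([toeplitz_poly_le]); the general case
    follows from f (rho z) as rho tends to 1. Testing it on explicit vectors gives
    - Carlson's inequalities ([carlson_odd], [carlson_even]), which telescope to
      B_2 + A <= (1 - al^2) r^2 / (1 - r) ([B2_A_le]);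
    - the domination of the partial sums of |a_k|^2 by those of the disc automorphism with the
      same al ([schur_sum_mobius]), which Abel summation turns into a sharp bound for S_r / pi
      ([area_le]);
    - the Schwarz-Pick inequality ([schwarz_pick]) and its infinitesimal form, which bound
      |f z| + |f' z| r ([value_deriv_le]).
    The identity between S_r and the sum of pi n |a_n|^2 r^(2 n) ([area_series]) comes from
    averaging the integrand over rotations, which preserve planar measure because they are
    products of shears.

    The sum of the three bounds is [majorant] lam al r. It is increasing in r, so the theorem
    reduces to r = r0, and all bounds are equalities for a disc automorphism at the point - r
    ([mobius_bohr_sum]). Hence lambda has to be the largest number for which
    majorant lambda al r0 <= 1 for all al in [0, 1].

    By [majorant_gap], for al < 1, 1 - majorant lam al r0 is a positive multiple of
    gap_num - lam r0^4 gap_den at al, so lambda is the minimum over [0, 1) of the quotient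
    gap_num / (r0^4 gap_den). The derivative of this quotient has the sign of a sextic [crit] which
    is increasing on [0, 1], so the minimum is attained at the only root a_star of [crit]. The
    polynomial Psi1 is [crit] times a sextic without zeros on [0, 1] ([Psi1_factor]), and the
    minimum is [lambda_of] a_star because the two differ by a multiple of [crit]
    ([lambda_identity]). At al = a_star the majorant equals 1, which is the case of equality.

    The coefficients lie in Q(sqrt 17) and are written as u + v r0 throughout; the polynomial
    identities hold modulo 2 r^2 + 3 r - 1, and their proofs exhibit the quotient. *)

(** * Averages over roots of unity *)

Lemma prim_root_exists (C : numClosedFieldType) n :
  (0 < n)%N -> exists w : C, n.-primitive_root w.
Proof.
move=> n_gt0; pose p : {poly C} := 'X^n - 1.
have [r Dp] := closed_field_poly_normal p.
rewrite (monicP _) ?monicXnsubC // scale1r in Dp.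
have rn1 : all n.-unity_root r by apply/allP=> z; rewrite -root_prod_XsubC -Dp.
have sz_r : (n < (size r).+1)%N.
  by rewrite -(size_prod_XsubC r id) -Dp size_XnsubC.
have [|z] := hasP (has_prim_root n_gt0 rn1 _ sz_r); last by exists z.
by rewrite -separable_prod_XsubC -Dp separable_Xn_sub_1 // pnatr_eq0 -lt0n.
Qed.

Section Toeplitz.
Variable C : numClosedFieldType.
Local Notation "z ^*" := (Num.conj z) : ring_scope.

Lemma prim_root_norm n (w : C) : n.-primitive_root w -> `|w| = 1.
Proof.
move=> wn; have n0 := prim_order_gt0 wn.
by apply/eqP; rewrite -(@pexpr_eq1 _ _ n) // -normrX (prim_expr_order wn) normr1.
Qed.

(** Orthogonality of the characters of the cyclic group generated by w. *)
Lemma sum_prim_root n (w : C) i j : n.-primitive_root w -> (i < n)%N -> (j < n)%N ->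
  \sum_(k < n) (w ^+ k) ^+ i * ((w ^+ k) ^+ j)^* = (i == j)%:R * n%:R.
Proof.
move=> wn ilt jlt.
have w0 : w != 0 by rewrite -normr_eq0 (prim_root_norm wn) oner_eq0.
have -> : \sum_(k < n) (w ^+ k) ^+ i * ((w ^+ k) ^+ j)^*
    = \sum_(k < n) (w ^+ i * (w ^+ j)^*) ^+ k.
  by apply: eq_bigr => k _; rewrite exprMn !rmorphXn -!exprM !(mulnC k).
have cE : (w ^+ j)^* = (w ^+ j)^-1.
  by rewrite invC_norm normrX (prim_root_norm wn) !expr1n invr1 mul1r.
rewrite cE; have [->|ij] := eqVneq i j.
  rewrite divff ?expf_neq0 // (eq_bigr (fun=> 1)); last by move=> k _; rewrite expr1n.
  by rewrite sumr_const card_ord mul1r.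
rewrite mul0r; set x := _ / _.
have x1 : x - 1 != 0.
  rewrite subr_eq0; apply/eqP => xE.
  have /eqP : w ^+ i = w ^+ j by rewrite -[LHS](divfK (expf_neq0 j w0)) -/x xE mul1r.
  rewrite (eq_prim_root_expr wn) !modn_small //; exact/negP.
apply: (mulfI x1); rewrite mulr0 -subrX1 exprMn exprVn -!exprM ![(_ * n)%N]mulnC.
by rewrite !exprM (prim_expr_order wn) !expr1n invr1 mulr1 subrr.
Qed.

(** Discrete Parseval: with at least as many nodes as coefficients, the mean over the n-th roots
    of unity replaces the mean over the unit circle, so that no integral is needed. *)
Lemma mean_poly n (w : C) (p q : {poly C}) :
  n.-primitive_root w -> (size p <= n)%N -> (size q <= n)%N ->
  \sum_(k < n) p.[w ^+ k] * (q.[w ^+ k])^* = n%:R * \sum_(i < n) p`_i * (q`_i)^*.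
Proof.
move=> wn sp sq.
transitivity (\sum_(k < n) \sum_(i < n) \sum_(j < n)
    p`_i * (q`_j)^* * ((w ^+ k) ^+ i * ((w ^+ k) ^+ j)^*)).
  apply: eq_bigr => k _.
  rewrite (horner_coef_wide _ sp) (horner_coef_wide _ sq) rmorph_sum /= mulr_suml.
  apply: eq_bigr => i _; rewrite mulr_sumr; apply: eq_bigr => j _.
  by rewrite rmorphM /= mulrACA.
rewrite exchange_big /= mulr_sumr; apply: eq_bigr => i _.
rewrite exchange_big /=.
under eq_bigr => j _ do rewrite -mulr_sumr sum_prim_root //.
rewrite (bigD1 i) //= eqxx mul1r big1 ?addr0 1?mulrC // => j ji.
by rewrite eq_sym (negbTE (_ : val j != val i)) // mul0r mulr0.
Qed.

Lemma mean_norm2 n (w : C) (p : {poly C}) :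
  n.-primitive_root w -> (size p <= n)%N ->
  \sum_(k < n) `|p.[w ^+ k]| ^+ 2 = n%:R * \sum_(i < n) `|p`_i| ^+ 2.
Proof.
move=> wn sp; under eq_bigr do rewrite normCK.
by rewrite mean_poly //; congr (_ * _); apply: eq_bigr => i _; rewrite normCK.
Qed.

(** The sum is the mean of F p (conj q) over sufficiently many roots of unity, and pointwise
    |F p q| <= B (|p|^2 + |q|^2) / 2. *)
Lemma toeplitz_poly_le (B : C) M (F p q : {poly C}) :
  (forall u, `|u| = 1 -> `|F.[u]| <= B) -> (size p <= M)%N -> (size q <= M)%N ->
  `|\sum_(i < M) (F * p)`_i * (q`_i)^*|
    <= B * ((\sum_(i < M) `|p`_i| ^+ 2 + \sum_(i < M) `|q`_i| ^+ 2) / 2).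
Proof.
move=> FB sp sq; pose n := (size F + M).+1.
have [w wn] := @prim_root_exists C n isT.
have widen (r : {poly C}) (G : nat -> C) : (size r <= M)%N ->
    (forall i, r`_i = 0 -> G i = 0) -> \sum_(i < M) G i = \sum_(i < n) G i.
  move=> sr G0; rewrite (@big_ord_widen _ _ _ M n) ?/n; last by lia.
  rewrite [RHS](bigID (fun i : 'I_n => (i < M)%N)) /= [X in _ + X]big1 ?addr0 // => i.
  by rewrite -leqNgt => Mi; apply: G0; rewrite nth_default // (leq_trans sr).
have W1 : 0 < n%:R :> C by rewrite ltr0n.
rewrite (widen q (fun i => (F * p)`_i * (q`_i)^*)) //; last first.
  by move=> i ->; rewrite rmorph0 mulr0.
rewrite (widen p (fun i => `|p`_i| ^+ 2)) //; last by move=> i ->; rewrite normr0 expr0n.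
rewrite (widen q (fun i => `|q`_i| ^+ 2)) //; last by move=> i ->; rewrite normr0 expr0n.
have sFp : (size (F * p)%R <= n)%N.
  by apply: leq_trans (size_polyMleq _ _) _; rewrite /n; lia.
have sq' : (size q <= n)%N by rewrite /n; lia.
have sp' : (size p <= n)%N by rewrite /n; lia.
rewrite -(ler_pM2l W1) -[X in X * `|_|]ger0_norm ?ler0n // -normrM -(mean_poly wn) //.
rewrite mulrCA [n%:R * _]mulrA mulrDr -(mean_norm2 wn sp') -(mean_norm2 wn sq').
rewrite -big_split /= mulr_suml mulr_sumr.
apply: le_trans (ler_norm_sum _ _ _) _; apply: ler_sum => k _.
rewrite hornerM !normrM norm_conjC -mulrA.
have u1 : `|w ^+ k| = 1 by rewrite normrX (prim_root_norm wn) expr1n.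
apply: ler_pM; rewrite ?mulr_ge0 //; first exact: FB.
set x := `|_|; set y := `|_|.
have xr : x \is Num.real by rewrite normr_real.
have yr : y \is Num.real by rewrite normr_real.
rewrite ler_pdivlMr // -subr_ge0.
have -> : x ^+ 2 + y ^+ 2 - x * y * 2 = (x - y) ^+ 2 by ring.
by rewrite real_exprn_even_ge0 // realB.
Qed.

End Toeplitz.

(** * Coefficient sequences of bounded functions *)

Section SchurSeq.
Variable C : numClosedFieldType.
Local Notation "z ^*" := (Num.conj z) : ring_scope.
Implicit Types (a h p q : nat -> C).

Lemma le_of_eq (x y : C) : x = y -> x <= y. Proof. by move=> ->. Qed.

Definition cauchy_prod a h i : C := \sum_(j < i.+1) a (i - j)%N * h j.

(** The truncated lower triangular Toeplitz matrices of a are contractions. The arithmetic mean on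
    the right is equivalent to the product of the norms and avoids square roots. *)
Definition schur_seq a := forall M p q,
  `|\sum_(i < M) cauchy_prod a p i * (q i)^*|
    <= (\sum_(i < M) `|p i| ^+ 2 + \sum_(i < M) `|q i| ^+ 2) / 2.

Lemma cauchy_prodD a h1 h2 i : cauchy_prod a (fun j => h1 j + h2 j) i = cauchy_prod a h1 i +
  cauchy_prod a h2 i.
Proof. by rewrite /cauchy_prod -big_split; apply: eq_bigr => j _; rewrite mulrDr. Qed.

Lemma cauchy_prod_delta a k t i :
  cauchy_prod a (fun j => (j == k)%:R * t) i = if (k <= i)%N then a (i - k)%N * t else 0.
Proof.
rewrite /cauchy_prod; case: ifP => ki.
  have ki' : (k < i.+1)%N by [].
  rewrite (bigD1 (Ordinal ki')) //= eqxx mul1r big1 ?addr0 // => j jk.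
  by rewrite (negbTE (_ : val j != k)) ?mul0r ?mulr0.
rewrite big1 // => j _; rewrite (_ : val j == k = false) ?mul0r ?mulr0 //.
by apply/negP => /eqP jk; move: (ltn_ord j); rewrite ltnS jk ki.
Qed.

(** The bilinear bound with q equal to the image of h. *)
Lemma schur_contraction a M h : schur_seq a ->
  \sum_(i < M) `|cauchy_prod a h i| ^+ 2 <= \sum_(i < M) `|h i| ^+ 2.
Proof.
move=> /(_ M h (cauchy_prod a h)).
under eq_bigr do rewrite -normCK.
set s := \sum_(i < M) _; set t := \sum_(i < M) _.
have s0 : 0 <= s by apply: sumr_ge0 => i _; rewrite exprn_ge0.
rewrite ger0_norm // ler_pdivlMr // mulr_natr mulr2n lerD2r; exact.
Qed.

Lemma schur_sum_le1 a M : schur_seq a -> \sum_(i < M) `|a i| ^+ 2 <= 1.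
Proof.
move=> aS; have := @schur_contraction a M (fun j => (j == 0%N)%:R * 1) aS.
under eq_bigr do rewrite cauchy_prod_delta /= subn0 mulr1.
move=> /le_trans; apply; case: M => [|M]; first by rewrite big_ord0 ler01.
rewrite big_ord_recl /= mulr1 normr1 expr1n big1 ?addr0 //.
by move=> i _; rewrite mul0r normr0 expr0n.
Qed.

Lemma schur_le1 a n : schur_seq a -> `|a n| <= 1.
Proof.
move=> aS; have := schur_sum_le1 n.+1 aS; rewrite big_ord_recr /= => h.
rewrite -(@expr_le1 _ 2) //; apply: le_trans h; rewrite lerDr.
by apply: sumr_ge0 => i _; rewrite exprn_ge0.
Qed.

(** Contraction on e_0 + t e_(m+1) for the best t; the image has the coefficients
    a_0, ..., a_m, a_(m+1) + a_0 t. *)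
Lemma schur_sum_rec a m : schur_seq a ->
  \sum_(k < m.+1) `|a k.+1| ^+ 2
   <= (1 - `|a 0%N| ^+ 2) ^+ 2 + `|a 0%N| ^+ 2 * \sum_(k < m) `|a k.+1| ^+ 2.
Proof.
move=> aS; set A := `|a 0%N| ^+ 2; set S := \sum_(k < m) _.
have A0 : 0 <= A by rewrite exprn_ge0.
have S0 : 0 <= S by apply: sumr_ge0 => i _; rewrite exprn_ge0.
rewrite big_ord_recr /= -/S; set B := `|a m.+1| ^+ 2.
have B0 : 0 <= B by rewrite exprn_ge0.
have AS : A + S + B <= 1.
  by have := schur_sum_le1 m.+2 aS; rewrite big_ord_recl big_ord_recr /= addrA.
have A1 : A <= 1 by apply: le_trans AS; rewrite -addrA lerDl addr_ge0.
have [A1'|A1'] := eqVneq A 1.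
  have : S + B <= 0 by rewrite -(lerD2l A) addr0 addrA {2}A1'.
  by rewrite A1' subrr expr0n add0r mul1r => /le_trans; apply.
have D0 : 0 < 1 - A by rewrite subr_gt0 lt_neqAle A1' A1.
(* the t for which the contraction inequality on e_0 + t e_(m+1) is sharpest *)
pose t := (a 0%N)^* * a m.+1 / (1 - A).
pose h j : C := (j == 0%N)%:R * 1 + (j == m.+1)%:R * t.
have hE i : cauchy_prod a h i = a i + (if (m < i)%N then a (i - m.+1)%N * t else 0).
  by rewrite /h cauchy_prodD !cauchy_prod_delta /= subn0 mulr1.
have := @schur_contraction a m.+2 h aS.
rewrite big_ord_recl big_ord_recr [X in _ <= X -> _]big_ord_recl big_ord_recr /=.
rewrite !hE ltn0 addr0 /bump /= add1n ltnSn subnn.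
rewrite (eq_bigr (fun k : 'I_m => `|a k.+1| ^+ 2)); last first.
  by move=> i _; rewrite hE add1n ltnS leqNgt ltn_ord addr0.
rewrite [X in _ <= _ + (X + _) -> _]big1; last first.
  move=> i _; rewrite /h add1n eqSS (ltn_eqF (ltn_ord i)).
  by rewrite !mul0r addr0 normr0 expr0n.
rewrite /h !eqxx !mul0r !mul1r addr0 !add0r normr1 expr1n.
have AE : A = a 0%N * (a 0%N)^* by rewrite /A normCK.
have D1 : 1 - a 0%N * (a 0%N)^* != 0 by rewrite -AE gt_eqF.
have tE : a m.+1 + a 0%N * t = a m.+1 / (1 - A).
  by rewrite /t AE; field.
have Dc : `|1 - A| = 1 - A by rewrite gtr0_norm.
rewrite tE /t !normrM normfV norm_conjC Dc !exprMn exprVn -/A -/B -/S => hh.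
have {hh} : (A + S) * (1 - A) ^+ 2 + B <= (1 - A) ^+ 2 + A * B.
  have D2 : 0 < (1 - A) ^+ 2 by rewrite exprn_gt0.
  have D3 : 1 - A != 0 by rewrite gt_eqF.
  by move: hh; rewrite -(ler_pM2r D2) => hh; apply: le_trans (le_trans _ hh) _;
    apply: le_of_eq; field.
rewrite -subr_ge0 => hh; rewrite -subr_ge0 -(pmulr_rge0 _ D0).
 by apply: le_trans hh _; apply: le_of_eq; ring.
Qed.

Lemma sum_gap (F : nat -> C) m N : (m < N)%N ->
  (forall k, (m < k < N)%N -> F k = 0) ->
  \sum_(k < N.+1) F k = \sum_(k < m) F k + F m + F N.
Proof.
move=> mN F0.
have -> : \sum_(k < m) F k + F m = \sum_(k < m.+1) F k by rewrite big_ord_recr.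
rewrite big_ord_recr /=; congr (_ + _).
rewrite (big_ord_widen N F mN) [LHS](bigID (fun k : 'I_N => (k < m.+1)%N)) /=.
rewrite [X in _ + X]big1 ?addr0 // => k; rewrite -leqNgt => mk.
by apply: F0; rewrite mk ltn_ord.
Qed.

Lemma cauchy_prod_rev a h n : cauchy_prod a h n = \sum_(k < n.+1) a k * h (n - k)%N.
Proof.
rewrite /cauchy_prod (reindex_inj rev_ord_inj) /=; apply: eq_bigr => j _.
by rewrite !subSS subKn // -ltnS.
Qed.

(** The vector s_0, ..., s_(m-1), x, 0, ..., 0, e of length N + 1, with e at position N. *)
Definition profile (s : nat -> C) m x N e k : C :=
  if (k < m)%N then s k else if k == m then x else if k == N then e else 0.

Lemma sum_profile (H : nat -> C -> C) s m x N e : (m < N)%N -> (forall k, H k 0 = 0) ->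
  \sum_(k < N.+1) H k (profile s m x N e k)
    = \sum_(k < m) H k (s k) + H m x + H N e.
Proof.
move=> mN H0; rewrite (sum_gap (F := fun k => H k (profile s m x N e k)) mN).
  rewrite {2 3}/profile ltnn ltnNge (ltnW mN) /= !eqxx (gtn_eqF mN).
  by congr (_ + _ + _); apply: eq_bigr => k _; rewrite /profile ltn_ord.
move=> k /andP[mk kN]; rewrite /profile ltnNge (ltnW mk) /=.
by rewrite (gtn_eqF mk) (ltn_eqF kN).
Qed.

(** The bilinear bound for p = e_0 + ... and q = ... + e_N whose other coefficients, at the top of
    p and at the bottom of q, are those of a up to conjugation and the factor u. Coordinates below
    m contribute the sum of the |a_k|^2 once, coordinate N contributes it a second time together
    with a_N. For N = 2 m the middle coefficients of p and q meet, whence the term a_0 x. *)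
Lemma carlson_form a m N u x y : schur_seq a -> (m < N)%N -> (m.*2 <= N)%N ->
  `|u| = 1 ->
  `|\sum_(k < m) `|a k| ^+ 2
     + (a m + (if (0 < m)%N && (N == m.*2) then a 0%N * x else 0)) * y
     + (\sum_(k < m) `|a k| ^+ 2 + a m * (u * x) + u * a N)|
   <= (\sum_(k < m) `|a k| ^+ 2 + `|x| ^+ 2 + 1
       + (\sum_(k < m) `|a k| ^+ 2 + `|y| ^+ 2 + 1)) / 2.
Proof.
move=> aS mN m2N u1.
pose q := profile a m y^* N u^*.
pose p k := profile (fun k => (u * a k)^*) m x N 1 (N - k)%N.
have u2 : u * u^* = 1 by rewrite -normCK u1 expr1n.
have p0 : p 0%N = 1.
  by rewrite /p /profile subn0 ltnNge (ltnW mN) /= (gtn_eqF mN) eqxx.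
have pE k : (0 < k)%N -> (k <= m)%N -> (k < m)%N || (N != m.*2) -> p k = 0.
  move=> k0 km kmN; rewrite /p /profile ltnNge (_ : m <= N - k)%N /=; last by lia.
  rewrite (_ : (N - k)%N == m = false); last by apply/negP; move: kmN; lia.
  by rewrite (_ : (N - k)%N == N = false) //; apply/negP; lia.
have crow k : (k < m)%N -> cauchy_prod a p k = a k.
  move=> km; rewrite /cauchy_prod big_ord_recl /= subn0 p0 mulr1 big1 ?addr0 // => j _.
  by rewrite /bump /= add1n pE ?mulr0 //; move: (ltn_ord j); lia.
have cm : cauchy_prod a p m = a m + (if (0 < m)%N && (N == m.*2) then a 0%N * x else 0).
  rewrite /cauchy_prod; case: (posnP m) => [->|m0].
    by rewrite big_ord_recl big_ord0 p0 mulr1.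
  rewrite big_ord_recr /= subnn; congr (_ + _); last first.
    case: eqP => [NE|NE]; last by rewrite pE ?mulr0 //; apply/orP; right; apply/eqP.
    by congr (_ * _); rewrite /p /profile NE -addnn addnK ltnn eqxx.
  have m0' : (0 < m)%N by [].
  rewrite (bigD1 (Ordinal m0')) //= subn0 p0 mulr1 big1 ?addr0 // => j j0.
  rewrite pE ?mulr0 ?(ltn_ord j) ?(ltnW (ltn_ord j)) // lt0n.
  by apply: contraNneq j0 => jE; apply/eqP/val_inj.
have cN : cauchy_prod a p N = \sum_(k < m) u^* * `|a k| ^+ 2 + a m * x + a N.
  rewrite cauchy_prod_rev (eq_bigr (fun k : 'I__ =>
     a k * profile (fun k => (u * a k)^*) m x N 1 k)); last first.
    by move=> k _; rewrite /p subKn // -ltnS.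
  rewrite (sum_profile (H := fun k z => a k * z)) //; last by move=> k; rewrite mulr0.
  rewrite mulr1; congr (_ + _ + _); apply: eq_bigr => k _.
  by rewrite rmorphM normCK /= mulrCA mulrA.
have := aS N.+1 p q.
rewrite (sum_profile (H := fun k z => cauchy_prod a p k * z^*)) //; last first.
  by move=> k; rewrite rmorph0 mulr0.
rewrite (sum_profile (H := fun k z => `|z| ^+ 2)) //; last first.
  by move=> k; rewrite normr0 expr0n.
have -> : \sum_(i < N.+1) `|p i| ^+ 2 = \sum_(k < m) `|a k| ^+ 2 + `|x| ^+ 2 + 1.
  rewrite (reindex_inj rev_ord_inj) /=.
  rewrite (eq_bigr (fun k : 'I__ =>
     `|profile (fun k => (u * a k)^*) m x N 1 k| ^+ 2)); last first.
    by move=> k _; rewrite /p subSS subKn // -ltnS.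
  rewrite (sum_profile (H := fun k z => `|z| ^+ 2)) //; last first.
    by move=> k; rewrite normr0 expr0n.
  rewrite normr1 expr1n; congr (_ + _ + _); apply: eq_bigr => k _.
  by rewrite norm_conjC normrM u1 mul1r.
rewrite !norm_conjC u1 expr1n !conjCK cm cN.
rewrite (eq_bigr (fun k : 'I_m => `|a k| ^+ 2)); last by move=> k _; rewrite crow // normCK.
congr (`|_| <= _); congr (_ + _).
rewrite !mulrDl -mulr_sumr [X in X + _ + _]mulrC mulrA u2 mul1r.
by congr (_ + _ + _); [rewrite -mulrA [x * u]mulrC|rewrite mulrC].
Qed.

Lemma unimodular_factor (z : C) : exists2 u : C, `|u| = 1 & u * z = `|z|.
Proof.
have [->|z0] := eqVneq z 0; first by exists 1; rewrite ?normr1 // mulr0 normr0.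
exists (z^* / `|z|).
  by rewrite normrM normfV norm_conjC normr_id divff ?normr_eq0.
by rewrite mulrAC [_ * z]mulrC -normCK expr2 mulfK ?normr_eq0.
Qed.

(** Carlson's inequality for odd indices: [carlson_form] with middle coefficients that continue
    the patterns of p and q. *)
Lemma carlson_odd a n : schur_seq a ->
  `|a n.*2.+1| <= 1 - \sum_(k < n.+1) `|a k| ^+ 2.
Proof.
move=> aS; have [u u1 uE] := unimodular_factor (a n.*2.+1).
have n1 : (n < n.*2.+1)%N by lia.
have := @carlson_form a n n.*2.+1 u (u * a n)^* (a n)^* aS n1 (leqnSn _) u1.
rewrite (gtn_eqF (ltnSn _)) andbF addr0.
have -> : a n * (u * (u * a n)^*) = `|a n| ^+ 2.
  rewrite rmorphM /= mulrA -[RHS]mul1r -(expr1n _ 2) -u1 !normCK; ring.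
rewrite -normCK uE !norm_conjC normrM u1 mul1r [X in _ -> _ <= _ - X]big_ord_recr /=.
set T := \sum_(k < n) _; set b := `|a n| ^+ 2; set A := `|a n.*2.+1|.
have T0 : 0 <= T by apply: sumr_ge0 => i _; rewrite exprn_ge0.
have b0 : 0 <= b by rewrite exprn_ge0.
rewrite ger0_norm ?addr_ge0 //; last by rewrite /A.
rewrite -subr_ge0 => h; rewrite -subr_ge0.
by apply: le_trans h _; apply: le_of_eq; field.
Qed.

(** Carlson's inequality for even indices. The middle coefficient belongs to both p and q; damping
    it by 1 / (1 + |a_0|) is optimal. *)
Lemma carlson_even a n : schur_seq a -> (0 < n)%N ->
  `|a n.*2| <= 1 - \sum_(k < n) `|a k| ^+ 2 - `|a n| ^+ 2 / (1 + `|a 0%N|).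
Proof.
move=> aS n0; have [u u1 uE] := unimodular_factor (a n.*2).
have u2 : u * u^* = 1 by rewrite -normCK u1 expr1n.
have n1 : (n < n.*2)%N by lia.
set S := \sum_(k < n) _; set A := `|a n.*2|; set b := `|a n|; set A0 := `|a 0%N|.
have S0 : 0 <= S by apply: sumr_ge0 => i _; rewrite exprn_ge0.
pose t := (1 + A0)^-1.
have A00 : 0 <= A0 by rewrite /A0.
have t0 : 0 < 1 + A0 by rewrite ltr_wpDr.
have tr : t^* = t by apply: CrealP; rewrite realV realD // normr_real.
have tge : 0 <= t by rewrite invr_ge0 ltW.
have := @carlson_form a n n.*2 u (t * (u * a n)^*) (t * (a n)^*) aS n1 (leqnn _) u1.
rewrite n0 eqxx /= uE -/S -/A.
rewrite !(normrM t) !norm_conjC normrM u1 mul1r (ger0_norm tge) -/b.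
have -> : S + (a n + a 0%N * (t * (u * a n)^*)) * (t * (a n)^*)
     + (S + a n * (u * (t * (u * a n)^*)) + A)
   = (S + S + A + t * b ^+ 2 *+ 2) + t ^+ 2 * (a 0%N * (u * a n)^* * (a n)^*).
  have -> : b ^+ 2 = a n * (a n)^* by rewrite /b normCK.
  have uc : u * (u * a n)^* = (a n)^* by rewrite rmorphM /= mulrA u2 mul1r.
  rewrite [u * (t * _)]mulrCA uc; ring.
set P := S + S + A + _; set Z := t ^+ 2 * _.
have P0 : 0 <= P.
  have Ag : 0 <= A by rewrite /A.
  have tb : 0 <= t * b ^+ 2 by rewrite mulr_ge0 ?exprn_ge0 // /b.
  by rewrite /P !addr_ge0.
have ZE : `|Z| = t ^+ 2 * (A0 * b ^+ 2).
  rewrite /Z normrM normrX (ger0_norm tge) !normrM !norm_conjC normrM u1 mul1r -/b -/A0.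
  by rewrite expr2; ring.
move=> h.
have {}h : P - `|Z| <= (S + (t * b) ^+ 2 + 1 + (S + (t * b) ^+ 2 + 1)) / 2.
  by apply: le_trans h; rewrite -[X in X - _](ger0_norm P0) lerB_normD.
move: h; rewrite ZE /P -subr_ge0 => h; rewrite -subr_ge0.
by apply: le_trans h _; apply: le_of_eq; rewrite /t; field; rewrite gt_eqF.
Qed.
End SchurSeq.

(** * Bounded power series in the disc *)

Section PowerSeries.
Local Open Scope classical_set_scope.
Local Open Scope complex_scope.
Local Open Scope ring_scope.
Variable R : realType.
Local Notation C := R[i].
Implicit Types (a : nat -> C) (f : C -> C) (z w : C).

Definition psum a n z : C := \sum_(k < n) a k * z ^+ k.

Lemma normE z : `|z| = (cabs z)%:C.
Proof. by []. Qed.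

Lemma cabs_ge0 z : 0 <= cabs z.
Proof. by rewrite -lecR -normE normr_ge0. Qed.

Lemma cabsM z w : cabs (z * w) = cabs z * cabs w.
Proof. by apply: complexI; rewrite rmorphM /= -!normE normrM. Qed.

Lemma cabsX z n : cabs (z ^+ n) = cabs z ^+ n.
Proof. by apply: complexI; rewrite rmorphXn /= -!normE normrX. Qed.

Lemma cabs_real (x : R) : cabs x%:C = `|x|.
Proof. by rewrite /= expr0n /= addr0 sqrtr_sqr. Qed.

Lemma ler_cabsD z w : cabs (z + w) <= cabs z + cabs w.
Proof. by rewrite -lecR rmorphD /= -!normE ler_normD. Qed.

Lemma ler_cabs_sum (I : Type) (r : seq I) (P : pred I) (F : I -> C) :
  cabs (\sum_(i <- r | P i) F i) <= \sum_(i <- r | P i) cabs (F i).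
Proof. by rewrite -lecR rmorph_sum /= -!normE; apply: ler_norm_sum. Qed.

Lemma cabsB z w : cabs (z - w) = cabs (w - z).
Proof. by apply: complexI; rewrite -!normE distrC. Qed.

Lemma cabsN z : cabs (- z) = cabs z.
Proof. by apply: complexI; rewrite -!normE normrN. Qed.

Lemma cvgC_dist (u : nat -> C) (l : C) : (u : nat -> C^o) @ \oo --> (l : C^o) ->
  forall e : R, 0 < e -> exists N, forall n, (N <= n)%N -> cabs (l - u n) < e.
Proof.
move=> /cvgrPdist_lt ul e e0.
have e0' : 0 < e%:C by rewrite ltcR.
have [N _ NP] := ul _ e0'.
by exists N => n Nn; have := NP n Nn; rewrite /= normE ltcR.
Qed.

Lemma psum_cvg a f z : power_series_in_disc a f -> cabs z < 1 ->
  forall e : R, 0 < e -> exists N, forall n, (N <= n)%N -> cabs (f z - psum a n z) < e.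
Proof.
move=> af z1 e e0; have [N NP] := cvgC_dist (af z z1) e0.
by exists N => n /NP; rewrite /psum /series /= big_mkord.
Qed.

(** The terms at the radius s = (1 + rho) / 2 are bounded because the series converges there, and
    rho / s is the ratio of the geometric majorant. *)
Lemma psum_cauchy_geo a f (rho : R) : power_series_in_disc a f -> 0 <= rho < 1 ->
  exists2 B : R, 0 <= B &
  exists2 t : R, 0 <= t < 1 & forall n, cabs (a n) * rho ^+ n <= B * t ^+ n.
Proof.
move=> af /andP[r0 r1]; pose s := (1 + rho) / 2.
have s0 : 0 < s by rewrite /s; lra.
have s1 : s < 1 by rewrite /s; lra.
have rs : rho < s by rewrite /s; lra.
have cs : cabs s%:C < 1 by rewrite cabs_real gtr0_norm.
have [N NP] := psum_cvg af cs (ltr01 : 0 < 1 :> R).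
exists (2 + \sum_(k < N) cabs (a k) * s ^+ k).
  by rewrite addr_ge0 // sumr_ge0 // => k _; rewrite mulr_ge0 ?cabs_ge0 // exprn_ge0 // ltW.
exists (rho / s); first by rewrite divr_ge0 // ?(ltW s0) //= ltr_pdivrMr // mul1r.
have h n : cabs (a n) * s ^+ n <= 2 + \sum_(k < N) cabs (a k) * s ^+ k.
  have p0 k : 0 <= cabs (a k) * s ^+ k by rewrite mulr_ge0 ?cabs_ge0 // exprn_ge0 // ltW.
  have [Nn|nN] := leqP N n; last first.
    rewrite (bigD1 (Ordinal nN)) //= addrCA lerDl addr_ge0 // sumr_ge0 // => k _.
  rewrite (@le_trans _ _ 2) //; last by rewrite lerDl sumr_ge0.
  have -> : cabs (a n) * s ^+ n = cabs (a n * s%:C ^+ n).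
    by rewrite cabsM cabsX cabs_real gtr0_norm.
  have -> : a n * s%:C ^+ n = (f s%:C - psum a n s%:C) - (f s%:C - psum a n.+1 s%:C).
    rewrite /psum big_ord_recr /=; ring.
  have := ler_cabsD (f s%:C - psum a n s%:C) (- (f s%:C - psum a n.+1 s%:C)).
  move=> /le_trans; apply; rewrite cabsN (_ : 2 = 1 + 1) //.
  by rewrite lerD // ltW // NP // (leq_trans Nn).
move=> n; rewrite expr_div_n mulrA ler_pdivlMr ?exprn_gt0 // mulrAC.
by rewrite ler_wpM2r // exprn_ge0.
Qed.

Lemma sum_geo_le (t : R) m n : 0 <= t < 1 ->
  \sum_(m <= k < n) t ^+ k <= t ^+ m / (1 - t).
Proof.
move=> /andP[t0 t1]; rewrite ler_pdivlMr ?subr_gt0 //.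
have [mn|/ltnW nm] := leqP m n; last by rewrite big_geq // mul0r exprn_ge0.
rewrite mulr_suml (eq_bigr (fun k => - t ^+ k.+1 - - t ^+ k)); last first.
  by move=> k _; rewrite exprS; ring.
by rewrite telescope_sumr // opprK addrC lerBlDr lerDl exprn_ge0.
Qed.

Lemma expr_lt_eps (t B e : R) : 0 <= t < 1 -> 0 < e -> exists N, forall n, (N <= n)%N ->
  B * t ^+ n < e.
Proof.
move=> /andP[t0 t1] e0.
have := @cvg_geometric R B t; rewrite ger0_norm // => /(_ t1) /cvgrPdist_lt /(_ _ e0).
case=> N _ NP; exists N => n /NP /=; rewrite sub0r normrN.
by apply: le_lt_trans; rewrite ler_norm.
Qed.

Lemma psum_ucvg a f (rho : R) : power_series_in_disc a f -> 0 <= rho < 1 ->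
  forall e : R, 0 < e -> exists N, forall n z, (N <= n)%N -> cabs z <= rho ->
    cabs (f z - psum a n z) < e.
Proof.
move=> af rho01 e e0.
have [B B0 [t t01 Bt]] := psum_cauchy_geo af rho01.
have e20 : 0 < e / 2 by rewrite divr_gt0.
have [N NP] := @expr_lt_eps t (B / (1 - t)) (e / 2) t01 e20.
exists N => n z Nn zr.
have z1 : cabs z < 1 by case/andP: rho01 => _; apply: le_lt_trans.
have [N' NP'] := psum_cvg af z1 e20.
pose m := maxn N' n.
rewrite (_ : f z - _ = (f z - psum a m z) + (psum a m z - psum a n z)); last by ring.
apply: le_lt_trans (ler_cabsD _ _) _; rewrite [e]splitr ltr_leD ?NP' ?leq_maxl //.
have -> : psum a m z - psum a n z = \sum_(n <= k < m) a k * z ^+ k.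
  rewrite /psum -!(big_mkord xpredT (fun k => a k * z ^+ k)).
  by rewrite [X in X - _](@big_cat_nat _ _ _ n) ?leq_maxr //= addrAC subrr add0r.
apply: le_trans (ler_cabs_sum _ _ _) _.
rewrite (@le_trans _ _ (\sum_(n <= k < m) B * t ^+ k)) //.
  apply: ler_sum => k _; apply: le_trans (Bt k); rewrite cabsM cabsX.
  by rewrite ler_wpM2l ?cabs_ge0 // lerXn2r ?nnegrE ?cabs_ge0 //; case/andP: rho01.
rewrite -mulr_sumr; apply: le_trans (ltW (NP n Nn)).
by rewrite -mulrA [_^-1 * _]mulrC ler_wpM2l // sum_geo_le.
Qed.

Lemma bernoulli_ineq (x : R) n : 0 <= x <= 1 -> 1 - n%:R * x <= (1 - x) ^+ n.
Proof.
move=> /andP[x0 x1]; elim: n => [|n IH]; first by rewrite mul0r subr0.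
rewrite exprS; apply: le_trans (ler_wpM2l _ IH); last by rewrite subr_ge0.
rewrite -subr_ge0 -[n.+1]addn1 natrD.
have -> : (1 - x) * (1 - n%:R * x) - (1 - (n%:R + 1) * x) = n%:R * (x * x) by ring.
by rewrite mulr_ge0 ?ler0n // mulr_ge0.
Qed.

Lemma cauchy_prod_coef a p M L i : (i < M)%N -> (M <= L)%N ->
  ((\poly_(n < L) a n) * (\poly_(n < M) p n))`_i = cauchy_prod a p i.
Proof.
move=> iM ML; rewrite coefMr; apply: eq_bigr => j _.
have jM : (j < M)%N by rewrite (leq_trans (ltn_ord j)).
rewrite !coef_poly jM (leq_trans _ ML) //.
by rewrite (leq_ltn_trans (leq_subr _ _) iM).
Qed.

(** For a polynomial this is [toeplitz_poly_le]. In general f (rho z) is uniformly approximated by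
    polynomials on the unit circle, and the form of a_n rho^n at p_j rho^j and q_i rho^-i is the
    form of a at p and q. *)
Theorem bounded_schur a f : power_series_in_disc a f ->
  (forall z, cabs z < 1 -> cabs (f z) <= 1) -> schur_seq a.
Proof.
move=> af f1 M p q.
pose P := \sum_(i < M) cabs (p i) ^+ 2; pose Q := \sum_(i < M) cabs (q i) ^+ 2.
have -> : \sum_(i < M) `|p i| ^+ 2 + \sum_(i < M) `|q i| ^+ 2 = (P + Q)%:C.
  by rewrite rmorphD !rmorph_sum /=; congr (_ + _); apply: eq_bigr => i _;
     rewrite rmorphXn.
have -> : (P + Q)%:C / 2 = ((P + Q) / 2)%:C.
  by rewrite rmorphM fmorphV /= rmorph_nat.
rewrite normE lecR; set X := cabs _.
have PQ0 : 0 <= (P + Q) / 2.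
  by rewrite divr_ge0 // addr_ge0 // sumr_ge0 // => i _; rewrite exprn_ge0 ?cabs_ge0.
suff key (e : R) : 0 < e -> X <= (1 + e) * (1 + e) * ((P + Q) / 2).
  apply/ler_addgt0Pr => e e0; pose c := (P + Q) / 2.
  have c1 : 0 < c + 1 by rewrite ltr_wpDl.
  pose d := Num.min 1 (e / (3 * (c + 1))).
  have d0 : 0 < d by rewrite lt_min ltr01 divr_gt0 // mulr_gt0.
  apply: le_trans (key d d0) _; rewrite -/c.
  have d1 : d <= 1 by rewrite ge_min lexx.
  have de : d * (3 * (c + 1)) <= e by rewrite -ler_pdivlMr ?mulr_gt0 // ge_min lexx orbT.
  have cd : 0 <= c * d by rewrite mulr_ge0 // ltW.
  have : c * d * d <= c * d by rewrite ler_piMr.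
  nra.
move=> e0.
(* a radius so close to 1 that rho^(-2M) <= 1 + e; passing from q_i to q_i rho^-i then
   costs at most that factor *)
pose x := e / ((1 + e) * (2 * M + 1)%:R); pose rho := 1 - x.
have m0 : 0 < (2 * M + 1)%:R :> R by rewrite ltr0n addn1.
have e1 : 0 < 1 + e by rewrite addr_gt0.
have x0 : 0 < x by rewrite divr_gt0 // mulr_gt0.
have xM : x * (2 * M + 1)%:R = e / (1 + e).
  by rewrite /x; field; rewrite !gt_eqF.
have ee : e / (1 + e) < 1 by rewrite ltr_pdivrMr // mul1r ltrDr.
have x1 : x < 1.
  apply: le_lt_trans ee; rewrite -xM ler_peMr ?(ltW x0) // ler1n addn1 //.
have rho01 : 0 <= rho < 1 by rewrite /rho; apply/andP; split; lra.
have rho0 : 0 < rho by rewrite /rho; lra.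
have rhoM k : (k <= 2 * M)%N -> 1 <= (1 + e) * rho ^+ k.
  move=> kM; rewrite mulrC -ler_pdivrMr // mul1r.
  have x01 : 0 <= x <= 1 by rewrite !ltW.
  apply: le_trans (bernoulli_ineq k x01).
  have : k%:R * x <= x * (2 * M + 1)%:R.
    by rewrite mulrC ler_wpM2l ?(ltW x0) // ler_nat; lia.
  rewrite xM => kx; rewrite lerBrDr; apply: le_trans (lerD (lexx _) kx) _.
  by rewrite -[X in X + _]mul1r -mulrDl divff // gt_eqF.
have [N NP] := psum_ucvg af rho01 e0.
pose L := maxn N M.
pose F : {poly C} := \poly_(n < L) (a n * rho%:C ^+ n).
have Fb u : `|u| = 1 -> `|F.[u]| <= (1 + e)%:C.
  rewrite normE => -[u1].
  have -> : F.[u] = psum a L (rho%:C * u).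
    by rewrite horner_poly; apply: eq_bigr => k _; rewrite exprMn mulrA.
  set z := _ * u; have zr : cabs z = rho by rewrite cabsM u1 mulr1 cabs_real gtr0_norm.
  rewrite normE lecR (_ : psum a L z = f z + - (f z - psum a L z)); last by ring.
  apply: le_trans (ler_cabsD _ _) _; rewrite cabsN lerD //.
    by rewrite f1 // zr; case/andP: rho01.
  by rewrite ltW // NP ?leq_maxl // zr.
pose p' j := p j * rho%:C ^+ j; pose q' j := q j / rho%:C ^+ j.
have rC : rho%:C != 0 by rewrite eq_complex /= gt_eqF.
have := @toeplitz_poly_le C (1 + e)%:C M F (\poly_(i < M) p' i) (\poly_(i < M) q' i) Fb
  (size_poly _ _) (size_poly _ _).
have coefP (g : nat -> C) (i : 'I_M) : (\poly_(i < M) g i)`_i = g i.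
  by rewrite coef_poly ltn_ord.
have -> : \sum_(i < M) (F * \poly_(i < M) p' i)`_i * Num.conj (\poly_(i < M) q' i)`_i
    = \sum_(i < M) cauchy_prod a p i * Num.conj (q i).
  apply: eq_bigr => i _; rewrite coefP cauchy_prod_coef ?leq_maxr //.
  have -> : cauchy_prod (fun n => a n * rho%:C ^+ n) p' i = cauchy_prod a p i * rho%:C ^+ i.
    rewrite /cauchy_prod mulr_suml; apply: eq_bigr => j _.
    rewrite /p' mulrACA -exprD subnK //.
    by rewrite -ltnS.
  rewrite /q' rmorphM fmorphV rmorphXn /=.
  have -> : Num.conj rho%:C = rho%:C by apply: CrealP; rewrite complex_real.
  by rewrite mulrACA divff ?mulr1 // expf_neq0.
rewrite normE -/X.
have -> : \sum_(i < M) `|(\poly_(i < M) p' i)`_i| ^+ 2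
    = (\sum_(i < M) cabs (p' i) ^+ 2)%:C.
  by rewrite rmorph_sum; apply: eq_bigr => i _; rewrite coefP rmorphXn.
have -> : \sum_(i < M) `|(\poly_(i < M) q' i)`_i| ^+ 2
    = (\sum_(i < M) cabs (q' i) ^+ 2)%:C.
  by rewrite rmorph_sum; apply: eq_bigr => i _; rewrite coefP rmorphXn.
have -> (u v w : R) : w%:C * ((u%:C + v%:C) / 2) = (w * ((u + v) / 2))%:C.
  by rewrite rmorphM rmorphM fmorphV /= rmorph_nat rmorphD.
rewrite lecR => /le_trans; apply; rewrite -mulrA ler_wpM2l ?(ltW e1) //.
rewrite mulrA ler_wpM2r ?invr_ge0 // mulrDr lerD //.
  rewrite mulr_sumr; apply: ler_sum => i _; rewrite cabsM cabsX cabs_real gtr0_norm //.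
  rewrite exprMn mulrC ler_wpM2r ?exprn_ge0 ?cabs_ge0 //.
  rewrite (@le_trans _ _ 1) ?lerDl ?(ltW e0) // !exprn_ile1 ?exprn_ge0 ?(ltW rho0) //.
  by case/andP: rho01 => _ /ltW.
rewrite mulr_sumr; apply: ler_sum => i _.
have rhoi : 0 < rho ^+ i by rewrite exprn_gt0.
have : cabs (q' i) * rho ^+ i = cabs (q i).
  have -> : rho ^+ i = cabs (rho%:C ^+ i) by rewrite cabsX cabs_real gtr0_norm.
  by rewrite -cabsM /q' divfK // expf_neq0.
move=> <-; rewrite exprMn mulrCA ler_peMr ?exprn_ge0 ?cabs_ge0 //.
by rewrite -exprM rhoM // mulnC leq_mul2l ltnW ?orbT.
Qed.

End PowerSeries.

(** * The Schwarz-Pick inequality *)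

Section Pick.
Variable R : realType.
Local Notation C := R[i].
Local Open Scope classical_set_scope.
Local Open Scope complex_scope.
Local Open Scope ring_scope.
Local Notation "z ^*" := (Num.conj z) : ring_scope.
Implicit Types (a : nat -> C) (f : C -> C) (z w x y : C).

Lemma cabs_conj z : cabs z^* = cabs z.
Proof. by apply: complexI; rewrite -!normE norm_conjC. Qed.

Lemma pick_norm_identity z w :
  cabs (1 - z * w^*) ^+ 2 - cabs (z - w) ^+ 2 = (1 - cabs z ^+ 2) * (1 - cabs w ^+ 2).
Proof.
by case: z w => [z1 z2] [w1 w2] /=; rewrite !sqr_sqrtr ?addr_ge0 ?sqr_ge0 //; ring.
Qed.

(** The transpose of a contraction is a contraction. *)
Lemma schur_dual a M (q : nat -> C) : schur_seq a ->
  \sum_(j < M) `|\sum_(i < M | (j <= i)%N) a (i - j)%N * q i| ^+ 2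
    <= \sum_(i < M) `|q i| ^+ 2.
Proof.
move=> aS.
pose p (j : nat) : C := (\sum_(i < M | (j <= i)%N) a (i - j)%N * q i)^*.
have := aS M p (fun i => (q i)^*).
have -> : \sum_(i < M) cauchy_prod a p i * ((q i)^*)^* = \sum_(i < M) `|p i| ^+ 2.
  transitivity (\sum_(i < M) \sum_(j < M | (j <= i)%N) a (i - j)%N * p j * q i).
    apply: eq_bigr => i _; rewrite conjCK /cauchy_prod mulr_suml.
    by rewrite (big_ord_widen M (fun j => a (i - j)%N * p j * q i)).
  rewrite (exchange_big_dep xpredT) //=; apply: eq_bigr => j _.
  rewrite normCK {2}/p conjCK mulr_sumr; apply: eq_bigr => i _; ring.
have -> : \sum_(j < M) `|\sum_(i < M | (j <= i)%N) a (i - j)%N * q i| ^+ 2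
    = \sum_(j < M) `|p j| ^+ 2.
  by apply: eq_bigr => j _; rewrite /p norm_conjC.
under [X in _ <= (_ + X) / _ -> _]eq_bigr do rewrite norm_conjC.
set s := \sum_(i < M) `|p i| ^+ 2; set t := \sum_(i < M) _.
have s0 : 0 <= s by apply: sumr_ge0 => i _; rewrite exprn_ge0.
rewrite ger0_norm // ler_pdivlMr // mulr_natr mulr2n lerD2l; exact.
Qed.

(** The transposed Toeplitz matrix maps the Szego kernel, a geometric sequence, to a multiple of
    itself by f (z), up to truncation. *)
Lemma dual_geo a M j z : (j <= M)%N ->
  \sum_(i < M | (j <= i)%N) a (i - j)%N * z ^+ i = z ^+ j * psum a (M - j) z.
Proof.
move=> jM; rewrite /psum mulr_sumr.
rewrite -(big_mkord (fun i => (j <= i)%N) (fun i => a (i - j)%N * z ^+ i)).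
rewrite (big_cat_nat (n := j)) //= big_nat_cond big1 ?add0r; last first.
  by move=> i /andP[/andP[_ ij]]; rewrite leqNgt ij.
rewrite -{1}[j]add0n big_addn big_mkord.
apply: eq_big => [i|i _]; first by rewrite leq_addl.
by rewrite addnK exprD; ring.
Qed.

Lemma pick_partial a M x y z w : schur_seq a ->
  \sum_(j < M) cabs (x * z ^+ j * psum a (M - j) z + y * w ^+ j * psum a (M - j) w) ^+ 2
    <= \sum_(i < M) cabs (x * z ^+ i + y * w ^+ i) ^+ 2.
Proof.
move=> aS; have := schur_dual M (fun i => x * z ^+ i + y * w ^+ i) aS.
rewrite -lecR !rmorph_sum /=.
under eq_bigr => j _.
  rewrite (_ : \sum_(i < M | _) _ = x * z ^+ j * psum a (M - j) z + y * w ^+ j * psum a (M - j) w).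
    over.
  rewrite -!mulrA -!dual_geo 1?ltnW // !mulr_sumr -big_split /=; apply: eq_bigr => i _.
  by ring.
under [X in X <= _ -> _]eq_bigr do rewrite normE -rmorphXn.
by under [X in _ <= X -> _]eq_bigr do rewrite normE -rmorphXn.
Qed.

(** The squared l^2 norm of the sequence x z^i + y w^i, that is, of a combination of two Szego
    kernels. *)
Definition szego x y z w : R :=
  cabs x ^+ 2 / (1 - cabs z ^+ 2) + cabs y ^+ 2 / (1 - cabs w ^+ 2)
  + 2 * complex.Re (x * y^* / (1 - z * w^*)).

(** Convergence in R[i] stated with moduli in R, where the order is total. *)
Definition ctends (u : nat -> C) (l : C) :=
  forall e : R, 0 < e -> exists N, forall n, (N <= n)%N -> cabs (l - u n) < e.

Lemma ctendsD u v l m : ctends u l -> ctends v m -> ctends (fun n => u n + v n) (l + m).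
Proof.
move=> ul vm e e0; have e2 : 0 < e / 2 by rewrite divr_gt0.
have [N NP] := ul _ e2; have [N' NP'] := vm _ e2.
exists (maxn N N') => n; rewrite geq_max => /andP[Nn N'n].
rewrite opprD addrACA; apply: le_lt_trans (ler_cabsD _ _) _.
by rewrite [e]splitr ltrD ?NP ?NP'.
Qed.

Lemma ctendsZ x u l : ctends u l -> ctends (fun n => x * u n) (x * l).
Proof.
move=> ul e e0; have c0 : 0 < cabs x + 1 by rewrite ltr_wpDl ?cabs_ge0.
have [N NP] := ul (e / (cabs x + 1)) (divr_gt0 e0 c0).
exists N => n /NP h; rewrite -mulrBr cabsM; apply: le_lt_trans (_ : _ <= (cabs x + 1) * cabs (l - u
  n)) _.
  by rewrite ler_wpM2r ?cabs_ge0 // lerDl.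
by rewrite mulrC -ltr_pdivlMr.
Qed.

Lemma ctends_shift u l j : ctends u l -> ctends (fun n => u (n - j)%N) l.
Proof.
move=> ul e e0; have [N NP] := ul e e0.
by exists (N + j)%N => n Nn; apply: NP; lia.
Qed.

Lemma ctends_cabs u l : ctends u l -> (fun n => cabs (u n)) @ \oo --> cabs l.
Proof.
move=> ul; apply/cvgrPdist_lt => e e0; have [N NP] := ul e e0.
exists N => // n /NP; apply: le_lt_trans.
have h1 := ler_cabsD (u n) (l - u n); have h2 := ler_cabsD l (u n - l).
move: h1 h2; rewrite ![_ + (_ - _)]addrC !subrK [cabs (u n - l)]cabsB => h1 h2.
by rewrite ler_norml; apply/andP; split; lra.
Qed.

Lemma Re_le_cabs z : `|complex.Re z| <= cabs z.
Proof. by case: z => p q /=; rewrite -sqrtr_sqr ler_wsqrtr // lerDl sqr_ge0. Qed.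

Lemma ctends_Re u l : ctends u l -> (fun n => complex.Re (u n)) @ \oo --> complex.Re l.
Proof.
move=> ul; apply/cvgrPdist_lt => e e0; have [N NP] := ul e e0.
exists N => // n /NP; apply: le_lt_trans.
by rewrite -raddfB Re_le_cabs.
Qed.

Lemma ctends_geo v : cabs v < 1 -> ctends (fun n => \sum_(i < n) v ^+ i) (1 - v)^-1.
Proof.
move=> v1 e e0.
have v10 : 1 - v != 0.
  by apply: contraTneq v1 => /subr0_eq <-; rewrite cabs_real normr1 ltxx.
have [|N NP] := @expr_lt_eps R (cabs v) (cabs (1 - v)^-1) e _ e0; first by rewrite cabs_ge0.
exists N => n /NP; rewrite -cabsX -cabsM; congr (cabs _ < _).
have E : (1 - v) * (\sum_(i < n) v ^+ i) = 1 - v ^+ n.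
  by rewrite -[1 - v]opprB mulNr -subrX1 opprB.
by apply: (mulfI v10); rewrite mulrBr E; field.
Qed.

Lemma cabs2D x y : cabs (x + y) ^+ 2 = cabs x ^+ 2 + cabs y ^+ 2 + 2 * complex.Re (x * y^*).
Proof.
case: x y => [x1 x2] [y1 y2] /=; rewrite !sqr_sqrtr ?addr_ge0 ?sqr_ge0 //.
by ring.
Qed.

Lemma szego_cvg x y z w : cabs z < 1 -> cabs w < 1 ->
  (fun n => \sum_(i < n) cabs (x * z ^+ i + y * w ^+ i) ^+ 2) @ \oo --> szego x y z w.
Proof.
move=> z1 w1.
have zw1 : cabs (z * w^*) < 1.
  rewrite cabsM.
  by rewrite cabs_conj mulr_ilt1 ?cabs_ge0.
rewrite (_ : (fun n => _) = (fun n => cabs x ^+ 2 * (\sum_(0 <= i < n) (cabs z ^+ 2) ^+ i)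
   + cabs y ^+ 2 * (\sum_(0 <= i < n) (cabs w ^+ 2) ^+ i)
   + 2 * complex.Re (x * y^* * \sum_(i < n) (z * w^*) ^+ i))); last first.
  apply/funext => n; rewrite !big_mkord !mulr_sumr raddf_sum /= mulr_sumr -!big_split /=.
  apply: eq_bigr => i _; rewrite cabs2D.
  have -> : x * z ^+ i * (y * w ^+ i)^* = x * y^* * (z * w^*) ^+ i.
    by rewrite rmorphM rmorphXn /= exprMn; ring.
  by rewrite !cabsM !cabsX ![(_ * cabs _ ^+ _) ^+ 2]exprMn -!exprM ![(i * 2)%N]mulnC.
have geo (t : R) : 0 <= t < 1 -> (fun n => \sum_(0 <= i < n) (t ^+ 2) ^+ i) @ \oo --> (1 - t ^+
  2)^-1.
  move=> /andP[t0 t1].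
  have := @cvg_geometric_series R 1 (t ^+ 2).
  rewrite ger0_norm ?exprn_ge0 // exprn_ilt1 // => /(_ isT); rewrite mul1r.
  rewrite (_ : series _ = (fun n => \sum_(0 <= i < n) (t ^+ 2) ^+ i)) //.
  by apply/funext => n; apply: eq_bigr => k _; rewrite /= mul1r.
apply: cvgD.
  by apply: cvgD; apply: cvgM; [exact: cvg_cst|apply: geo; rewrite cabs_ge0
    |exact: cvg_cst|apply: geo; rewrite cabs_ge0].
apply: cvgM; first exact: cvg_cst.
by apply: ctends_Re; apply: ctendsZ; apply: ctends_geo.
Qed.

(** Positivity of the Pick matrix of f at z and w: the limit of [pick_partial], first in M with
    finitely many terms on the left, then in their number. *)
Theorem pick_szego a f x y z w : power_series_in_disc a f -> schur_seq a ->
  cabs z < 1 -> cabs w < 1 -> szego (x * f z) (y * f w) z w <= szego x y z w.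
Proof.
move=> af aS z1 w1.
have le_szego M : \sum_(i < M) cabs (x * z ^+ i + y * w ^+ i) ^+ 2 <= szego x y z w.
  have cv := @szego_cvg x y z w z1 w1.
  rewrite -(cvg_lim _ cv) //; apply: nondecreasing_cvgn_le; last by apply: cvgP cv.
  by apply/nondecreasing_seqP => n; rewrite big_ord_recr /= lerDl exprn_ge0 ?cabs_ge0.
have le_fix J : \sum_(j < J) cabs (x * f z * z ^+ j + y * f w * w ^+ j) ^+ 2 <= szego x y z w.
  have cvJ : (fun M => \sum_(j < J) cabs (x * z ^+ j * psum a (M - j) z
        + y * w ^+ j * psum a (M - j) w) ^+ 2) @ \oo
      --> \sum_(j < J) cabs (x * f z * z ^+ j + y * f w * w ^+ j) ^+ 2.
    apply: cvg_big => [|j _]; first exact: add_continuous.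
    apply: (@continuous_cvg _ _ _ _ _ _ (fun t : R => t ^+ 2)); first exact: exprn_continuous.
    apply: ctends_cabs; rewrite ![x * f z * _]mulrAC ![y * f w * _]mulrAC.
    apply: ctendsD; apply: ctendsZ.
      by apply: (@ctends_shift (fun n => psum a n z)); apply: psum_cvg.
    by apply: (@ctends_shift (fun n => psum a n w)); apply: psum_cvg.
  apply: (cvgr_to_le cvJ).
  exists J => // M /= JM; apply: le_trans (le_szego M).
  apply: le_trans (pick_partial M x y z w aS).
  rewrite (big_ord_widen M (fun j => cabs (x * z ^+ j * psum a (M - j) z
        + y * w ^+ j * psum a (M - j) w) ^+ 2) JM) big_mkcond /=.
  by apply: ler_sum => j _; case: ifP => // _; rewrite exprn_ge0 ?cabs_ge0.
apply: (cvgr_to_le (@szego_cvg (x * f z) (y * f w) z w z1 w1)).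
by exists 0%N => // J _; apply: le_fix.
Qed.

(** The 2 x 2 Pick matrix is positive semidefinite. The test vectors x = - s (conj c), y = t,
    where c is its off-diagonal entry, turn this into a real quadratic form in s and t, and its
    discriminant condition is the inequality by [pick_norm_identity]. *)
Theorem schwarz_pick a f z w : power_series_in_disc a f -> schur_seq a ->
  (forall z, cabs z < 1 -> cabs (f z) <= 1) -> cabs z < 1 -> cabs w < 1 ->
  cabs (f z - f w) * cabs (1 - z * w^*) <= cabs (z - w) * cabs (1 - f z * (f w)^*).
Proof.
move=> af aS f1 z1 w1.
have dz : 0 < 1 - cabs z ^+ 2 by rewrite subr_gt0 exprn_ilt1 ?cabs_ge0.
have dw : 0 < 1 - cabs w ^+ 2 by rewrite subr_gt0 exprn_ilt1 ?cabs_ge0.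
have nz : 0 <= 1 - cabs (f z) ^+ 2 by rewrite subr_ge0 exprn_ile1 ?cabs_ge0 ?f1.
have nw : 0 <= 1 - cabs (f w) ^+ 2 by rewrite subr_ge0 exprn_ile1 ?cabs_ge0 ?f1.
have id2 := pick_norm_identity.
have Q0 : 0 < cabs (1 - z * w^*) ^+ 2.
  by rewrite -[X in 0 < X](subrK (cabs (z - w) ^+ 2)) id2 ltr_wpDr ?exprn_ge0 ?cabs_ge0 // mulr_gt0.
have [c cdef] : exists c : C, c = (1 - f z * (f w)^*) / (1 - z * w^*) by eexists.
pose A := (1 - cabs (f z) ^+ 2) / (1 - cabs z ^+ 2).
pose B := (1 - cabs (f w) ^+ 2) / (1 - cabs w ^+ 2).
have A0 : 0 <= A by rewrite divr_ge0 // ltW.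
have B0 : 0 <= B by rewrite divr_ge0 // ltW.
have form (s t : R) : 0 <= s ^+ 2 * cabs c ^+ 2 * A + t ^+ 2 * B - 2 * (s * t * cabs c ^+ 2).
  have := @pick_szego a f ((- s)%:C * c^*) t%:C z w af aS z1 w1.
  rewrite /szego -subr_ge0 !cabsM !cabs_real normrN.
  rewrite cabs_conj.
  rewrite !exprMn !real_normK ?num_real // => h; apply: le_trans h _.
  set X1 := complex.Re _; set X2 := complex.Re _.
  have -> : X2 = X1 + s * t * cabs c ^+ 2.
    suff : X1 - X2 = - (s * t * cabs c ^+ 2) by lra.
    have tc : (t%:C)^* = t%:C by apply: CrealP; rewrite complex_real.
    rewrite /X1 /X2 -raddfB rmorphM tc -mulrBl.
    rewrite (_ : (_ - _) / _ = (- (s * t))%:C * (c * c^*)).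
      by rewrite -normCK normE -rmorphXn -rmorphM /= mulNr.
    set k := c^*; rewrite cdef !rmorphN !rmorphM /= tc; ring.
  rewrite le_eqVlt; apply/orP; left; apply/eqP; rewrite /A /B.
  by field; rewrite !gt_eqF.
have cAB : cabs c ^+ 2 <= A * B.
  have [->|c0] := eqVneq (cabs c) 0; first by rewrite expr0n mulr_ge0.
  have c2 : 0 < cabs c ^+ 2 by rewrite exprn_gt0 // lt_neqAle eq_sym c0 cabs_ge0.
  have [BE|Bn0] := eqVneq B 0.
    have := form 1 (A + 1); rewrite BE; nra.
  have Bp : 0 < B by rewrite lt_neqAle eq_sym Bn0.
  have := form B (cabs c ^+ 2); rewrite -(pmulr_rge0 _ Bp) => h.
  rewrite -subr_ge0 -(pmulr_rge0 _ Bp) -(pmulr_rge0 _ c2).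
  move: h; rewrite (pmulr_rge0 _ Bp); nra.
rewrite -(@ler_pXn2r _ 2) ?nnegrE ?mulr_ge0 ?cabs_ge0 // !exprMn.
have := id2 z w; have := id2 (f z) (f w).
have cE : cabs c ^+ 2 * cabs (1 - z * w^*) ^+ 2 = cabs (1 - f z * (f w)^*) ^+ 2.
  rewrite -exprMn -cabsM cdef divfK //.
  by apply: contraTneq Q0 => ->; rewrite cabs_real normr0 expr0n ltxx.
have AE : A * (1 - cabs z ^+ 2) = 1 - cabs (f z) ^+ 2 by rewrite divfK // gt_eqF.
have BE : B * (1 - cabs w ^+ 2) = 1 - cabs (f w) ^+ 2 by rewrite divfK // gt_eqF.
rewrite -AE -BE.
set P := cabs (1 - f z * _) ^+ 2; set Q := cabs (1 - z * _) ^+ 2.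
set p := cabs (f z - f w) ^+ 2; set q := cabs (z - w) ^+ 2.
move=> h1 h2.
have h3 : P * (Q - q) <= (P - p) * Q.
  rewrite h1 h2 /P -cE -/Q.
  have : cabs c ^+ 2 * (Q * ((1 - cabs z ^+ 2) * (1 - cabs w ^+ 2))) <= A * B * (Q * ((1 - cabs z ^+
    2) * (1 - cabs w ^+ 2))).
    by rewrite ler_wpM2r // mulr_ge0 ?(ltW Q0) // mulr_ge0 // ltW.
  by move=> /le_trans h; rewrite (_ : _ * _ * _ = cabs c ^+ 2 * (Q * ((1 - cabs z ^+ 2) * (1 - cabs
    w ^+ 2)))); [apply: h; rewrite le_eqVlt; apply/orP; left; apply/eqP; ring|ring].
lra.
Qed.
End Pick.

(** * Derivatives of power series *)

Section Derivative.
Variable R : realType.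
Local Notation C := R[i].
Local Open Scope classical_set_scope.
Local Open Scope complex_scope.
Local Open Scope ring_scope.
Implicit Types (a : nat -> C) (f : C -> C) (z w x y : C).

Lemma natexp_le (x : R) n : 0 <= x < 1 -> n.+1%:R * x ^+ n <= (1 - x)^-1.
Proof.
move=> x01; have /andP[x0 x1] := x01.
have -> : n.+1%:R * x ^+ n = \sum_(0 <= k < n.+1) x ^+ n.
  by rewrite sumr_const_nat subn0 mulr_natl.
apply: le_trans (_ : \sum_(0 <= k < n.+1) x ^+ k <= _).
  rewrite !big_mkord; apply: ler_sum => k _.
  by rewrite ler_wiXn2l ?(ltW x1) // -ltnS.
by have := @sum_geo_le R x 0 n.+1 x01; rewrite expr0 mul1r.
Qed.

(** With x = t^4, two factors t^n absorb (n + 1)^2 and the remaining t^2 is the new ratio. *)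
Lemma natexp2_le (x : R) : 0 <= x < 1 -> exists2 B : R, 0 <= B &
  exists2 t : R, 0 <= t < 1 & forall n, n.+1%:R ^+ 2 * x ^+ n <= B * t ^+ n.
Proof.
move=> /andP[x0 x1]; pose s := Num.sqrt x; pose t := Num.sqrt s.
have s0 : 0 <= s by rewrite sqrtr_ge0.
have t0 : 0 <= t by rewrite sqrtr_ge0.
have s1 : s < 1 by rewrite -sqrtr1 ltr_sqrt.
have t1 : t < 1 by rewrite -sqrtr1 ltr_sqrt.
exists ((1 - t)^-1 ^+ 2); first by rewrite exprn_ge0 // invr_ge0 subr_ge0 ltW.
exists s; first by rewrite s0.
move=> n.
have -> : n.+1%:R ^+ 2 * x ^+ n = (n.+1%:R * t ^+ n) ^+ 2 * s ^+ n.
  rewrite -(sqr_sqrtr x0) -/s -(sqr_sqrtr s0) -/t ![_ ^+ 2 ^+ n]exprAC.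
  by ring.
rewrite ler_wpM2r ?exprn_ge0 // lerXn2r ?nnegrE ?mulr_ge0 ?exprn_ge0 //.
  by rewrite invr_ge0 subr_ge0 ltW.
by rewrite natexp_le // t0.
Qed.

Lemma ctends_series (c : nat -> C) (B t : R) : 0 <= t < 1 ->
  (forall n, cabs (c n) <= B * t ^+ n) -> exists l, ctends (fun n => \sum_(i < n) c i) l.
Proof.
move=> t01 cB; have /andP[t0 t1] := t01.
have cvp (p : C -> R) : (forall z, `|p z| <= cabs z) -> cvgn (series (p \o c)).
  move=> pc; apply: normed_cvg; apply: (@series_le_cvg _ _ (geometric B t)).
  - by move=> n /=.
  - by move=> n; apply: le_trans (cB n); exact: cabs_ge0.
  - by move=> n; apply: le_trans (cB n); apply: pc.
  - by apply: is_cvg_geometric_series; rewrite ger0_norm.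
have cr := cvp _ (@Re_le_cabs R).
have Im_le z : `|complex.Im z| <= cabs z.
  by case: z => p q /=; rewrite -sqrtr_sqr ler_wsqrtr // lerDr sqr_ge0.
have ci := cvp _ Im_le.
exists (limn (series (@complex.Re R \o c)) +i* limn (series (@complex.Im R \o c))).
move=> e e0; have e2 : 0 < e / 2 by rewrite divr_gt0.
have /cvgrPdist_lt /(_ _ e2) [N _ NP] := cr.
have /cvgrPdist_lt /(_ _ e2) [N' _ N'P] := ci.
exists (maxn N N') => n; rewrite geq_max => /andP[/NP /= h1 /N'P /= h2].
set l1 := limn _ in h1 *; set l2 := limn _ in h2 *.
have le_cabs (p q : R) : cabs (p +i* q) <= `|p| + `|q|.
  rewrite -[`|q|](normr_id) -[X in _ + X]mul1r.
  have -> : p +i* q = p%:C + 'i * q%:C by simpc.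
  apply: le_trans (ler_cabsD _ _) _; rewrite cabsM !cabs_real lerD //.
  by rewrite /= expr0n /= add0r expr1n sqrtr1 normr_id.
have -> : l1 +i* l2 - \sum_(i < n) c i
  = (l1 - series (@complex.Re R \o c) n) +i* (l2 - series (@complex.Im R \o c) n).
  rewrite /series /= !big_mkord -!raddf_sum /=.
  by case: (\sum_(i < n) c i) => p q.
by apply: le_lt_trans (le_cabs _ _) _; rewrite [e]splitr ltrD.
Qed.

Definition dseq a n : C := n.+1%:R * a n.+1.

Lemma cabs_nat n : cabs (n%:R : C) = n%:R.
Proof. by rewrite -(rmorph_nat (real_complex R)) cabs_real ger0_norm. Qed.

(** Induction on n from (z + h)^(n+1) = (z + h) (z + h)^n. Multiplying by rho^2 keeps all
    exponents natural. *)
Lemma taylor_remainder z h (rho : R) n : 0 < rho -> cabs z <= rho -> cabs (z + h) <= rho ->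
  rho ^+ 2 * cabs ((z + h) ^+ n - z ^+ n - n%:R * h * z ^+ n.-1)
   <= cabs h ^+ 2 * (n%:R ^+ 2 * rho ^+ n).
Proof.
move=> r0 zr zhr; elim: n => [|n IH].
  by rewrite !expr0 mul0r mul0r subrr subr0 cabs_real normr0 mulr0 expr0n mul0r mulr0.
have -> : (z + h) ^+ n.+1 - z ^+ n.+1 - n.+1%:R * h * z ^+ n.+1.-1
  = (z + h) * ((z + h) ^+ n - z ^+ n - n%:R * h * z ^+ n.-1) + n%:R * h ^+ 2 * z ^+ n.-1.
  case: n {IH} => [|n] /=; first by rewrite !expr1 !expr0; ring.
  have -> : n.+2%:R = n.+1%:R + 1 :> C by rewrite -addn1 natrD.
  by rewrite ![_ ^+ n.+2]exprS ![_ ^+ n.+1]exprS; set p := (z + h) ^+ n; ring.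
apply: le_trans (_ : _ <= rho ^+ 2 * (rho * cabs ((z + h) ^+ n - z ^+ n - n%:R * h * z ^+ n.-1)
     + n%:R * cabs h ^+ 2 * rho ^+ n.-1)) _.
  rewrite ler_wpM2l ?exprn_ge0 ?(ltW r0) //; apply: le_trans (ler_cabsD _ _) _.
  rewrite !cabsM cabs_nat !cabsX lerD // ?ler_wpM2r ?cabs_ge0 //.
  rewrite ler_wpM2l ?mulr_ge0 ?exprn_ge0 ?cabs_ge0 //.
  by rewrite lerXn2r ?nnegrE ?cabs_ge0 ?(ltW r0).
rewrite mulrDr mulrCA; apply: le_trans (lerD (ler_wpM2l (ltW r0) IH) (lexx _)) _.
have -> : rho ^+ 2 * (n%:R * cabs h ^+ 2 * rho ^+ n.-1) = cabs h ^+ 2 * (n%:R * rho ^+ n.+1).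
  case: n {IH} => [|n] /=; first by ring.
  by rewrite !exprS; ring.
rewrite mulrCA -mulrDr ler_wpM2l ?exprn_ge0 ?cabs_ge0 //.
rewrite mulrCA -exprS -mulrDl ler_wpM2r ?exprn_ge0 ?(ltW r0) //.
have n0 : 0 <= n%:R :> R by [].
rewrite -[n.+1]addn1 natrD; nra.
Qed.

(** Term by term, [taylor_remainder] bounds the second order remainder by a convergent series. *)
Lemma power_series_taylor a f z : power_series_in_disc a f -> (forall n, cabs (a n) <= 1) ->
  cabs z < 1 -> exists2 g, ctends (fun n => psum (dseq a) n z) g &
  exists2 K : R, 0 <= K & forall h, cabs h <= (1 - cabs z) / 2 ->
     cabs (f (z + h) - f z - h * g) <= K * cabs h ^+ 2.
Proof.
move=> af a1 z1; pose rho := (1 + cabs z) / 2.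
have z0 := cabs_ge0 z.
have rho0 : 0 < rho by rewrite /rho; lra.
have rho1 : rho < 1 by rewrite /rho; lra.
have zrho : cabs z <= rho by rewrite /rho; lra.
have rho01 : 0 <= rho < 1 by rewrite ltW.
have [B B0 [t t01 Bt]] := natexp2_le rho01.
have [|g gP] := @ctends_series (fun n => dseq a n * z ^+ n) B t t01.
  move=> n; apply: le_trans (Bt n); rewrite !cabsM cabs_nat cabsX.
  apply: ler_pM; rewrite ?mulr_ge0 ?exprn_ge0 ?cabs_ge0 //; last first.
    by rewrite lerXn2r ?nnegrE ?cabs_ge0 ?(ltW rho0).
  rewrite expr2; apply: ler_pM; rewrite ?cabs_ge0 //.
  by apply: le_trans (a1 _) _; rewrite ler1n.
exists g => //.
have /andP[t0 t1] := t01.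
exists (rho ^- 2 * (B / (1 - t))).
  by rewrite mulr_ge0 ?invr_ge0 ?exprn_ge0 ?(ltW rho0) // divr_ge0 // subr_ge0 ltW.
move=> h hr.
have zhr : cabs (z + h) <= rho.
  by apply: le_trans (ler_cabsD _ _) _; apply: le_trans (lerD (lexx _) hr) _; rewrite /rho; lra.
have zh1 : cabs (z + h) < 1 := le_lt_trans zhr rho1.
have lim : ctends (fun n => psum a n.+1 (z + h) + (- 1 * psum a n.+1 z + - h * psum (dseq a) n z))
   (f (z + h) + (- 1 * f z + - h * g)).
  have shift u : cabs u < 1 -> ctends (fun n => psum a n.+1 u) (f u).
    move=> u1 e e0; have [N NP] := psum_cvg af u1 e0; exists N => n Nn; apply: NP; exact: leqW.
  apply: ctendsD; first exact: shift.
  by apply: ctendsD; apply: ctendsZ => //; apply: shift.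
have -> : f (z + h) - f z - h * g = f (z + h) + (- 1 * f z + - h * g) by ring.
apply: (cvgr_to_le (ctends_cabs lim)).
exists 0%N => // n _ /=.
have -> : psum a n.+1 (z + h) + (- 1 * psum a n.+1 z + - h * psum (dseq a) n z)
   = \sum_(k < n.+1) a k * ((z + h) ^+ k - z ^+ k - k%:R * h * z ^+ k.-1).
  have -> : psum (dseq a) n z = \sum_(k < n.+1) k%:R * a k * z ^+ k.-1.
    by rewrite [RHS]big_ord_recl !mul0r add0r /=; apply: eq_bigr.
  rewrite /psum !mulr_sumr -!big_split /=; apply: eq_bigr => k _; ring.
apply: le_trans (ler_cabs_sum _ _ _) _.
apply: le_trans (_ : _ <= \sum_(k < n.+1) rho ^- 2 * (cabs h ^+ 2 * (B * t ^+ k))) _.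
  apply: ler_sum => k _; rewrite cabsM ler_pdivlMl ?exprn_gt0 //.
  apply: le_trans (_ : _ <= rho ^+ 2 * cabs ((z + h) ^+ k - z ^+ k - k%:R * h * z ^+ k.-1)) _.
    by rewrite ler_wpM2l ?exprn_ge0 ?(ltW rho0) // ler_piMl ?cabs_ge0.
  apply: le_trans (taylor_remainder k rho0 zrho zhr) _.
  rewrite ler_wpM2l ?exprn_ge0 ?cabs_ge0 //; apply: le_trans (Bt k).
  by rewrite ler_wpM2r ?exprn_ge0 ?(ltW rho0) // lerXn2r ?nnegrE // ler_nat.
have -> : \sum_(k < n.+1) rho ^- 2 * (cabs h ^+ 2 * (B * t ^+ k))
    = rho ^- 2 * (B * \sum_(k < n.+1) t ^+ k) * cabs h ^+ 2.
  by rewrite !mulr_sumr mulr_suml; apply: eq_bigr => k _; ring.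
rewrite ler_wpM2r ?exprn_ge0 ?cabs_ge0 // ler_wpM2l ?invr_ge0 ?exprn_ge0 ?(ltW rho0) //.
rewrite ler_wpM2l //.
by have := @sum_geo_le R t 0 n.+1 t01; rewrite expr0 mul1r big_mkord.
Qed.

Lemma cderiv_unique f z g (K : R) (d : R) : 0 < d ->
  (forall h, cabs h <= d -> cabs (f (z + h) - f z - h * g) <= K * cabs h ^+ 2) ->
  cderiv f z = g.
Proof.
move=> d0 fK; rewrite /cderiv /derive1; apply: (@cvg_lim C^o); first exact: norm_hausdorff.
apply/cvgrPdist_lt => e e0.
have eR : e = (complex.Re e)%:C by rewrite RRe_real // gtr0_real.
rewrite eR ltcR in e0.
pose m := Num.min d (complex.Re e / (`|K| + 1)).
have K1 : 0 < `|K| + 1 by rewrite ltr_wpDl.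
have m0 : 0 < m by rewrite lt_min d0 divr_gt0.
have m0' : 0 < m%:C by rewrite ltcR.
near=> h.
have h0 : h != 0 by near: h; exact: nbhs_dnbhs_neq.
have hm : cabs h < m.
  by rewrite -ltcR -normE; near: h; apply: dnbhs0_lt.
rewrite /= eR normE ltcR.
have -> : g - h^-1 * (f (h + z) - f z) = - (h^-1 * (f (z + h) - f z - h * g)).
  by rewrite [h + z]addrC; field.
rewrite cabsN cabsM.
have ch : 0 < cabs h by rewrite -ltcR -normE normr_gt0.
have -> : cabs h^-1 = (cabs h)^-1 by apply: complexI; rewrite fmorphV -!normE normfV.
rewrite mulrC ltr_pdivrMr //.
have hd : cabs h <= d by apply: ltW; apply: lt_le_trans hm _; rewrite ge_min lexx.
apply: le_lt_trans (fK h hd) _; rewrite expr2 mulrA ltr_pM2r //.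
have he : cabs h < complex.Re e / (`|K| + 1) by apply: lt_le_trans hm _; rewrite ge_min lexx orbT.
rewrite ltr_pdivlMr // in he; apply: le_lt_trans he.
by rewrite mulrC ler_wpM2l ?cabs_ge0 //; apply: le_trans (ler_norm _) _; rewrite lerDl.
Unshelve. all: by end_near.
Qed.

Theorem power_series_deriv a f : power_series_in_disc a f -> (forall n, cabs (a n) <= 1) ->
  forall z, cabs z < 1 -> ctends (fun n => psum (dseq a) n z) (cderiv f z).
Proof.
move=> af a1 z z1; have [g gP [K K0 fK]] := power_series_taylor af a1 z1.
by rewrite (cderiv_unique _ fK) // divr_gt0 // subr_gt0.
Qed.

(** The limit of [schwarz_pick] along real increments h of z; the second order bound of
    [power_series_taylor] makes the limit quantitative. *)
Theorem schwarz_pick_deriv a f z : power_series_in_disc a f -> schur_seq a ->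
  (forall z, cabs z < 1 -> cabs (f z) <= 1) -> cabs z < 1 ->
  cabs (cderiv f z) * (1 - cabs z ^+ 2) <= 1 - cabs (f z) ^+ 2.
Proof.
move=> af aS f1 z1.
have a1 n : cabs (a n) <= 1 by rewrite -lecR -normE schur_le1.
have [g gP [K K0 fK]] := power_series_taylor af a1 z1.
have d0 : 0 < (1 - cabs z) / 2 by rewrite divr_gt0 // subr_gt0.
rewrite (cderiv_unique d0 fK).
set G := cabs g; have G0 : 0 <= G := cabs_ge0 _.
have z0 := cabs_ge0 z; have fz0 := cabs_ge0 (f z); have fz1 := f1 z z1.
apply/ler_addgt0Pr => e e0.
pose D := 3 * (K + G + 1); have D0 : 0 < D by rewrite mulr_gt0 // ltr_wpDl // addr_ge0.
pose t := Num.min ((1 - cabs z) / 2) (Num.min 1 (e / D)).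
have t0 : 0 < t by rewrite !lt_min d0 ltr01 divr_gt0.
have td : t <= (1 - cabs z) / 2 by rewrite ge_min lexx.
have t1 : t <= 1 by rewrite !ge_min lexx orbT.
have te : t * D <= e by rewrite -ler_pdivlMr // !ge_min lexx !orbT.
pose h := t%:C; have hE : cabs h = t by rewrite cabs_real gtr0_norm.
have := fK h; rewrite hE => /(_ td) fh.
have w1 : cabs (z + h) < 1.
  by apply: le_lt_trans (ler_cabsD _ _) _; rewrite hE; lra.
have := schwarz_pick af aS f1 w1 z1.
rewrite (_ : z + h - z = h); last by ring.
rewrite hE => sp.
have cc := @cabs_conj R.
have sq (u : C) : u * Num.conj u = (cabs u ^+ 2)%:C by rewrite -normCK normE rmorphXn.
have b1 : t * G <= cabs (f (z + h) - f z) + K * t ^+ 2.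
  rewrite -hE /G -cabsM -[h * g](subKr (f (z + h) - f z)).
  apply: le_trans (ler_cabsD _ _) _; rewrite cabsN hE lerD2l //.
have b2 : 1 - cabs z ^+ 2 - t <= cabs (1 - (z + h) * Num.conj z).
  have := ler_cabsD (1 - (z + h) * Num.conj z) (h * Num.conj z).
  rewrite (_ : _ + h * _ = 1 - z * Num.conj z); last by ring.
  rewrite sq -[1]/(1%:C) -rmorphB cabs_real cabsM hE cc => h1.
  have : 1 - cabs z ^+ 2 <= `|1 - cabs z ^+ 2| by rewrite ler_norm.
  have : t * cabs z <= t by rewrite ler_piMr ?(ltW t0) // ltW.
  lra.
have b3 : cabs (1 - f (z + h) * Num.conj (f z)) <= 1 - cabs (f z) ^+ 2 + cabs (f (z + h) - f z).
  rewrite (_ : 1 - _ = (1 - f z * Num.conj (f z)) + - ((f (z + h) - f z) * Num.conj (f z))); last by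
    ring.
  apply: le_trans (ler_cabsD _ _) _; rewrite sq -[1]/(1%:C) -rmorphB cabs_real cabsN cabsM cc.
  rewrite ger0_norm ?subr_ge0 ?exprn_ile1 // lerD2l ler_piMr ?cabs_ge0 //.
have b4 : cabs (f (z + h) - f z) <= t * G + K * t ^+ 2.
  rewrite -[f (z + h) - f z](subrK (h * g)) addrC.
  by apply: le_trans (ler_cabsD _ _) _; rewrite cabsM hE lerD2l.
set F := cabs (f (z + h) - f z) in b1 b3 b4 sp.
have F0 : 0 <= F := cabs_ge0 _.
set P := cabs (1 - f (z + h) * _) in b3 sp; set Q := cabs (1 - (z + h) * _) in b2 sp.
(* t G Q <= (F + K t^2) Q <= t P + K t^2 Q, and Q <= 2 *)
have Q2 : Q <= 2.
  apply: le_trans (ler_cabsD _ _) _; rewrite cabsN cabsM cc -[1]/(1%:C) cabs_real normr1.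
  by rewrite lerD2l mulr_ile1 ?cabs_ge0 // ltW.
have Q0 : 0 <= Q := cabs_ge0 _.
have c1 : G * Q <= P + K * t * Q.
  rewrite -(ler_pM2l t0) mulrA; apply: le_trans (ler_wpM2r Q0 b1) _.
  by rewrite mulrDl mulrDr expr2 !mulrA [t * K]mulrC; apply: lerD.
have c2 : G * (1 - cabs z ^+ 2 - t) <= G * Q by rewrite ler_wpM2l.
have tG : 0 <= t * G by rewrite mulr_ge0 // ltW.
have tK : 0 <= K * t by rewrite mulr_ge0 // ltW.
have c3 : K * t * Q <= K * t * 2 by rewrite ler_wpM2l.
have c4 : K * t ^+ 2 <= K * t by rewrite ler_wpM2l // expr2 ler_piMr ?(ltW t0).
rewrite /D in te; lra.
Qed.

End Derivative.

(** * Rotation invariance of planar measure *)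

Section Planar.
Variable R : realType.
Local Open Scope classical_set_scope.
Local Open Scope complex_scope.
Local Open Scope ring_scope.
Local Notation T := (measurableTypeR R).
Local Notation leb := (@lebesgue_measure R).
Local Notation mu2 := (leb \x leb)%E.

Lemma leb_shift (c : R) (A : set T) : measurable A ->
  leb ((fun y : T => y + c : T) @^-1` A) = leb A.
Proof.
move=> mA.
have mf : measurable_fun [set: T] (fun y : T => y + c : T).
  by apply: measurable_funD.
apply/esym.
apply: (lebesgue_measure_unique (mu := (pushforward leb (fun y : T => y + c : T)))) => //.
move=> _ [[a b]] _ <- /=.
rewrite -[RHS]/(leb ((fun y : T => y + c : T) @^-1` `]a, b]%classic)).
have -> : (fun y : T => y + c : T) @^-1` `]a, b] = `]a - c, b - c]%classic.
  by apply/seteqP; split => x /=; rewrite !in_itv /= => /andP[h1 h2]; apply/andP; split; lra.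
rewrite !lebesgue_measure_itv /= !lte_fin ltrD2r.
by case: ifP => // _; rewrite -!EFinB; congr (_%:E); ring.
Qed.

Let swap2 (p : T * T) : T * T := (p.2, p.1).

Let mswap : measurable_fun [set: T * T] swap2.
Proof.
by apply/measurable_fun_pairP; split; [exact: measurable_snd|exact: measurable_fst].
Qed.

Lemma mu2_swap (A : set (T * T)) : measurable A -> mu2 (swap2 @^-1` A) = mu2 A.
Proof.
move=> mA; apply/esym.
apply: (product_measure_unique (m' := (pushforward mu2 swap2))) => //.
move=> B1 B2 mB1 mB2 /=.
rewrite -[LHS]/(mu2 (swap2 @^-1` (B1 `*` B2))).
have -> : swap2 @^-1` (B1 `*` B2) = B2 `*` B1.
  by apply/seteqP; split => -[x y] /= [].
by rewrite product_measure1E // muleC.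
Qed.

Definition shear_y (k : R) (p : T * T) : T * T := (p.1, p.2 + k * p.1).
Definition shear_x (k : R) (p : T * T) : T * T := (p.1 + k * p.2, p.2).

Lemma measurable_shear_y k : measurable_fun [set: T * T] (shear_y k).
Proof.
apply/measurable_fun_pairP; split; first exact: measurable_fst.
apply: measurable_funD; first exact: measurable_snd.
by apply: measurable_funM => //; exact: measurable_fst.
Qed.

Lemma measurable_shear_x k : measurable_fun [set: T * T] (shear_x k).
Proof.
apply/measurable_fun_pairP; split; last exact: measurable_snd.
apply: measurable_funD; first exact: measurable_fst.
by apply: measurable_funM => //; exact: measurable_snd.
Qed.

Lemma mu2_shear_y k (A : set (T * T)) : measurable A -> mu2 (shear_y k @^-1` A) = mu2 A.
Proof.
move=> mA; rewrite /product_measure1; apply: eq_integral => x _ /=.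
rewrite -[RHS](leb_shift (k * x)); last exact: measurable_xsection.
congr (leb _); apply/seteqP; split => y /=; rewrite !xsectionE /=; exact.
Qed.

Lemma mu2_shear_x k (A : set (T * T)) : measurable A -> mu2 (shear_x k @^-1` A) = mu2 A.
Proof.
move=> mA; rewrite -[RHS](mu2_swap mA) -[RHS](mu2_shear_y k); last first.
  by rewrite -[X in measurable X]setTI; exact: mswap.
rewrite -[RHS]mu2_swap; last first.
  rewrite -[X in measurable X]setTI; apply: measurable_shear_y => //.
  by rewrite -[X in measurable X]setTI; exact: mswap.
by congr (mu2 _); apply/seteqP; split => -[x y].
Qed.

Definition rotation (c s : R) (p : T * T) : T * T := (c * p.1 - s * p.2, s * p.1 + c * p.2).

Lemma rot_shears c s p : c ^+ 2 + s ^+ 2 = 1 -> c != -1 ->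
  rotation c s p = shear_x (- (s / (1 + c))) (shear_y s (shear_x (- (s / (1 + c))) p)).
Proof.
move=> cs c1; have c0 : 1 + c != 0 by rewrite addrC addr_eq0.
have st : s / (1 + c) * s = 1 - c.
  apply: (mulfI c0); rewrite !mulrA [(1 + c) * s]mulrC mulfK // -[s * s]expr2.
  by have -> : s ^+ 2 = 1 - c ^+ 2; [rewrite -cs addrAC subrr add0r|ring].
case: p => x y; rewrite /rotation /shear_x /shear_y /=.
set t := s / (1 + c) in st *.
have tc : t * (1 + c) = s by rewrite /t divfK.
congr (_, _).
  have -> : x + - t * y + - t * (y + s * (x + - t * y))
      = c * x - s * y + (1 - c - t * s) * (x - t * y) + (s - t * (1 + c)) * y by ring.
  by rewrite st tc !subrr !mul0r !addr0.
have -> : y + s * (x + - t * y) = s * x + (1 - t * s) * y by ring.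
by rewrite st subKr.
Qed.

(** A rotation other than the half turn is a product of three shears, and a shear translates each
    section. *)
Lemma mu2_rot c s (A : set (T * T)) : c ^+ 2 + s ^+ 2 = 1 -> c != -1 -> measurable A ->
  mu2 (rotation c s @^-1` A) = mu2 A.
Proof.
move=> cs c1 mA; pose k := - (s / (1 + c)).
have -> : rotation c s @^-1` A = shear_x k @^-1` (shear_y s @^-1` (shear_x k @^-1` A)).
  by apply/seteqP; split => p /=; rewrite rot_shears.
have m1 : measurable (shear_x k @^-1` A).
  by rewrite -[X in measurable X]setTI; exact: measurable_shear_x.
have m2 : measurable (shear_y s @^-1` (shear_x k @^-1` A)).
  by rewrite -[X in measurable X]setTI; exact: measurable_shear_y.
by rewrite mu2_shear_x // mu2_shear_y // mu2_shear_x.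
Qed.

Lemma measurable_rot c s : measurable_fun [set: T * T] (rotation c s).
Proof.
apply/measurable_fun_pairP; split.
  by apply: measurable_funB; apply: measurable_funM.
by apply: measurable_funD; apply: measurable_funM.
Qed.

Lemma integral_rot c s (f : T * T -> \bar R) : c ^+ 2 + s ^+ 2 = 1 -> c != -1 ->
  measurable_fun [set: T * T] f -> (forall p, 0 <= f p)%E ->
  (\int[mu2]_p f (rotation c s p) = \int[mu2]_p f p)%E.
Proof.
move=> cs c1 mf f0.
have := @ge0_integral_pushforward _ _ _ _ R (rotation c s) (measurable_rot c s) mu2 setT f
  measurableT mf (fun p _ => f0 p).
rewrite preimage_setT => <-.
by apply: eq_measure_integral => [|? A mA _]; [exact: measurable_rot|exact: mu2_rot].
Qed.

End Planar.

(** * The measure of a disc *)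

Section Disc.
Variable R : realType.
Local Open Scope classical_set_scope.
Local Open Scope complex_scope.
Local Open Scope ring_scope.
Local Notation T := (measurableTypeR R).
Local Notation leb := (@lebesgue_measure R).
Local Notation mu2 := (leb \x leb)%E.

(** Substitution of x = t sin u. *)
Lemma integral_half_circle (t : R) : 0 < t ->
  (\int[leb]_(x in `[(- t)%R, t]) (2 * Num.sqrt (t ^+ 2 - x ^+ 2))%:E = (pi * t ^+ 2)%:E)%E.
Proof.
move=> t0; pose F (x : R) := t * sin x.
have p0 : 0 < pi / 2 :> R by have /andP[] := @pihalf_02 R.
have dF (x : R) : is_derive x 1 F (t * cos x).
  by rewrite /F; apply: is_derive_eq.
have dFE : derive1 F = fun x : R => t * cos x.
  by apply/funext => x; rewrite derive1E (@derive_val _ _ _ _ _ _ _ (dF x)).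
have Fc : continuous F.
  by move=> x; apply/differentiable_continuous/derivable1_diffP; case: (dF x).
have Fc' : continuous (fun x : R => t * cos x).
  by move=> x; apply: cvgM; [exact: cvg_cst|exact: continuous_cos].
have FB : F (- (pi / 2)) = - t by rewrite /F sinN sin_pihalf mulrN mulr1.
have FA : F (pi / 2) = t by rewrite /F sin_pihalf mulr1.
have lt_p : - (pi / 2) < pi / 2 :> R by lra.
rewrite -{1}FB -{1}FA.
rewrite (@integration_by_substitution_increasing R F (fun x => 2 * Num.sqrt (t ^+ 2 - x ^+ 2))) //.
- pose H (x : R) := t ^+ 2 * (x + sin x * cos x).
  have dH (x : R) : is_derive x 1 H (2 * t ^+ 2 * cos x ^+ 2).
    rewrite /H; apply: is_derive_eq; rewrite /GRing.scale /=.
    by have := cos2sin2 x; nra.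
  have Hc : continuous H.
    by move=> x; apply/differentiable_continuous/derivable1_diffP; case: (dH x).
  transitivity ((\int[leb]_(x in `[(- (pi / 2))%R, (pi / 2)%R]) (2 * t ^+ 2 * cos x ^+ 2)%:E)%E).
    apply: eq_integral => x; rewrite inE /= in_itv /= => xp; congr (_%:E).
    rewrite dFE -[LHS]/(2 * Num.sqrt (t ^+ 2 - (t * sin x) ^+ 2) * (t * cos x)).
    rewrite exprMn -{1}[t ^+ 2]mulr1 -mulrBr -cos2sin2.
    rewrite sqrtrM ?sqr_ge0 // !sqrtr_sqr (ger0_norm (ltW t0)) ger0_norm ?cos_ge0_pihalf //.
    by ring.
  rewrite (@continuous_FTC2 R _ H) //.
  + by rewrite -EFinB /H sinN cosN cos_pihalf !mulr0 !addr0; congr (_%:E); field.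
  + apply: continuous_subspaceT => x; apply: cvgM; first exact: cvg_cst.
    by apply: (@continuous_cvg _ _ _ _ _ _ (fun t : R => t ^+ 2)); [exact: exprn_continuous|exact:
      continuous_cos].
  + split; first by move=> x _; case: (dH x).
      by apply: cvg_at_right_filter; apply: Hc.
    by apply: cvg_at_left_filter; apply: Hc.
  + by move=> x _; rewrite derive1E (@derive_val _ _ _ _ _ _ _ (dH x)).
- by rewrite ltW.
- by move=> x y xp yp xy; rewrite /F ltr_pM2l // ltr_sin.
- by move=> x _; rewrite dFE; apply: Fc'.
- rewrite dFE; apply/cvg_ex; exists (t * cos (- (pi / 2))).
  by apply: cvg_at_right_filter; apply: Fc'.
- rewrite dFE; apply/cvg_ex; exists (t * cos (pi / 2)).
  by apply: cvg_at_left_filter; apply: Fc'.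
- split; first by move=> x _; case: (dF x).
    by apply: cvg_at_right_filter; apply: Fc.
  by apply: cvg_at_left_filter; apply: Fc.
- apply: continuous_subspaceT => x; apply: cvgM; first exact: cvg_cst.
  apply: continuous_cvg; first exact: sqrt_continuous.
  by apply: cvgB; [exact: cvg_cst|exact: exprn_continuous].
Qed.

Definition sqnorm (p : T * T) : R := p.1 ^+ 2 + p.2 ^+ 2.

Lemma measurable_sqnorm : measurable_fun [set: T * T] (sqnorm : T * T -> T).
Proof. by apply: measurable_funD; apply: measurable_funX. Qed.

Lemma measurable_disc (b : R) : measurable [set p : T * T | sqnorm p <= b].
Proof.
rewrite -[X in measurable X]setTI.
rewrite (_ : [set p | _] = (sqnorm : T * T -> T) @^-1` `]-oo, b]%classic).
  by apply: measurable_sqnorm.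
by apply/seteqP; split => p /=; rewrite in_itv.
Qed.

Lemma mu2_disc (b : R) : 0 <= b -> mu2 [set p : T * T | sqnorm p <= b] = (pi * b)%:E.
Proof.
move=> b0; rewrite /product_measure1.
pose t := Num.sqrt b; have tb : t ^+ 2 = b by rewrite sqr_sqrtr.
have sec x : leb (xsection [set p : T * T | sqnorm p <= b] x)
    = (2 * Num.sqrt (b - x ^+ 2))%:E.
  have [xb|bx] := leP (x ^+ 2) b.
    have bx0 : 0 <= b - x ^+ 2 by rewrite subr_ge0.
    rewrite (_ : xsection _ _ = `[- Num.sqrt (b - x ^+ 2), Num.sqrt (b - x ^+ 2)]%classic).
      rewrite lebesgue_measure_itv /= lte_fin; case: ltP => h.
        by rewrite -EFinB; congr (_%:E); ring.
      by congr (_%:E); have := sqrtr_ge0 (b - x ^+ 2); lra.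
    apply/seteqP; split => y; rewrite xsectionE /= in_itv /= -ler_norml /sqnorm /=.
      by move=> h; rewrite -(@ler_pXn2r _ 2) ?nnegrE // sqr_sqrtr // real_normK ?num_real //; lra.
    by rewrite -(@ler_pXn2r _ 2) ?nnegrE // sqr_sqrtr // real_normK ?num_real //; lra.
  rewrite (_ : xsection _ _ = set0).
    by rewrite measure0 ler0_sqrtr ?mulr0 //; lra.
  apply/seteqP; split => // y; rewrite xsectionE /sqnorm /= => h.
  by have := sqr_ge0 y; lra.
transitivity (\int[leb]_x (2 * Num.sqrt (b - (x : R) ^+ 2))%:E)%E.
  by apply: eq_integral => x _; exact: sec.
move: b0; rewrite le_eqVlt => /predU1P[b0|b0].
  rewrite integral0_eq ?mulr0 -?b0 ?mulr0 // => x _.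
  by rewrite ler0_sqrtr ?mulr0 // sub0r oppr_le0 sqr_ge0.
have t0 : 0 < t by rewrite sqrtr_gt0.
rewrite -tb -integral_half_circle // [RHS]integral_mkcond.
apply: eq_integral => x _; rewrite patchE; case: ifPn => //.
rewrite notin_setE /= in_itv /= -ler_norml => /negP; rewrite -ltNge => h.
rewrite ler0_sqrtr ?mulr0 // subr_le0 -[x ^+ 2]real_normK ?num_real //.
by rewrite lerXn2r ?nnegrE ?(ltW t0) // ltW.
Qed.

End Disc.

(** * Radial integrals *)

Section Radial.
Variable R : realType.
Local Open Scope classical_set_scope.
Local Open Scope complex_scope.
Local Open Scope ring_scope.
Local Notation T := (measurableTypeR R).
Local Notation leb := (@lebesgue_measure R).
Local Notation mu2 := (leb \x leb)%E.
Local Notation sq := (@sqnorm R : T * T -> T).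

Lemma mu2_annulus (a b : R) : a <= b ->
  mu2 (sq @^-1` `]a, b]%classic) = (pi * (Num.max 0 b - Num.max 0 a))%:E.
Proof.
have disc c : mu2 [set p : T * T | sqnorm p <= c] = (pi * Num.max 0 c)%:E.
  have [c0|c0] := leP 0 c; first exact: mu2_disc.
  rewrite mulr0 (_ : [set p | _] = set0) ?measure0 //.
  apply/seteqP; split => // p /= h.
  by have := addr_ge0 (sqr_ge0 p.1) (sqr_ge0 p.2); rewrite -/(sqnorm p); lra.
move=> ab; rewrite (_ : _ @^-1` _ =
  [set p : T * T | sqnorm p <= b] `\` [set p : T * T | sqnorm p <= a]); last first.
  apply/seteqP; split => p /=; rewrite in_itv /=.
    by move=> /andP[h1 h2]; split => //; apply/negP; rewrite -ltNge.
  by move=> [h1 /negP]; rewrite -ltNge h1 => ->.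
have fin : (mu2 [set p : T * T | (sqnorm p <= b)%R] < +oo)%E by rewrite disc ltry.
transitivity (mu2 [set p : T * T | (sqnorm p <= b)%R] -
    mu2 ([set p : T * T | (sqnorm p <= b)%R] `&` [set p : T * T | (sqnorm p <= a)%R]))%E.
  by apply: measureD => //; exact: measurable_disc.
rewrite (_ : _ `&` _ = [set p : T * T | sqnorm p <= a]).
  by rewrite !disc -EFinB -mulrBr.
by apply/seteqP; split => p /=; [case|move=> h; split => //; apply: le_trans ab].
Qed.

(** The law of the squared norm is pi times Lebesgue measure on [0, +oo[, because this holds for
    intervals by [mu2_annulus]. The uniqueness theorem is for measures on the whole line, so the
    law divided by pi is completed by Lebesgue measure on the negative half line. *)
Lemma radial_law (A : set T) : measurable A -> A `<=` `[0, +oo[%classic ->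
  mu2 (sq @^-1` A) = (pi%:E * leb A)%E.
Proof.
move=> mA A0.
have pi0 := @pi_gt0 R.
have pV0 : 0 <= pi^-1 :> R by rewrite invr_ge0 ltW.
pose k : {nonneg R} := NngNum pV0.
have mN : measurable (`]-oo, 0[%classic : set T) by [].
have mS := @measurable_sqnorm R.
pose nu : {measure set T -> \bar R} :=
  measure_function_pushforward__canonical__measure_function_Measure mu2 mS.
pose m : {measure set T -> \bar R} := measure_add (mscale k nu) (mrestr leb mN).
have mE B : m B = (k%:num%:E * mu2 (sq @^-1` B) + leb (B `&` `]-oo, 0%R[%classic))%E.
  exact: (measure_addE (mscale k nu) (mrestr leb mN) B).
have lebE : leb A = m A.
  apply: lebesgue_measure_unique => // _ [[a b]] _ <- /=.
  rewrite mE; have [ab|ba] := leP a b; last first.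
    by rewrite set_itv_ge ?preimage_set0 ?set0I ?measure0 ?mule0 ?adde0 //= bnd_simp -leNgt ltW.
  rewrite mu2_annulus // -EFinM mulrA mulVf ?gt_eqF // mul1r.
  have [b0|b0] := ltP b 0.
    rewrite (_ : _ `&` _ = `]a, b]%classic).
      by rewrite !max_l ?subrr ?add0e //; lra.
    by apply/seteqP; split => x /=; rewrite !in_itv /=; [case|move=> /andP[h1 h2]; split;
      [exact/andP|lra]].
  have [a0|a0] := ltP a 0.
    rewrite (_ : _ `&` _ = `]a, 0[%classic); last first.
      apply/seteqP; split => x /=; rewrite !in_itv /=.
        by move=> [/andP[h1 h2] h3]; exact/andP.
      by move=> /andP[h1 h2]; split => //; apply/andP; split => //; lra.
    rewrite !lebesgue_measure_itv /= !lte_fin a0 (lt_le_trans a0 b0).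
    by rewrite -!EFinB -EFinD; congr (_%:E); ring.
  rewrite (_ : _ `&` _ = set0); last first.
    by apply/seteqP; split => // x /=; rewrite !in_itv /= => -[/andP[h1 h2] h3]; lra.
  rewrite measure0 adde0 lebesgue_measure_itv /= lte_fin.
  by case: ltP => // h; congr (_%:E); lra.
rewrite lebE mE (_ : A `&` _ = set0); last first.
  apply/seteqP; split => // x /= [/A0] /=; rewrite !in_itv /= andbT => h1 h2; lra.
by rewrite measure0 adde0 muleA -EFinM /= divff ?gt_eqF // mul1e.
Qed.

Lemma integral_expn (b : R) n : 0 < b ->
  (\int[leb]_(x in `[0%R, b]) (x ^+ n)%:E = (b ^+ n.+1 / n.+1%:R)%:E)%E.
Proof.
move=> b0; pose H (x : R) := n.+1%:R^-1 * x ^+ n.+1.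
have dH (x : R) : is_derive x 1 H (x ^+ n).
  pose p : {poly R} := n.+1%:R^-1 *: 'X^(n.+1).
  have -> : H = horner p by apply/funext => y; rewrite /H /p hornerZ hornerXn.
  have -> : x ^+ n = p^`().[x].
    by rewrite /p derivZ derivXn hornerZ hornerMn hornerXn -[X in _ * X]mulr_natl mulKf ?pnatr_eq0.
  exact: is_derive_poly.
have Hc : continuous H.
  by move=> x; apply/differentiable_continuous/derivable1_diffP; case: (dH x).
rewrite (@continuous_FTC2 R _ H) //.
- by rewrite -EFinB /H expr0n mulr0 subr0 mulrC.
- by apply: continuous_subspaceT; exact: exprn_continuous.
- split; first by move=> x _; case: (dH x).
    by apply: cvg_at_right_filter; apply: Hc.
  by apply: cvg_at_left_filter; apply: Hc.
- by move=> x _; rewrite derive1E (@derive_val _ _ _ _ _ _ _ (dH x)).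
Qed.

Lemma integral_radial (b : R) n : 0 < b ->
  (\int[mu2]_(p in [set p : T * T | (sqnorm p < b)%R]) (sqnorm p ^+ n)%:E
    = (pi * (b ^+ n.+1 / n.+1%:R))%:E)%E.
Proof.
move=> b0; have mS := @measurable_sqnorm R.
have mX : measurable_fun (`[0%R, b[%classic : set T) (fun x : T => ((x : R) ^+ n)%:E).
  by apply/measurable_EFinP; apply: measurable_funX.
have -> : [set p : T * T | (sqnorm p < b)%R] = sq @^-1` `[0%R, b[%classic.
  apply/seteqP; split => p /=; rewrite in_itv /=; last by case/andP.
  by move=> ->; rewrite andbT addr_ge0 // sqr_ge0.
have := @ge0_integral_pushforward _ _ _ _ R sq mS mu2 `[0%R, b[%classic
  (fun x : T => ((x : R) ^+ n)%:E).
rewrite /comp => <- //; last first.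
  by move=> x; rewrite inE /= in_itv /= => /andP[x0 _]; rewrite lee_fin exprn_ge0.
pose k : {nonneg R} := NngNum (pi_ge0 R).
rewrite (eq_measure_integral (mscale k leb)).
  rewrite ge0_integral_mscale //; last first.
    by move=> x /=; rewrite in_itv /= => /andP[x0 _]; rewrite lee_fin exprn_ge0.
  by rewrite integral_itv_bndo_bndc // integral_expn // -EFinM.
move=> A mA AD; rewrite /= /mscale /=; apply: radial_law => //.
by move=> x /AD /=; rewrite !in_itv /= andbT => /andP[].
Qed.

End Radial.

(** * The area integral of a power series *)

Section Area.
Variable R : realType.
Local Notation C := R[i].
Local Open Scope classical_set_scope.
Local Open Scope complex_scope.
Local Open Scope ring_scope.
Local Notation T := (measurableTypeR R).
Local Notation leb := (@lebesgue_measure R).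
Local Notation mu2 := (leb \x leb)%E.
Implicit Types (b : nat -> C) (g : C -> C).

Definition point_of (p : T * T) : C := p.1 +i* p.2.

Definition cmeasurable (h : T * T -> C) :=
  measurable_fun [set: T * T] (fun p => complex.Re (h p) : T)
  /\ measurable_fun [set: T * T] (fun p => complex.Im (h p) : T).

Lemma cmeasurable_cst (c : C) : cmeasurable (fun=> c).
Proof. by split; exact: measurable_cst. Qed.

Lemma cmeasurable_point_of : cmeasurable point_of.
Proof. by split; [exact: measurable_fst|exact: measurable_snd]. Qed.

Lemma cmeasurableD h1 h2 : cmeasurable h1 -> cmeasurable h2 ->
  cmeasurable (fun p => h1 p + h2 p).
Proof.
move=> [m1 m1'] [m2 m2']; split; under eq_fun do rewrite raddfD;
  exact: measurable_funD.
Qed.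

Lemma cmeasurableM h1 h2 : cmeasurable h1 -> cmeasurable h2 ->
  cmeasurable (fun p => h1 p * h2 p).
Proof.
move=> [m1 m1'] [m2 m2']; split.
  rewrite (_ : (fun _ => _) = (fun p => (complex.Re (h1 p) * complex.Re (h2 p)
     - complex.Im (h1 p) * complex.Im (h2 p)) : T)).
    by apply: measurable_funB; apply: measurable_funM.
  by apply/funext => p; case: (h1 p) (h2 p) => [x y] [u v].
rewrite (_ : (fun _ => _) = (fun p => (complex.Re (h1 p) * complex.Im (h2 p)
   + complex.Im (h1 p) * complex.Re (h2 p)) : T)).
  by apply: measurable_funD; apply: measurable_funM.
by apply/funext => p; case: (h1 p) (h2 p) => [x y] [u v].
Qed.

Lemma cmeasurableX h n : cmeasurable h -> cmeasurable (fun p => h p ^+ n).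
Proof.
move=> mh; elim: n => [|n IH].
  by under eq_fun do rewrite expr0; exact: cmeasurable_cst.
by under eq_fun do rewrite exprS; exact: cmeasurableM.
Qed.

Lemma cmeasurable_psum b n : cmeasurable (fun p => psum b n (point_of p)).
Proof.
elim: n => [|n IH]; rewrite /psum.
  by under eq_fun do rewrite big_ord0; exact: cmeasurable_cst.
under eq_fun do rewrite big_ord_recr /=.
apply: cmeasurableD => //; apply: cmeasurableM; first exact: cmeasurable_cst.
exact: cmeasurableX cmeasurable_point_of.
Qed.

Lemma measurable_cabs2 h : cmeasurable h ->
  measurable_fun [set: T * T] (fun p => cabs (h p) ^+ 2 : T).
Proof.
move=> [m1 m2].
rewrite (_ : (fun _ => _) = (fun p => (complex.Re (h p) ^+ 2 + complex.Im (h p) ^+ 2) : T)).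
  by apply: measurable_funD; apply: measurable_funX.
by apply/funext => p; case: (h p) => x y /=; rewrite sqr_sqrtr // addr_ge0 // sqr_ge0.
Qed.

Lemma sqnorm_point_of p : sqnorm p = cabs (point_of p) ^+ 2.
Proof. by case: p => x y /=; rewrite sqr_sqrtr // addr_ge0 // sqr_ge0. Qed.

Lemma cabs_lt_sqnorm (r : R) p : 0 <= r -> (cabs (point_of p) < r) = (sqnorm p < r ^+ 2).
Proof. by move=> r0; rewrite sqnorm_point_of ltr_pXn2r // nnegrE ?cabs_ge0. Qed.

Lemma measurable_odisc (r : R) : 0 <= r -> measurable [set p : T * T | cabs (point_of p) < r].
Proof.
move=> r0; rewrite -[X in measurable X]setTI.
rewrite (_ : [set p | _] = (@sqnorm R : T * T -> T) @^-1` `]-oo, r ^+ 2[%classic).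
  by apply: measurable_sqnorm.
by apply/seteqP; split => p /=; rewrite in_itv /= cabs_lt_sqnorm.
Qed.

Lemma point_of_rot (c s : R) p : point_of (rotation c s p) = (c +i* s) * point_of p.
Proof. by case: p => x y; rewrite /point_of /rotation /=; simpc; rewrite [c * y + _]addrC. Qed.

Lemma integral_iter_rot (c s : R) k (f : T * T -> \bar R) :
  c ^+ 2 + s ^+ 2 = 1 -> c != -1 ->
  measurable_fun [set: T * T] f -> (forall p, 0 <= f p)%E ->
  (\int[mu2]_p f (iter k (rotation c s) p) = \int[mu2]_p f p)%E.
Proof.
move=> cs c1; elim: k f => // k IH f mf f0.
rewrite -[RHS](integral_rot cs c1 mf f0).
rewrite -[RHS](IH (fun p => f (rotation c s p))) //.
by apply: measurableT_comp => //; exact: measurable_rot.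
Qed.

Lemma mean_psum b N n (w z : C) : n.-primitive_root w -> (N <= n)%N ->
  \sum_(k < n) cabs (psum b N (w ^+ k * z)) ^+ 2
    = n%:R * \sum_(i < N) cabs (b i) ^+ 2 * (cabs z ^+ 2) ^+ i.
Proof.
move=> wn Nn; apply: complexI.
pose P : {poly C} := \poly_(i < N) (b i * z ^+ i).
have sP : (size P <= n)%N := leq_trans (size_poly _ _) Nn.
have := mean_norm2 wn sP.
rewrite rmorph_sum rmorphM rmorph_nat rmorph_sum /= => E.
rewrite (eq_bigr (fun k : 'I_n => `|P.[w ^+ k]| ^+ 2)); last first.
  move=> k _; rewrite rmorphXn /= -normE horner_poly /psum.
  by congr (`|_| ^+ 2); apply: eq_bigr => i _; rewrite exprMn mulrAC mulrA.
rewrite E; congr (_ * _).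
rewrite [RHS](big_ord_widen n (fun i => (cabs (b i) ^+ 2 * (cabs z ^+ 2) ^+ i)%:C) Nn).
rewrite [RHS]big_mkcond /=; apply: eq_bigr => i _; rewrite coef_poly; case: ifP => _.
  by rewrite normE -rmorphXn cabsM cabsX exprMn -!exprM mulnC.
by rewrite normr0 expr0n.
Qed.

(** The second part excludes the half turn, which has no decomposition into shears of the form
    used in [rot_shears]. *)
Lemma prim_root_rotation n (w : C) : n.-primitive_root w -> (2 < n)%N ->
  complex.Re w ^+ 2 + complex.Im w ^+ 2 = 1 /\ complex.Re w != -1.
Proof.
move=> wn n2.
have w1 : complex.Re w ^+ 2 + complex.Im w ^+ 2 = 1.
  by apply: complexI; rewrite add_Re2_Im2 (prim_root_norm wn) expr1n.
split => //; apply/eqP => wr.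
have wi : complex.Im w = 0.
  by move: w1; rewrite wr sqrrN expr1n -[X in _ = X]addr0 => /addrI /eqP; rewrite sqrf_eq0 => /eqP.
have w2 : w ^+ 2 = 1.
  by rewrite [w]complexE wr wi rmorph0 mulr0 addr0 rmorphN rmorph1 sqrrN expr1n.
have /(_ 2%N) := prim_order_dvd wn; rewrite w2 eqxx.
by move=> n2d; have := dvdn_leq (isT : (0 < 2)%N) n2d; rewrite leqNgt n2.
Qed.

(** By rotation invariance the integrand may be replaced by its mean over the rotations by the
    n-th roots of unity, n > N, which is a polynomial in the squared norm. *)
Lemma area_psum b N (r : R) : 0 < r ->
  (\int[mu2]_(p in [set p : T * T | (cabs (point_of p) < r)%R]) (cabs (psum b N (point_of p)) ^+
    2)%:E
   = (\sum_(i < N) cabs (b i) ^+ 2 * (pi * (r ^+ 2) ^+ i.+1 / i.+1%:R))%:E)%E.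
Proof.
move=> r0; set D := [set p | _].
have mD : measurable D by apply: measurable_odisc; exact: ltW.
have [n n2] : exists n, n = N.+3 by eexists.
have n_gt0 : (0 < n)%N by rewrite n2.
have n_gt2 : (2 < n)%N by rewrite n2.
have Nn : (N <= n)%N by rewrite n2; lia.
move=> {n2}.
have [w wn] := @prim_root_exists C n n_gt0.
have [cs c1] := prim_root_rotation wn n_gt2.
pose rw := rotation (complex.Re w) (complex.Im w).
have zrw k p : point_of (iter k rw p) = w ^+ k * point_of p.
  elim: k => [|k IH]; first by rewrite mul1r.
  by rewrite iterS point_of_rot IH exprS mulrA; congr (_ * _ * _); case: (w).
have wk k : cabs (w ^+ k) = 1.
  by apply: complexI; rewrite -normE normrX (prim_root_norm wn) expr1n.
pose F0 p := (cabs (psum b N (point_of p)) ^+ 2)%:E.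
have mF0 : measurable_fun [set: T * T] F0.
  by apply/measurable_EFinP; apply: measurable_cabs2; exact: cmeasurable_psum.
pose F := F0 \_ D.
have mF : measurable_fun [set: T * T] F.
  by apply/(measurable_restrictT _ mD); exact: measurable_funS mF0.
have F_ge0 p : (0 <= F p)%E.
  by rewrite /F patchE; case: ifP => // _; rewrite lee_fin exprn_ge0 // cabs_ge0.
have mrw k : measurable_fun [set: T * T] (iter k rw).
  elim: k => [|k IH] /=; first exact: measurable_id.
  by apply: measurableT_comp => //; exact: measurable_rot.
have FE k p : F (iter k rw p) = ((cabs (psum b N (w ^+ k * point_of p)) ^+ 2)%:E * (\1_D p)%:E)%E.
  rewrite /F patchE indicE /F0 zrw.
  have -> : (iter k rw p \in D) = (p \in D).
    have Dz q : (q \in D) = (cabs (point_of q) < r) by apply/idP/idP; rewrite inE.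
    by rewrite !Dz zrw cabsM wk mul1r.
  by case: ifP; rewrite ?mule1 ?mule0.
have step : (n%:R%:E * \int[mu2]_p F p
    = n%:R%:E * (\sum_(i < N) cabs (b i) ^+ 2 * (pi * (r ^+ 2) ^+ i.+1 / i.+1%:R))%:E)%E.
  transitivity (\sum_(k < n) \int[mu2]_p F (iter k rw p))%E.
    rewrite (eq_bigr (fun=> \int[mu2]_p F p)%E); last first.
      by move=> k _; exact: (integral_iter_rot k cs c1 mF F_ge0).
    have I0 : (0 <= \int[mu2]_p F p)%E by apply: integral_ge0 => p _; exact: F_ge0.
    elim: (n) => [|m IH]; first by rewrite big_ord0 mul0e.
    by rewrite big_ord_recr /= -IH -natr1 EFinD ge0_muleDl ?mul1e // lee_fin.
  have mFk (k : 'I_n) : measurable_fun [set: T * T] (fun p => F (iter k rw p)).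
    by apply: measurableT_comp; [exact: mF|exact: mrw].
  have Fk0 (k : 'I_n) p : [set: T * T] p -> (0 <= F (iter k rw p))%E.
    by move=> _; exact: F_ge0.
  rewrite -(ge0_integral_sum mu2 measurableT mFk Fk0 (index_enum 'I_n)).
  transitivity (\int[mu2]_(p in D) \sum_(i < N) (n%:R * cabs (b i) ^+ 2)%:E * (sqnorm p ^+ i)%:E)%E.
    rewrite [RHS]integral_mkcond; apply: eq_integral => p _.
    under eq_bigr do rewrite FE.
    rewrite patchE indicE; case: ifP => _; last first.
      by rewrite big1 // => k _; rewrite mule0.
    under eq_bigr do rewrite mule1.
    rewrite sumEFin (mean_psum _ _ wn Nn) mulr_sumr -sumEFin.
    by apply: eq_bigr => i _; rewrite -EFinM sqnorm_point_of mulrA.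
  rewrite ge0_integral_sum //; last 2 first.
    move=> i; apply: measurable_funeM; apply/measurable_EFinP.
    by apply: measurable_funX; apply: measurable_funS (@measurable_sqnorm R).
    move=> i p _; rewrite -EFinM lee_fin mulr_ge0 ?exprn_ge0 //.
      by rewrite mulr_ge0 // exprn_ge0 // cabs_ge0.
    by rewrite sqnorm_point_of exprn_ge0 ?cabs_ge0.
  rewrite -EFinM mulr_sumr -sumEFin; apply: eq_bigr => i _.
  rewrite ge0_integralZl_EFin //; last 3 first.
  - by move=> p _; rewrite lee_fin sqnorm_point_of !exprn_ge0 ?cabs_ge0.
  - apply/measurable_EFinP.
    by apply: measurable_funX; apply: measurable_funS (@measurable_sqnorm R).
  - by rewrite mulr_ge0 // exprn_ge0 // cabs_ge0.
  rewrite (_ : D = [set p : T * T | (sqnorm p < r ^+ 2)%R]).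
    by rewrite integral_radial ?exprn_gt0 // -EFinM; congr (_%:E); rewrite -!mulrA.
  by apply/seteqP; split => p; rewrite /D /= cabs_lt_sqnorm // ltW.
rewrite integral_mkcond -/F.
have n0 : n%:R != 0 :> R by rewrite pnatr_eq0 -lt0n.
have := congr1 (mule (n%:R^-1)%:E) step.
by rewrite !muleA -!EFinM mulVf // mul1r mul1e.
Qed.

(** Dominated convergence from [area_psum] for the partial sums of f'. *)
Theorem area_series a f (r : R) : power_series_in_disc a f ->
  (forall n, cabs (a n) <= 1) -> 0 < r < 1 ->
  area f r = (\sum_(0 <= n <oo) (pi * (n.+1%:R * cabs (a n.+1) ^+ 2 * r ^+ (2 * n.+1)))%:E)%E.
Proof.
move=> af a1 /andP[r0 r1]; pose D := [set p : T * T | cabs (point_of p) < r].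
have mD : measurable D by apply: measurable_odisc; exact: ltW.
pose f_ n (p : T * T) := (cabs (psum (dseq a) n (point_of p)) ^+ 2)%:E.
have mf n : measurable_fun D (f_ n).
  apply/measurable_EFinP; apply: measurable_funS (_ : measurable_fun [set: T * T] _) => //.
  by apply: measurable_cabs2; exact: cmeasurable_psum.
have r01 : 0 <= r < 1 by rewrite ltW.
have [B B0 [t t01 Bt]] := natexp2_le r01.
have /andP[t0 t1] := t01.
have K0 : 0 <= B / (1 - t) by rewrite divr_ge0 // subr_ge0 ltW.
have bound n p : D p -> cabs (psum (dseq a) n (point_of p)) <= B / (1 - t).
  move=> Dp; apply: le_trans (ler_cabs_sum _ _ _) _.
  apply: le_trans (_ : _ <= \sum_(k < n) B * t ^+ k) _.
    apply: ler_sum => k _; apply: le_trans (Bt k); rewrite !cabsM cabs_nat cabsX.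
    apply: ler_pM; rewrite ?mulr_ge0 ?exprn_ge0 ?cabs_ge0 //; last first.
      by rewrite lerXn2r ?nnegrE ?cabs_ge0 ?(ltW r0) // ltW.
    rewrite expr2; apply: ler_pM; rewrite ?cabs_ge0 //.
    by apply: le_trans (a1 _) _; rewrite ler1n.
  rewrite -mulr_sumr ler_wpM2l //.
  by have := @sum_geo_le R t 0 n t01; rewrite expr0 mul1r big_mkord.
have fcvg p : D p -> f_ ^~ p @ \oo --> (cabs (cderiv f (point_of p)) ^+ 2)%:E.
  move=> Dp; apply: cvg_EFin; first by near=> n.
  apply: (@continuous_cvg _ _ _ _ _ _ (fun t : R => t ^+ 2)); first exact: exprn_continuous.
  by apply: ctends_cabs; apply: power_series_deriv => //; apply: lt_trans r1.
have muD : (mu2 D < +oo)%E.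
  apply: le_lt_trans (_ : _ <= mu2 [set p : T * T | (sqnorm p <= r ^+ 2)%R])%E _.
    apply: le_measure; rewrite ?inE //; first exact: measurable_disc.
    by move=> p /= /ltW; rewrite sqnorm_point_of => h; rewrite lerXn2r ?nnegrE ?cabs_ge0 // ltW.
  by rewrite mu2_disc ?ltry // exprn_ge0 // ltW.
have ig : mu2.-integrable D (cst ((B / (1 - t)) ^+ 2)%:E).
  apply/integrableP; split; first exact: measurable_cst.
  rewrite (_ : (\int[mu2]_(p in D) _)%E = \int[mu2]_(p in D) cst ((B / (1 - t)) ^+ 2)%:E p)%E.
    by rewrite integral_cst // lte_mul_pinfty // lee_fin exprn_ge0.
  by apply: eq_integral => p _; rewrite /= ger0_norm // exprn_ge0.
have absf n p : D p -> (`|f_ n p| <= cst ((B / (1 - t)) ^+ 2)%:E p)%E.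
  move=> Dp; rewrite /f_ /= lee_fin ger0_norm ?exprn_ge0 ?cabs_ge0 //.
  by rewrite lerXn2r ?nnegrE ?cabs_ge0 // bound.
have fing p : D p -> cst ((B / (1 - t)) ^+ 2)%:E p \is a fin_num by [].
have := dominated_cvg mD mf fcvg fing ig absf.
move=> lim; transitivity (\int[mu2]_(p in D) (cabs (cderiv f (point_of p)) ^+ 2)%:E)%E; first by [].
rewrite -(cvg_lim _ lim) //.
congr (limn _); apply/funext => n.
rewrite area_psum // -sumEFin big_mkord; apply: eq_bigr => k _; congr (_%:E).
rewrite /dseq cabsM cabs_nat exprMn -exprM.
by field; rewrite nat1r pnatr_eq0.
Unshelve. all: by end_near.
Qed.

Lemma area0 f : area f (0 : R) = 0%E.
Proof.
transitivity (\int[mu2]_(p in set0) (cabs (cderiv f (point_of p)) ^+ 2)%:E)%E; last first.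
  exact: integral_set0.
congr (integral _ _ _); apply/seteqP; split => // p.
move=> h; suff : (0 : R) < 0 by rewrite ltxx.
exact: le_lt_trans (cabs_ge0 (point_of p)) h.
Qed.

End Area.

(** * Sharp bounds for sums of coefficients *)

Section Sums.
Variable R : realType.
Local Notation C := R[i].
Local Open Scope classical_set_scope.
Local Open Scope complex_scope.
Local Open Scope ring_scope.
Implicit Types (a : nat -> C) (f : C -> C).

Lemma nneseries_le (u : nat -> R) m (c : R) : (forall n, 0 <= u n) ->
  (forall N, \sum_(m <= n < N) u n <= c) -> (\sum_(m <= n <oo) (u n)%:E <= c%:E)%E.
Proof.
move=> u0 uc; apply: lime_le.
  by apply: is_cvg_nneseries => n _ _; rewrite lee_fin.
by near=> N; rewrite sumEFin lee_fin.
Unshelve. all: by end_near.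
Qed.

Lemma nneseries_eq (u : nat -> R) m (c : R) :
  (fun N => \sum_(m <= n < N) u n) @ \oo --> c -> (\sum_(m <= n <oo) (u n)%:E = c%:E)%E.
Proof.
move=> uc; apply/cvg_lim => //.
rewrite (_ : (fun n => _) = (fun N => (\sum_(m <= n < N) u n)%:E)); last first.
  by apply/funext => N; rewrite sumEFin.
apply: cvg_EFin; last exact: uc.
by near=> n.
Unshelve. all: by end_near.
Qed.

Lemma abel_sum_le (w d : nat -> R) N : (forall n, 0 <= w n.+1 <= w n) ->
  (forall m, \sum_(k < m) d k <= 0) -> \sum_(k < N) w k * d k <= w N * \sum_(k < N) d k.
Proof.
move=> wn dn; elim: N => [|N IH]; first by rewrite !big_ord0 mulr0.
have /andP[_ w1] := wn N; have := dn N.+1; rewrite !big_ord_recr /= => h.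
apply: le_trans (lerD IH (lexx _)) _; rewrite -mulrDr.
exact: ler_wnM2r h _ _ w1.
Qed.

Lemma sum_natexp_eq (x : R) N :
  (1 - x) ^+ 2 * (\sum_(k < N) k.+1%:R * x ^+ k) = 1 - N.+1%:R * x ^+ N + N%:R * x ^+ N.+1.
Proof.
elim: N => [|N IH]; first by rewrite big_ord0 expr0 mul0r; ring.
rewrite big_ord_recr /= mulrDr IH !exprS -[N.+2]addn1 -[N.+1]addn1 !natrD; ring.
Qed.

Lemma sum_natexp_le (x : R) N : 0 <= x < 1 ->
  \sum_(k < N) k.+1%:R * x ^+ k <= (1 - x) ^- 2.
Proof.
move=> /andP[x0 x1]; have p : 0 < (1 - x) ^+ 2 by rewrite exprn_gt0 // subr_gt0.
rewrite -(ler_pM2l p) divff ?gt_eqF // sum_natexp_eq exprS.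
have p0 : 0 <= x ^+ N by rewrite exprn_ge0.
have : 0 <= N%:R * x ^+ N * (1 - x) by rewrite !mulr_ge0 // subr_ge0 ltW.
rewrite -[N.+1]addn1 natrD; lra.
Qed.

(** The recursion [schur_sum_rec] is an equality for the coefficients of a disc automorphism, so
    the solution of the recursion with equality is the geometric sum on the right. *)
Lemma schur_sum_mobius a m : schur_seq a ->
  \sum_(k < m) cabs (a k.+1) ^+ 2
    <= \sum_(k < m) (1 - cabs (a 0%N) ^+ 2) ^+ 2 * (cabs (a 0%N) ^+ 2) ^+ k.
Proof.
move=> aS; elim: m => [|m IH]; first by rewrite !big_ord0.
have h : \sum_(k < m.+1) cabs (a k.+1) ^+ 2
   <= (1 - cabs (a 0%N) ^+ 2) ^+ 2 + cabs (a 0%N) ^+ 2 * \sum_(k < m) cabs (a k.+1) ^+ 2.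
  have := schur_sum_rec m aS; rewrite -lecR.
  rewrite rmorphD rmorphXn rmorphB rmorph1 rmorphXn rmorphM rmorphXn !rmorph_sum /=.
  under eq_bigr do rewrite normE -rmorphXn.
  by under [X in _ <= _ + _ * X -> _]eq_bigr do rewrite normE -rmorphXn.
apply: le_trans h _; rewrite big_ord_recl expr0 mulr1 lerD2l.
apply: le_trans (ler_wpM2l (exprn_ge0 2 (cabs_ge0 _)) IH) _.
rewrite mulr_sumr; apply: ler_sum => k _; rewrite (lift0 k) [_ ^+ k.+1]exprS.
by rewrite mulrCA.
Qed.

Definition mobius_area (al r : R) : R := (1 - al ^+ 2) ^+ 2 * r ^+ 2 / (1 - al ^+ 2 * r ^+ 2) ^+ 2.

(** The partial sums of the |a_k|^2 are dominated by [schur_sum_mobius], and the weights (k + 1)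
    r^(2 (k + 1)) decrease when r^2 <= 1 / 2; Abel summation transfers the domination to the
    weighted sums, whose right-hand side has a closed form. *)
Lemma area_sum_le a N (r : R) : schur_seq a -> 0 <= r -> r ^+ 2 <= 2^-1 ->
  \sum_(k < N) k.+1%:R * cabs (a k.+1) ^+ 2 * r ^+ (2 * k.+1) <= mobius_area (cabs (a 0%N)) r.
Proof.
move=> aS r0 r2; set al := cabs (a 0%N).
have al0 : 0 <= al := cabs_ge0 _.
have al1 : al <= 1 by rewrite -lecR -normE schur_le1.
have al20 : 0 <= al ^+ 2 by rewrite exprn_ge0.
have al21 : al ^+ 2 <= 1 by rewrite exprn_ile1.
pose w k := k.+1%:R * r ^+ (2 * k.+1).
pose d k := cabs (a k.+1) ^+ 2 - (1 - al ^+ 2) ^+ 2 * (al ^+ 2) ^+ k.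
have r20 : 0 <= r ^+ 2 by rewrite exprn_ge0.
have wn n : 0 <= w n.+1 <= w n.
  rewrite /w !exprM mulr_ge0 ?ler0n ?exprn_ge0 //= [r ^+ 2 ^+ n.+2]exprS mulrA.
  rewrite ler_wpM2r ?exprn_ge0 // -[n.+2]addn1 natrD.
  have : 1 <= n.+1%:R :> R by rewrite ler1n.
  by move: r2 r20; set s := r ^+ 2; set q := n.+1%:R; nra.
have dn m : \sum_(k < m) d k <= 0.
  by rewrite /d sumrB subr_le0; apply: schur_sum_mobius.
have wN : 0 <= w N by have /andP[h1 h2] := wn N; exact: le_trans h2.
have h0 : \sum_(k < N) w k * d k <= 0.
  by apply: le_trans (abel_sum_le N wn dn) _; rewrite mulr_ge0_le0.
have {h0} h : \sum_(k < N) w k * cabs (a k.+1) ^+ 2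
    <= \sum_(k < N) w k * ((1 - al ^+ 2) ^+ 2 * (al ^+ 2) ^+ k).
  by rewrite -subr_le0 -sumrB; move: h0; rewrite /d; under eq_bigr do rewrite mulrBr.
rewrite (eq_bigr (fun k : 'I_N => w k * cabs (a k.+1) ^+ 2)); last first.
  by move=> k _; rewrite /w mulrAC.
apply: le_trans h _.
have x01 : 0 <= al ^+ 2 * r ^+ 2 < 1.
  rewrite mulr_ge0 //=; apply: le_lt_trans (ler_piMl r20 al21) _.
  by apply: le_lt_trans r2 _; rewrite invf_lt1 // ltr1n.
rewrite (eq_bigr (fun k : 'I_N => (1 - al ^+ 2) ^+ 2 * r ^+ 2 * (k.+1%:R * (al ^+ 2 * r ^+ 2) ^+
  k))); last first.
  move=> k _; have rE : r ^+ (2 * k.+1) = r ^+ 2 * r ^+ 2 ^+ k by rewrite exprM exprS.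
  rewrite /w rE [(al ^+ 2 * _) ^+ k]exprMn; ring.
rewrite -mulr_sumr /mobius_area ler_wpM2l ?(mulr_ge0 (sqr_ge0 _) r20) //.
exact: sum_natexp_le.
Qed.

Lemma area_le a f (r : R) : power_series_in_disc a f -> schur_seq a ->
  0 <= r -> r ^+ 2 <= 2^-1 -> (area f r * (pi^-1)%:E <= (mobius_area (cabs (a 0%N)) r)%:E)%E.
Proof.
move=> af aS; rewrite le_eqVlt => /predU1P[<- _|r0 r2].
  by rewrite area0 mul0e lee_fin /mobius_area expr0n /= mulr0 mul0r.
have r1 : r < 1.
  rewrite -(@expr_lt1 _ 2) // ?(ltW r0) //; apply: le_lt_trans r2 _.
  by rewrite invf_lt1 // ltr1n.
have a1 n : cabs (a n) <= 1 by rewrite -lecR -normE schur_le1.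
have pi0 := @pi_gt0 R.
rewrite (area_series af a1) ?r0 // -lee_pdivlMr ?invr_gt0 // invrK -EFinM.
apply: nneseries_le => [n|N].
  by rewrite !mulr_ge0 ?exprn_ge0 ?cabs_ge0 ?(ltW pi0) ?(ltW r0).
rewrite big_mkord -mulr_sumr mulrC ler_wpM2r ?(ltW pi0) //.
by apply: area_sum_le => //; apply: ltW.
Qed.

(** Carlson's inequalities make the sum telescope: with S_N the sum of the |a_k|^2, k <= N, the
    terms 2 N + 2 and 2 N + 3 together with the square term N + 1 are at most the increment of -
    (1 - S_N) r^(2 N + 2) / (1 - r). The coefficient 1 / (1 + |a_0|) + r / (1 - r) is the one for
    which all |a_(N+1)|^2 cancel. *)
Lemma carlson_partial a N (r : R) : schur_seq a -> 0 <= r < 1 ->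
  \sum_(1 <= k < N.+1) (cabs (a k.*2) * r ^+ k.*2 + cabs (a k.*2.+1) * r ^+ k.*2.+1)
  + ((1 + cabs (a 0%N))^-1 + r / (1 - r)) * \sum_(1 <= k < N.+1) cabs (a k) ^+ 2 * r ^+ (2 * k)
  <= (1 - cabs (a 0%N) ^+ 2) * r ^+ 2 / (1 - r)
     - (1 - \sum_(k < N.+1) cabs (a k) ^+ 2) * r ^+ (2 * N.+1) / (1 - r).
Proof.
move=> aS /andP[r0 r1]; set al := cabs (a 0%N).
have al0 : 0 <= al := cabs_ge0 _.
have r10 : 1 - r != 0 by rewrite subr_eq0 gt_eqF.
have al10 : 1 + al != 0 by rewrite gt_eqF // ltr_wpDr.
elim: N => [|N IH].
  rewrite !big_geq // big_ord_recl big_ord0 /= mulr0 !addr0 -/al.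
  by rewrite subrr.
have odd : cabs (a N.+1.*2.+1) <= 1 - \sum_(k < N.+2) cabs (a k) ^+ 2.
  have := carlson_odd N.+1 aS; rewrite -lecR rmorphB rmorph1 rmorph_sum /=.
  by under [X in _ <= _ - X -> _]eq_bigr do rewrite normE -rmorphXn.
have even : cabs (a N.+1.*2) <= 1 - \sum_(k < N.+1) cabs (a k) ^+ 2 - cabs (a N.+1) ^+ 2 / (1 + al).
  have := @carlson_even _ a N.+1 aS isT.
  rewrite -lecR !rmorphB rmorph1 rmorph_sum fmorph_div rmorphD rmorph1 rmorphXn /=.
  by under [X in _ <= _ - X - _ -> _]eq_bigr do rewrite normE -rmorphXn.
rewrite big_nat_recr //= [\sum_(1 <= k < N.+2) cabs (a k) ^+ 2 * _]big_nat_recr //= mulrDr addrACA.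
apply: le_trans (lerD IH (lexx _)) _.
rewrite big_ord_recr /= in odd; rewrite [in X in _ <= X]big_ord_recr /=.
set S := \sum_(k < N.+1) _ in odd even *; set b := cabs (a N.+1) ^+ 2 in odd even *.
set e := cabs (a N.+1.*2) in even *; set o := cabs (a N.+1.*2.+1) in odd *.
have -> : r ^+ (2 * N.+2) = r ^+ (2 * N.+1) * r ^+ 2 by rewrite -exprD; congr (_ ^+ _); lia.
have -> : r ^+ N.+1.*2 = r ^+ (2 * N.+1) by rewrite mul2n.
have -> : r ^+ N.+1.*2.+1 = r ^+ (2 * N.+1) * r by rewrite -exprSr mul2n.
set p := r ^+ (2 * N.+1); have p0 : 0 <= p by rewrite exprn_ge0.
have e1 : e * p <= (1 - S - b / (1 + al)) * p by rewrite ler_wpM2r.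
have o1 : o * (p * r) <= (1 - (S + b)) * (p * r) by rewrite ler_wpM2r // mulr_ge0.
apply: le_trans (lerD (lexx _) (lerD (lerD e1 o1) (lexx _))) _.
rewrite -subr_ge0 le_eqVlt; apply/orP; left; apply/eqP.
by field; rewrite r10 al10.
Qed.

End Sums.

(** * The one-parameter majorant *)

Section Majorant.
Variable R : realType.
Local Notation C := R[i].
Local Open Scope classical_set_scope.
Local Open Scope complex_scope.
Local Open Scope ring_scope.
Implicit Types (a : nat -> C) (f : C -> C).

Lemma sum_pairs (F : nat -> R) N :
  \sum_(1 <= k < N.+1) (F k.*2 + F k.*2.+1) = \sum_(2 <= n < N.+1.*2) F n.
Proof.
elim: N => [|N IH]; first by rewrite !big_geq.
have e2 : (2 <= N.+1.*2)%N by rewrite doubleS.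
rewrite big_nat_recr // IH [N.+2.*2]doubleS.
move: (N.+1.*2) e2 => M e2.
by rewrite [RHS]big_nat_recr ?(leqW e2) // [X in _ = X + _]big_nat_recr //= addrA.
Qed.

Lemma B2_A_partial a M N (r : R) : schur_seq a -> 0 <= r < 1 ->
  \sum_(2 <= n < M) cabs (a n) * r ^+ n
  + ((1 + cabs (a 0%N))^-1 + r / (1 - r)) * \sum_(1 <= k < N) cabs (a k) ^+ 2 * r ^+ (2 * k)
  <= (1 - cabs (a 0%N) ^+ 2) * r ^+ 2 / (1 - r).
Proof.
move=> aS r01; have /andP[r0 r1] := r01; pose L := maxn M N.
have al0 := cabs_ge0 (a 0%N).
have k0 : 0 <= (1 + cabs (a 0%N))^-1 + r / (1 - r).
  by rewrite addr_ge0 ?invr_ge0 ?divr_ge0 ?subr_ge0 ?(ltW r1) // addr_ge0.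
have ext (u : nat -> R) m p q : (forall n, 0 <= u n) -> (p <= q)%N ->
    \sum_(m <= n < p) u n <= \sum_(m <= n < q) u n.
  move=> u0 pq; have [mp|pm] := leqP m p.
    by rewrite [leRHS](@big_cat_nat _ _ _ p) //= lerDl sumr_ge0.
  by rewrite big_geq ?(ltnW pm) // sumr_ge0.
apply: le_trans (_ : _ <= (1 - cabs (a 0%N) ^+ 2) * r ^+ 2 / (1 - r)
     - (1 - \sum_(k < L.+1) cabs (a k) ^+ 2) * r ^+ (2 * L.+1) / (1 - r)) _; last first.
  have S1 : \sum_(k < L.+1) cabs (a k) ^+ 2 <= 1.
    have := schur_sum_le1 L.+1 aS; rewrite -lecR rmorph_sum /=.
    by under eq_bigr do rewrite normE -rmorphXn.
  by rewrite lerBlDr lerDl divr_ge0 ?mulr_ge0 ?exprn_ge0 // subr_ge0 // ltW.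
apply: le_trans (carlson_partial L aS r01); rewrite (sum_pairs (fun n => cabs (a n) * r ^+ n)).
apply: lerD.
  apply: ext => [n|]; first by rewrite mulr_ge0 ?exprn_ge0 ?cabs_ge0.
  by rewrite /L; lia.
rewrite ler_wpM2l //; apply: ext => [n|]; first by rewrite mulr_ge0 ?exprn_ge0 ?cabs_ge0.
by rewrite /L; lia.
Qed.

Lemma B2_A_le a (r : R) : schur_seq a -> 0 <= r < 1 ->
  (B2 a r + A_f0 a r <= ((1 - cabs (a 0%N) ^+ 2) * r ^+ 2 / (1 - r))%:E)%E.
Proof.
move=> aS r01; have /andP[r0 r1] := r01.
set E0 := (1 - _) * _ / _.
set k := (1 + cabs (a 0%N))^-1 + r / (1 - r).
have k0 : 0 < k.
  by rewrite /k ltr_wpDr ?divr_ge0 ?invr_gt0 ?subr_ge0 ?(ltW r1) // ltr_wpDr ?cabs_ge0.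
have u0 n : 0 <= cabs (a n) * r ^+ n by rewrite mulr_ge0 ?exprn_ge0 ?cabs_ge0.
have v0 n : 0 <= cabs (a n) ^+ 2 * r ^+ (2 * n) by rewrite mulr_ge0 ?exprn_ge0 ?cabs_ge0.
have BN N : (B2 a r <= (E0 - k * \sum_(1 <= n < N) cabs (a n) ^+ 2 * r ^+ (2 * n))%:E)%E.
  by apply: nneseries_le => // M; rewrite lerBrDr; apply: B2_A_partial.
have B0 : (0 <= B2 a r)%E by apply: nneseries_ge0 => n _ _; rewrite lee_fin.
have Bfin : B2 a r \is a fin_num.
  by rewrite ge0_fin_numE // (le_lt_trans (BN 0%N)) // ltry.
have Afin : (sqnorm_f0 a r <= ((E0 - fine (B2 a r)) / k)%:E)%E.
  apply: nneseries_le => // N; rewrite ler_pdivlMr // mulrC lerBrDr addrC -lerBrDr.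
  by rewrite -lee_fin fineK.
rewrite -(fineK Bfin) /A_f0 -/k.
apply: le_trans (leeD (lexx _) (lee_wpmul2l _ Afin)) _; first by rewrite lee_fin ltW.
by rewrite -EFinM -EFinD lee_fin mulrCA divff ?gt_eqF // mulr1 addrC subrK.
Qed.

Lemma power_series_at0 a f : power_series_in_disc a f -> f 0 = a 0%N.
Proof.
move=> af; apply/eqP; rewrite -subr_eq0 -normr_eq0 normE -(rmorph0 (real_complex R)).
rewrite (inj_eq (@complexI R)) eq_le cabs_ge0 andbT; apply/ler_addgt0Pr => e e0; rewrite add0r.
have [|N NP] := psum_cvg af _ e0 (z := 0); first by rewrite cabs_real normr0.
have := NP N.+1 (leqnSn _); rewrite /psum big_ord_recl expr0 mulr1 big1 ?addr0; first exact: ltW.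
by move=> i _; rewrite expr0n mulr0.
Qed.

(** [schwarz_pick] at w = 0, solved for |f z|. *)
Lemma schwarz_pick_at0 a f z : power_series_in_disc a f -> schur_seq a ->
  (forall z, cabs z < 1 -> cabs (f z) <= 1) -> cabs z < 1 ->
  cabs (f z) <= (cabs (a 0%N) + cabs z) / (1 + cabs (a 0%N) * cabs z).
Proof.
move=> af aS f1 z1; have o1 : cabs (0 : C) < 1 by rewrite cabs_real normr0.
have := schwarz_pick af aS f1 z1 o1; rewrite (power_series_at0 af) rmorph0 mulr0 !subr0.
rewrite cabs_real normr1 mulr1 => sp.
have := f1 z z1; have := schur_le1 0 aS; rewrite normE lecR.
have cc := @cabs_conj R.
have id2 := @pick_norm_identity R.
have low : 1 - cabs (f z) * cabs (a 0%N) <= cabs (1 - f z * Num.conj (a 0%N)).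
  have := ler_cabsD (1 - f z * Num.conj (a 0%N)) (f z * Num.conj (a 0%N)).
  by rewrite subrK cabs_real normr1 cabsM cc lerBlDr.
have := id2 (f z) (a 0%N).
have x0 := cabs_ge0 (f z); have al0 := cabs_ge0 (a 0%N); have r0 := cabs_ge0 z.
set x := cabs (f z) in x0 low *; set al := cabs (a 0%N) in al0 low *; set r := cabs z in z1 r0 sp *.
set P := cabs (1 - _) in sp low *; set q := cabs (f z - _) in sp *.
move=> h al1 x1.
have q0 : 0 <= q := cabs_ge0 _.
have p0 : 0 <= 1 - x * al by rewrite subr_ge0 mulr_ile1.
have P0 : 0 <= P := cabs_ge0 _.
have h1 : q ^+ 2 <= r ^+ 2 * P ^+ 2 by rewrite -exprMn lerXn2r ?nnegrE ?mulr_ge0.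
have r2 : 0 <= 1 - r ^+ 2 by rewrite subr_ge0 exprn_ile1 // ltW.
have h2 : (1 - x * al) ^+ 2 <= P ^+ 2 by rewrite lerXn2r ?nnegrE.
have h3 : (1 - x * al) ^+ 2 * (1 - r ^+ 2) <= P ^+ 2 * (1 - r ^+ 2) by rewrite ler_wpM2r.
have h4 : (x - al) ^+ 2 <= (r * (1 - x * al)) ^+ 2.
  have -> : (x - al) ^+ 2 = (1 - x * al) ^+ 2 - (1 - x ^+ 2) * (1 - al ^+ 2) by ring.
  rewrite exprMn; lra.
have h5 : x - al <= r * (1 - x * al).
  have := h4; rewrite -ler_sqrt ?sqr_ge0 // !sqrtr_sqr [X in _ <= X]ger0_norm ?mulr_ge0 //.
  by apply: le_trans; rewrite ler_norm.
rewrite ler_pdivlMr; last by rewrite ltr_wpDr ?mulr_ge0.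
by lra.
Qed.

(** With k = r / (1 - r^2), [schwarz_pick_deriv] bounds the left-hand side by x + k (1 - x^2) for
    x = |f z|. This is increasing in x on [0, 1] when 2 k <= 1, which is the hypothesis on r, so
    the bound of [schwarz_pick_at0] for x may be inserted. *)
Lemma value_deriv_le a f z : power_series_in_disc a f -> schur_seq a ->
  (forall z, cabs z < 1 -> cabs (f z) <= 1) -> cabs z ^+ 2 + 2 * cabs z <= 1 ->
  cabs (f z) + cabs (cderiv f z) * cabs z
    <= (cabs (a 0%N) + cabs z) / (1 + cabs (a 0%N) * cabs z)
       + cabs z * (1 - cabs (a 0%N) ^+ 2) / (1 + cabs (a 0%N) * cabs z) ^+ 2.
Proof.
move=> af aS f1 zr; have r0 := cabs_ge0 z.
have z1 : cabs z < 1 by have := sqr_ge0 (cabs z); lra.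
have := schwarz_pick_at0 af aS f1 z1; have := schwarz_pick_deriv af aS f1 z1.
have := f1 z z1; have := schur_le1 0 aS; rewrite normE lecR.
have x0 := cabs_ge0 (f z); have al0 := cabs_ge0 (a 0%N).
have d0 := cabs_ge0 (cderiv f z).
set x := cabs (f z) in x0 *; set al := cabs (a 0%N) in al0 *; set r := cabs z in zr z1 r0 *.
set d := cabs (cderiv f z) in d0 *.
move=> al1 x1 hd hx; set y := (al + r) / _ in hx *.
have ar0 : 0 < 1 + al * r by rewrite ltr_wpDr ?mulr_ge0.
have r2 : 0 < 1 - r ^+ 2 by rewrite subr_gt0 exprn_ilt1.
have yE : 1 - y ^+ 2 = (1 - al ^+ 2) * (1 - r ^+ 2) / (1 + al * r) ^+ 2.
  by rewrite /y; field; rewrite gt_eqF.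
have y1 : y <= 1.
  rewrite ler_pdivrMr // mul1r; have : 0 <= (1 - al) * (1 - r) by rewrite mulr_ge0 ?subr_ge0 // ltW.
  lra.
have -> : r * (1 - al ^+ 2) / (1 + al * r) ^+ 2 = r / (1 - r ^+ 2) * (1 - y ^+ 2).
  by rewrite yE; field; rewrite !gt_eqF.
apply: le_trans (_ : _ <= x + r / (1 - r ^+ 2) * (1 - x ^+ 2)) _.
  rewrite lerD2l mulrC -mulrA ler_wpM2l // mulrC ler_pdivlMr //.
set k := r / (1 - r ^+ 2).
have k0 : 0 <= k by rewrite divr_ge0 // ltW.
have k2 : 2 * k <= 1 by rewrite mulrA ler_pdivrMr //; lra.
have : 0 <= (y - x) * (1 - k * (x + y)).
  apply: mulr_ge0; first by rewrite subr_ge0.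
  have : k * (x + y) <= k * 2 by rewrite ler_wpM2l //; lra.
  lra.
by lra.
Qed.

(** The value of the Bohr sum for the disc automorphism with value al at 0, at the point - r; see
    [mobius_bohr_sum]. *)
Definition majorant (lam al r : R) : R :=
  (al + r) / (1 + al * r) + r * (1 - al ^+ 2) / (1 + al * r) ^+ 2
  + (1 - al ^+ 2) * r ^+ 2 / (1 - r)
  + (221 - 43 * Num.sqrt 17) / 64 * mobius_area al r
  + lam * mobius_area al r ^+ 2.

Lemma mobius_area_ge0 (al r : R) : 0 <= mobius_area al r.
Proof. by rewrite /mobius_area divr_ge0 ?(mulr_ge0 (sqr_ge0 _) (sqr_ge0 _)) ?sqr_ge0. Qed.

Lemma majorant_mono (lam al r s : R) : 0 <= lam -> 0 <= (221 - 43 * Num.sqrt 17) / 64 :> R ->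
  0 <= al <= 1 -> 0 <= r <= s -> s < 1 ->
  majorant lam al r <= majorant lam al s.
Proof.
move=> l0 c0 /andP[al0 al1] /andP[r0 rs] s1.
have s0 : 0 <= s by lra.
have r1 : r < 1 by lra.
have alr : 0 < 1 + al * r by rewrite ltr_wpDr ?mulr_ge0.
have als : 0 < 1 + al * s by rewrite ltr_wpDr ?mulr_ge0.
have al2 : 0 <= 1 - al ^+ 2 by rewrite subr_ge0 exprn_ile1.
have rs0 : 0 <= s - r by lra.
have XX : mobius_area al r <= mobius_area al s.
  have mE u : mobius_area al u
      = (1 - al ^+ 2) ^+ 2 * (u ^+ 2 * (1 - al ^+ 2 * u ^+ 2) ^- 2).
    exact/esym/mulrA.
  rewrite !mE ler_wpM2l ?sqr_ge0 //.
  have qs : 0 < 1 - al ^+ 2 * s ^+ 2.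
    by rewrite -exprMn subr_gt0 exprn_ilt1 ?mulr_ge0 //; apply: le_lt_trans s1; rewrite ler_piMl.
  have qrs : 1 - al ^+ 2 * s ^+ 2 <= 1 - al ^+ 2 * r ^+ 2.
    by rewrite lerD2l lerN2 ler_wpM2l ?sqr_ge0 // lerXn2r ?nnegrE.
  have qr : 0 < 1 - al ^+ 2 * r ^+ 2 by apply: lt_le_trans qrs.
  have rs2 : r ^+ 2 <= s ^+ 2 by rewrite lerXn2r ?nnegrE.
  apply: (ler_pM _ _ rs2); rewrite ?sqr_ge0 ?invr_ge0 ?sqr_ge0 //.
  by rewrite lef_pV2 ?posrE ?exprn_gt0 // lerXn2r ?nnegrE // ltW.
rewrite /majorant; apply: lerD; last first.
  by rewrite ler_wpM2l // lerXn2r ?nnegrE ?mobius_area_ge0.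
apply: lerD; last by rewrite ler_wpM2l.
apply: lerD; last first.
  have rs2 : r ^+ 2 <= s ^+ 2 by rewrite lerXn2r ?nnegrE.
  have mE u : (1 - al ^+ 2) * u ^+ 2 / (1 - u) = (1 - al ^+ 2) * (u ^+ 2 / (1 - u)).
    exact/esym/mulrA.
  rewrite !mE ler_wpM2l //; apply: (ler_pM _ _ rs2); rewrite ?sqr_ge0 //.
    by rewrite invr_ge0 subr_ge0 ltW.
  by rewrite lef_pV2 ?posrE ?subr_gt0 // lerD2l lerN2.
apply: lerD.
  rewrite ler_pdivrMr // mulrAC ler_pdivlMr // -subr_ge0.
  have -> : (al + s) * (1 + al * r) - (al + r) * (1 + al * s) = (s - r) * (1 - al ^+ 2) by ring.
  by rewrite mulr_ge0.
rewrite ler_pdivrMr ?exprn_gt0 // mulrAC ler_pdivlMr ?exprn_gt0 // -subr_ge0.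
have -> : s * (1 - al ^+ 2) * (1 + al * r) ^+ 2 - r * (1 - al ^+ 2) * (1 + al * s) ^+ 2
  = (1 - al ^+ 2) * ((s - r) * (1 - (al * al) * (r * s))) by ring.
rewrite mulr_ge0 // mulr_ge0 // subr_ge0 mulr_ile1 ?mulr_ge0 ?mulr_ile1 // ltW //.
Qed.

Theorem bohr_sum_le_majorant (lam : R) a f z : 0 <= lam ->
  0 <= (221 - 43 * Num.sqrt 17) / 64 :> R ->
  power_series_in_disc a f -> (forall z, cabs z < 1 -> cabs (f z) <= 1) ->
  cabs z ^+ 2 + 2 * cabs z <= 1 ->
  (bohr_sum lam a f z <= (majorant lam (cabs (a 0%N)) (cabs z))%:E)%E.
Proof.
move=> l0 c0 af f1 zr; have aS := bounded_schur af f1.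
have r0 := cabs_ge0 z.
have z1 : cabs z < 1 by have := sqr_ge0 (cabs z); lra.
have z2 : cabs z ^+ 2 <= 2^-1.
  rewrite -[2^-1]mul1r ler_pdivlMr //.
  have : cabs z ^+ 2 <= cabs z by rewrite expr2 ler_piMr // ltW.
  lra.
rewrite /bohr_sum /majorant.
set X := mobius_area _ _; set Spi := (area f _ * _)%E.
have X0 : 0 <= X by apply: mobius_area_ge0.
have SX : (Spi <= X%:E)%E by apply: area_le.
have S0 : (0 <= Spi)%E.
  apply: mule_ge0; last by rewrite lee_fin invr_ge0 pi_ge0.
  by apply: integral_ge0 => p _; rewrite lee_fin exprn_ge0 ?cabs_ge0.
rewrite !EFinD; apply: leeD; last first.
  by rewrite EFinM lee_wpmul2l ?lee_fin // expr2 EFinM; apply: lee_pmul.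
apply: leeD; last by rewrite [leRHS]EFinM lee_wpmul2l ?lee_fin.
rewrite -[leLHS]addeA; apply: leeD; last by apply: B2_A_le; rewrite ?r0.
by rewrite -EFinD lee_fin value_deriv_le.
Qed.

End Majorant.

(** * The factorisation of Psi1 and its root *)

Section Numerics.
Variable R : realType.
Local Open Scope ring_scope.

Definition bohr_radius : R := (Num.sqrt 17 - 3) / 4.

Lemma sqrt17E : Num.sqrt 17 = 4 * bohr_radius + 3 :> R.
Proof. by rewrite /bohr_radius; field. Qed.

Lemma bohr_radius_eq : 2 * bohr_radius ^+ 2 + 3 * bohr_radius - 1 = 0.
Proof.
have s2 : Num.sqrt 17 ^+ 2 = 17 :> R by rewrite sqr_sqrtr.
have -> : 2 * bohr_radius ^+ 2 + 3 * bohr_radius - 1 = (Num.sqrt 17 ^+ 2 - 17) / 8 by rewrite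
  /bohr_radius; field.
by rewrite s2 subrr mul0r.
Qed.

(** The polynomials below have coefficients u + v r with u and v of order 10^6 that nearly cancel,
    hence the number of digits. *)
Lemma bohr_radius_bounds : 28077640640441%:R / 100000000000000%:R < bohr_radius < 28077640640442%:R
  / 100000000000000%:R.
Proof.
have r0 : - (3 / 4) <= bohr_radius by rewrite /bohr_radius; have := sqrtr_ge0 (17 : R); lra.
have h := bohr_radius_eq.
apply/andP; split; rewrite ltNge; apply/negP => hr.
  have : 0 <= (28077640640441%:R / 100000000000000%:R - bohr_radius) *
    (2 * (bohr_radius + 28077640640441%:R / 100000000000000%:R) + 3) by apply: mulr_ge0; lra.
  lra.
have : 0 <= (bohr_radius - 28077640640442%:R / 100000000000000%:R) *
  (2 * (bohr_radius + 28077640640442%:R / 100000000000000%:R) + 3) by apply: mulr_ge0; lra.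
lra.
Qed.

(** Up to positive factors, the numerator of the derivative of gap_num / gap_den; see
    [gap_wronskian]. *)
Definition crit (r t : R) : R :=
  (32 - 288 * r + t * (1611 - 5487%:R * r + t * (3441 - 12189%:R * r + t * (2204 - 7852%:R * r + t *
    (- 834 + 2970 * r + t * (- 1902 + 6774%:R * r + t * (- 634 + 2258 * r))))))).

Definition crit_cofactor (r t : R) : R :=
  (- 21696%:R + 77248%:R * r + t * (154496%:R - 550272%:R * r + t * (- 343920%:R + 1224880%:R * r +
    t * (0 + t * (1090620%:R - 3884300%:R * r + t * (- 1553720%:R + 5533656%:R * r + t * (691707%:R
    - 2463551%:R * r))))))).

(** Psi1 is reducible over Q(sqrt 17). *)
Lemma Psi1_factor (t : R) : Psi1 t = 8 * crit bohr_radius t * crit_cofactor bohr_radius t.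
Proof.
have h := bohr_radius_eq; rewrite /Psi1 sqrt17E; move: (bohr_radius) h => r h.
rewrite /crit /crit_cofactor; apply/eqP; rewrite -subr_eq0; apply/eqP.
(* the second factor is the quotient of the difference of the two sides by 2 r^2 + 3 r - 1 *)
transitivity ((2 * r ^+ 2 + 3 * r - 1) * (- 4 * (- 288 + t * (- 5487%:R + t * (- 12189%:R + t * (-
  7852%:R + t * (2970 + t * (6774%:R + t * (2258)))))))
  * (77248%:R + t * (- 550272%:R + t * (1224880%:R + t * (0 + t * (- 3884300%:R + t * (5533656%:R +
    t * (- 2463551%:R))))))))).
  ring.
by rewrite h mul0r.
Qed.

End Numerics.

Section CriticalRoot.
Variable R : realType.
Local Open Scope classical_set_scope.
Local Open Scope ring_scope.
Local Notation rad := (@bohr_radius R).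
Local Notation crit := (@crit R).

(** The coefficients from c3 on are nonnegative, so the part divided by t^2 is at most its value
    at 1. *)
Lemma sextic_lt0 (c0 c1 c2 c3 c4 c5 c6 t : R) : 0 <= t <= 1 ->
  c0 < 0 -> c1 <= 0 -> 0 <= c3 -> 0 <= c4 -> 0 <= c5 -> 0 <= c6 ->
  c2 + c3 + c4 + c5 + c6 <= 0 ->
  c0 + t * (c1 + t * (c2 + t * (c3 + t * (c4 + t * (c5 + t * c6))))) < 0.
Proof.
move=> /andP[t0 t1] h0 h1 h3 h4 h5 h6 hs.
have le v : 0 <= v -> t * v <= v by move=> v0; rewrite ler_piMl.
have h65 : 0 <= c5 + t * c6 by rewrite addr_ge0 ?mulr_ge0.
have h64 : 0 <= c4 + t * (c5 + t * c6) by rewrite addr_ge0 ?mulr_ge0.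
have h63 : 0 <= c3 + t * (c4 + t * (c5 + t * c6)) by rewrite addr_ge0 ?mulr_ge0.
have l6 := le _ h6; have l5 := le _ h65; have l4 := le _ h64; have l3 := le _ h63.
have : c3 + t * (c4 + t * (c5 + t * c6)) <= c3 + c4 + c5 + c6 by lra.
move: l3; set v := c3 + t * _ => l3 vle; have v2 : c2 + t * v <= 0 by lra.
have v1 : t * (c2 + t * v) <= 0 by rewrite mulr_ge0_le0.
have v0 : t * (c1 + t * (c2 + t * v)) <= 0 by rewrite mulr_ge0_le0 //; lra.
lra.
Qed.

Lemma crit_cofactor_lt0 (t : R) : 0 <= t <= 1 -> crit_cofactor rad t < 0.
Proof.
move=> t01; have /andP[rl rh] := bohr_radius_bounds R.
apply: (sextic_lt0 t01); move: (rad) rl rh => r rl rh; lra.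
Qed.

Lemma exprn_diff_le (x y : R) k : 0 <= x <= y -> y <= 1 ->
  0 <= y ^+ k - x ^+ k <= k%:R * (y - x).
Proof.
move=> /andP[x0 xy] y1; have y0 := le_trans x0 xy.
elim: k => [|k /andP[h1 h2]]; first by rewrite !expr0 subrr mul0r lexx.
have -> : y ^+ k.+1 - x ^+ k.+1 = y * (y ^+ k - x ^+ k) + x ^+ k * (y - x) by rewrite !exprS; ring.
have xk0 : 0 <= x ^+ k by rewrite exprn_ge0.
have xk1 : x ^+ k <= 1 by rewrite exprn_ile1 // (le_trans xy).
have d0 : 0 <= y - x by rewrite subr_ge0.
rewrite addr_ge0 ?mulr_ge0 //= -natr1 mulrDl mul1r lerD //.
  by apply: le_trans h2; rewrite ler_piMl.
by rewrite ler_piMl.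
Qed.

(** The increment of x^k lies between 0 and k (y - x), so the terms of degree 3 to 6 lose at most
    (3 + 4 + 5 + 6) (y - x) < 19 (y - x). *)
Lemma sextic_increasing (c0 c1 c2 c3 c4 c5 c6 x y : R) : 0 <= x -> x < y -> y <= 1 ->
  19 <= c1 -> 0 <= c2 -> - 1 <= c3 -> - 1 <= c4 -> - 1 <= c5 -> - 1 <= c6 ->
  c0 + x * (c1 + x * (c2 + x * (c3 + x * (c4 + x * (c5 + x * c6)))))
  < c0 + y * (c1 + y * (c2 + y * (c3 + y * (c4 + y * (c5 + y * c6))))).
Proof.
move=> x0 xy y1 h1 h2 h3 h4 h5 h6.
have xy' : 0 <= x <= y by rewrite x0 ltW.
have /andP[a2 _] := exprn_diff_le 2 xy' y1.
have /andP[a3 b3] := exprn_diff_le 3 xy' y1.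
have /andP[a4 b4] := exprn_diff_le 4 xy' y1.
have /andP[a5 b5] := exprn_diff_le 5 xy' y1.
have /andP[a6 b6] := exprn_diff_le 6 xy' y1.
have yx : 0 <= y - x by lra.
have k1 := ler_wpM2r yx h1; have k2 := mulr_ge0 h2 a2; have k3 := ler_wpM2r a3 h3.
have k4 := ler_wpM2r a4 h4; have k5 := ler_wpM2r a5 h5; have k6 := ler_wpM2r a6 h6.
lra.
Qed.

Lemma crit_increasing (x y : R) : 0 <= x -> x < y -> y <= 1 -> crit rad x < crit rad y.
Proof.
move=> x0 xy y1; have /andP[rl rh] := bohr_radius_bounds R.
apply: (sextic_increasing _ x0 xy y1); move: (rad) rl rh => r rl rh; lra.
Qed.

Lemma sextic_ivt (c0 c1 c2 c3 c4 c5 c6 x y : R) : x <= y ->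
  c0 + x * (c1 + x * (c2 + x * (c3 + x * (c4 + x * (c5 + x * c6))))) <= 0 ->
  0 <= c0 + y * (c1 + y * (c2 + y * (c3 + y * (c4 + y * (c5 + y * c6))))) ->
  exists2 a, x <= a <= y &
    c0 + a * (c1 + a * (c2 + a * (c3 + a * (c4 + a * (c5 + a * c6))))) = 0.
Proof.
move=> xy hx hy.
pose p : {poly R} := c0%:P + 'X * (c1%:P + 'X * (c2%:P + 'X * (c3%:P + 'X *
  (c4%:P + 'X * (c5%:P + 'X * c6%:P))))).
have pE t : p.[t] = c0 + t * (c1 + t * (c2 + t * (c3 + t * (c4 + t * (c5 + t * c6))))).
  by rewrite /p !hornerE.
have [|a a12 /rootP pa] := @poly_ivt R p x y xy; first by rewrite !pE hx.
by exists a => //; rewrite -pE.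
Qed.

Lemma crit_root : exists2 a : R,
  600975517%:R / 1000000000%:R <= a <= 600975518%:R / 1000000000%:R & crit rad a = 0.
Proof.
have /andP[rl rh] := bohr_radius_bounds R.
by apply: sextic_ivt; move: (rad) rl rh => r rl rh; lra.
Qed.

End CriticalRoot.

(** * The extremal value of lambda *)

Section Extremal.
Variable R : realType.
Local Open Scope classical_set_scope.
Local Open Scope ring_scope.
Local Notation rad := (@bohr_radius R).
Local Notation crit := (@crit R).

(** The polynomial of [gap_identity]: up to (1 - x)^3 and the denominator (1 - x^2 r^2)^4, it is
    what 1 exceeds the majorant by when lam = 0. *)
Definition gap_num (r x : R) : R :=
  (- 2032 + 8240%:R * r + x * (- 5584%:R + 20112%:R * r + x * (9592%:R - 34328%:R * r + x *
    (34152%:R - 121672%:R * r + x * (7553%:R - 26893%:R * r + x * (- 46557%:R + 165817%:R * r + x *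
    (- 48252%:R + 171852%:R * r + x * (- 16084%:R + 57284%:R * r)))))))) / 1024.

(** Up to (1 - x)^3 r^4 and the same denominator, the square of mobius_area x r. *)
Definition gap_den (x : R) : R := (1 - x) * (1 + x) ^+ 4.

Lemma is_derive_horner (c : R) (f : R -> R) (df x : R) : is_derive x 1 f df ->
  is_derive x 1 (fun y => c + y * f y) (f x + x * df).
Proof.
move=> hf; have h := @is_deriveM R R id f x 1 1 df (is_derive_id _ _) hf.
have h2 := @is_deriveD R R R (cst c) (fun y => y * f y) x 1 0 _ (is_derive_cst _ _ _) h.
by apply: (is_derive_eq h2); rewrite /GRing.scale /= mulr1 add0r addrC.
Qed.

Lemma is_derive_septic (c0 c1 c2 c3 c4 c5 c6 c7 x : R) :
  is_derive x 1 (fun x => c0 + x * (c1 + x * (c2 + x * (c3 + x * (c4 + x * (c5 + x * (c6 + x *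
    c7)))))))
   (c1 + x * (2 * c2 + x * (3 * c3 + x * (4 * c4 + x * (5 * c5 + x * (6 * c6 + x * (7 * c7))))))).
Proof.
apply: (is_derive_eq (is_derive_horner _ (is_derive_horner _
    (is_derive_horner _ (is_derive_horner _ (is_derive_horner _ (is_derive_horner _
    (is_derive_horner _ (is_derive_cst _ _ _)))))))) _) => /=.
by ring.
Qed.

Lemma is_derive_scaler (k : R) (f : R -> R) (df x : R) : is_derive x 1 f df ->
  is_derive x 1 (fun y => f y * k) (df * k).
Proof.
move=> hf; have h := @is_deriveM R R f (cst k) x 1 df 0 hf (is_derive_cst _ _ _).
by apply: (is_derive_eq h); rewrite /GRing.scale /= mulr0 add0r mulrC.
Qed.

Lemma is_derive_ratio (f g : R -> R) (df dg x : R) : is_derive x 1 f df -> is_derive x 1 g dg ->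
  g x != 0 -> is_derive x 1 (fun x => f x / g x) ((df * g x - f x * dg) / g x ^+ 2).
Proof.
move=> hf hg gx.
have hv : is_derive x 1 (fun x => (g x)^-1) (- (g x) ^- 2 * dg).
  apply: DeriveDef; first by apply: derivableV => //; case: hg.
  by rewrite deriveV ?(@derive_val _ _ _ _ _ _ _ hg) //; case: hg.
have h := @is_deriveM R R f (fun x => (g x)^-1) x 1 df _ hf hv.
apply: (is_derive_eq h); rewrite /GRing.scale /=; field.
exact: gx.
Qed.

(** The numerator of the derivative of gap_num / gap_den. *)
Lemma gap_wronskian (r x : R) : 2 * r ^+ 2 + 3 * r - 1 = 0 ->
  ((- 5584%:R + 20112%:R * r) + x * (2 * (9592%:R - 34328%:R * r) + x * (3 * (34152%:R - 121672%:R *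
    r) + x * (4 * (7553%:R - 26893%:R * r) + x * (5 * (- 46557%:R + 165817%:R * r) + x * (6 * (-
    48252%:R + 171852%:R * r) + x * (7 * (- 16084%:R + 57284%:R * r)))))))) / 1024 * gap_den x
   - gap_num r x * (3 + x * (4 - x * (6 + x * (12 + x * 5))))
  = crit r x / 64 * (1 + x) ^+ 3 * (1 - (1 - 3 * r) / 2 * x ^+ 2).
Proof.
move=> h; rewrite /gap_num /gap_den /crit; apply/eqP; rewrite -subr_eq0; apply/eqP.
transitivity ((2 * r ^+ 2 + 3 * r - 1) * (- 3 / 4 * ((- 288 + x * (- 5487%:R + x * (- 12189%:R + x *
  (- 7852%:R + x * (2970 + x * (6774%:R + x * (2258))))))) / 64) * (1 + x) ^+ 3 * x ^+ 2)).
  by field.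
by rewrite h mul0r.
Qed.

Lemma gap_den_gt0 (x : R) : 0 <= x < 1 -> 0 < gap_den x.
Proof.
by move=> /andP[x0 x1]; rewrite /gap_den mulr_gt0 ?exprn_gt0 ?subr_gt0 // ltr_wpDr.
Qed.

Lemma gap_den_horner (x : R) :
  gap_den x = 1 + x * (3 + x * (2 + x * (- 2 + x * (- 3 + x * (- 1 + x * (0 + x * 0)))))).
Proof. by rewrite /gap_den; ring. Qed.

Lemma gap_derive (x : R) : 0 <= x < 1 -> is_derive x 1 (fun x => gap_num rad x / gap_den x)
  (crit rad x / 64 * (1 + x) ^+ 3 * (1 - (1 - 3 * rad) / 2 * x ^+ 2) / gap_den x ^+ 2).
Proof.
move=> x01; have h := bohr_radius_eq R; move: (rad) h => r h.
rewrite -(gap_wronskian x h).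
have hf : is_derive x 1 (gap_num r) (((- 5584%:R + 20112%:R * r) + x * (2 * (9592%:R - 34328%:R * r)
  + x * (3 * (34152%:R - 121672%:R * r) + x * (4 * (7553%:R - 26893%:R * r) + x * (5 * (- 46557%:R +
  165817%:R * r) + x * (6 * (- 48252%:R + 171852%:R * r) + x * (7 * (- 16084%:R + 57284%:R *
  r)))))))) / 1024).
  exact: is_derive_scaler (is_derive_septic _ _ _ _ _ _ _ _ _).
have hg : is_derive x 1 gap_den (3 + x * (4 - x * (6 + x * (12 + x * 5)))).
  have -> := funext gap_den_horner.
  apply: (is_derive_eq (is_derive_septic _ _ _ _ _ _ _ _ _)).
  by ring.
apply: is_derive_ratio => //.
by rewrite gt_eqF ?gap_den_gt0.
Qed.

(** One step of Horner evaluation in interval arithmetic; the sign of the accumulator is not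
    fixed, so both ends of the range of t are compared. *)
Lemma horner_enclosure (t al ah v l u n nl nu L U : R) : al <= t <= ah -> l <= v <= u ->
  nl <= n <= nu -> 0 <= al ->
  L <= nl + al * l -> L <= nl + ah * l -> nu + al * u <= U -> nu + ah * u <= U ->
  L <= n + t * v <= U.
Proof.
move=> /andP[t0 t1] /andP[lv vu] /andP[nl1 nu1] al0 L0 L1 U0 U1.
have tp : 0 <= t by apply: le_trans t0.
have h1 : t * l <= t * v by rewrite ler_wpM2l.
have h2 : t * v <= t * u by rewrite ler_wpM2l.
have h3 : al * l <= t * l \/ ah * l <= t * l.
  have [l0|l0] := leP 0 l; [left|right]; first by rewrite ler_wpM2r.
  by rewrite ler_wnM2r // ltW.
have h4 : t * u <= al * u \/ t * u <= ah * u.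
  have [u0|u0] := leP 0 u; [right|left]; first by rewrite ler_wpM2r.
  by rewrite ler_wnM2r // ltW.
by apply/andP; split; [case: h3 => h3|case: h4 => h4]; lra.
Qed.

(** Instance for the coefficients of gap_num - 18.0214 r^4 gap_den near the root of crit. The
    value there is about 3 10^-8, which dictates the eleven digits. *)
Lemma gap_lower_gt0 (c0 c1 c2 c3 c4 c5 c6 c7 a : R) :
  600975517%:R / 1000000000%:R <= a <= 600975518%:R / 1000000000%:R ->
  16299430586%:R / 100000000000%:R <= c0 <= 16299430589%:R / 100000000000%:R ->
  - 27451091122%:R / 100000000000%:R <= c1 <= - 27451091119%:R / 100000000000%:R ->
  - 26940949042%:R / 100000000000%:R <= c2 <= - 26940949039%:R / 100000000000%:R ->
  21362882721%:R / 100000000000%:R <= c3 <= 21362882724%:R / 100000000000%:R ->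
  33804136839%:R / 100000000000%:R <= c4 <= 33804136842%:R / 100000000000%:R ->
  11249296905%:R / 100000000000%:R <= c5 <= 11249296908%:R / 100000000000%:R ->
  - 1270176%:R / 100000000000%:R <= c6 <= - 1270173%:R / 100000000000%:R ->
  - 423393%:R / 100000000000%:R <= c7 <= - 423390%:R / 100000000000%:R ->
  0 < c0 + a * (c1 + a * (c2 + a * (c3 + a * (c4 + a * (c5 + a * (c6 + a * (c7))))))).
Proof.
move=> a12 h0 h1 h2 h3 h4 h5 h6 h7.
have v6 := horner_enclosure (L := - 1524626%:R / 100000000000%:R) (U := - 1524619%:R /
  100000000000%:R) a12 h7 h6
  ltac:(clear; lra) ltac:(clear; lra) ltac:(clear; lra) ltac:(clear; lra) ltac:(clear; lra).
have v5 := horner_enclosure (L := 11248380641%:R / 100000000000%:R) (U := 11248380651%:R /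
  100000000000%:R) a12 v6 h5
  ltac:(clear; lra) ltac:(clear; lra) ltac:(clear; lra) ltac:(clear; lra) ltac:(clear; lra).
have v4 := horner_enclosure (L := 40564138209%:R / 100000000000%:R) (U := 40564138232%:R /
  100000000000%:R) a12 v5 h4
  ltac:(clear; lra) ltac:(clear; lra) ltac:(clear; lra) ltac:(clear; lra) ltac:(clear; lra).
have v3 := horner_enclosure (L := 45740936651%:R / 100000000000%:R) (U := 45740936712%:R /
  100000000000%:R) a12 v4 h3
  ltac:(clear; lra) ltac:(clear; lra) ltac:(clear; lra) ltac:(clear; lra) ltac:(clear; lra).
have v2 := horner_enclosure (L := 548234008%:R / 100000000000%:R) (U := 548234097%:R /
  100000000000%:R) a12 v3 h2
  ltac:(clear; lra) ltac:(clear; lra) ltac:(clear; lra) ltac:(clear; lra) ltac:(clear; lra).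
have v1 := horner_enclosure (L := - 27121615907%:R / 100000000000%:R) (U := - 27121615847%:R /
  100000000000%:R) a12 v2 h1
  ltac:(clear; lra) ltac:(clear; lra) ltac:(clear; lra) ltac:(clear; lra) ltac:(clear; lra).
have v0 := horner_enclosure (L := 3416 / 100000000000%:R) (U := 3485 / 100000000000%:R) a12 v1 h0
  ltac:(clear; lra) ltac:(clear; lra) ltac:(clear; lra) ltac:(clear; lra) ltac:(clear; lra).
have /andP[v _] := v0; apply: lt_le_trans v; clear; lra.
Qed.

(** The companion of [gap_lower_gt0] for 18.0216 r^4 gap_den - gap_num. *)
Lemma gap_upper_gt0 (c0 c1 c2 c3 c4 c5 c6 c7 a : R) :
  600975517%:R / 1000000000%:R <= a <= 600975518%:R / 1000000000%:R ->
  - 16299306288%:R / 100000000000%:R <= c0 <= - 16299306285%:R / 100000000000%:R ->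
  27451464020%:R / 100000000000%:R <= c1 <= 27451464023%:R / 100000000000%:R ->
  26941197639%:R / 100000000000%:R <= c2 <= 26941197642%:R / 100000000000%:R ->
  - 21363131325%:R / 100000000000%:R <= c3 <= - 21363131322%:R / 100000000000%:R ->
  - 33804509743%:R / 100000000000%:R <= c4 <= - 33804509740%:R / 100000000000%:R ->
  - 11249421208%:R / 100000000000%:R <= c5 <= - 11249421205%:R / 100000000000%:R ->
  1270173%:R / 100000000000%:R <= c6 <= 1270176%:R / 100000000000%:R ->
  423390%:R / 100000000000%:R <= c7 <= 423393%:R / 100000000000%:R ->
  0 < c0 + a * (c1 + a * (c2 + a * (c3 + a * (c4 + a * (c5 + a * (c6 + a * (c7))))))).
Proof.
move=> a12 h0 h1 h2 h3 h4 h5 h6 h7.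
have v6 := horner_enclosure (L := 1524619%:R / 100000000000%:R) (U := 1524626%:R / 100000000000%:R)
  a12 h7 h6
  ltac:(clear; lra) ltac:(clear; lra) ltac:(clear; lra) ltac:(clear; lra) ltac:(clear; lra).
have v5 := horner_enclosure (L := - 11248504951%:R / 100000000000%:R) (U := - 11248504941%:R /
  100000000000%:R) a12 v6 h5
  ltac:(clear; lra) ltac:(clear; lra) ltac:(clear; lra) ltac:(clear; lra) ltac:(clear; lra).
have v4 := horner_enclosure (L := - 40564585834%:R / 100000000000%:R) (U := - 40564585811%:R /
  100000000000%:R) a12 v5 h4
  ltac:(clear; lra) ltac:(clear; lra) ltac:(clear; lra) ltac:(clear; lra) ltac:(clear; lra).
have v3 := horner_enclosure (L := - 45741454311%:R / 100000000000%:R) (U := - 45741454250%:R /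
  100000000000%:R) a12 v4 h3
  ltac:(clear; lra) ltac:(clear; lra) ltac:(clear; lra) ltac:(clear; lra) ltac:(clear; lra).
have v2 := horner_enclosure (L := - 548296561%:R / 100000000000%:R) (U := - 548296473%:R /
  100000000000%:R) a12 v3 h2
  ltac:(clear; lra) ltac:(clear; lra) ltac:(clear; lra) ltac:(clear; lra) ltac:(clear; lra).
have v1 := horner_enclosure (L := 27121951209%:R / 100000000000%:R) (U := 27121951268%:R /
  100000000000%:R) a12 v2 h1
  ltac:(clear; lra) ltac:(clear; lra) ltac:(clear; lra) ltac:(clear; lra) ltac:(clear; lra).
have v0 := horner_enclosure (L := 322360%:R / 100000000000%:R) (U := 322429%:R / 100000000000%:R)
  a12 v1 h0
  ltac:(clear; lra) ltac:(clear; lra) ltac:(clear; lra) ltac:(clear; lra) ltac:(clear; lra).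
have /andP[v _] := v0; apply: lt_le_trans v; clear; lra.
Qed.

Lemma gap_value_bounds (a : R) : 600975517%:R / 1000000000%:R <= a <= 600975518%:R / 1000000000%:R
  ->
  180214%:R / 10000%:R * ((11 - 39 * rad) / 8 * gap_den a) < gap_num rad a
  /\ gap_num rad a < 180216%:R / 10000%:R * ((11 - 39 * rad) / 8 * gap_den a).
Proof.
move=> a12; have /andP[rl rh] := bohr_radius_bounds R; move: (rad) rl rh => r rl rh.
rewrite gap_den_horner /gap_num; split; rewrite -subr_gt0.
  have -> : (- 2032 + 8240%:R * r + a * (- 5584%:R + 20112%:R * r + a * (9592%:R - 34328%:R * r + a
    * (34152%:R - 121672%:R * r + a * (7553%:R - 26893%:R * r + a * (- 46557%:R + 165817%:R * r + a
    * (- 48252%:R + 171852%:R * r + a * (- 16084%:R + 57284%:R * r)))))))) / 1024 - 180214%:R /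
    10000%:R * ((11 - 39 * r) / 8 * (1 + a * (3 + a * (2 + a * (- 2 + a * (- 3 + a * (- 1 + a * (0 +
    a * 0))))))))
    = ((- 133819%:R + 479506%:R * r) / 5000%:R) + a * (((- 398957%:R + 1416018%:R * r) / 5000%:R) +
      a * (((- 3215333%:R + 11374817%:R * r) / 80000%:R) + a * (((6632833%:R - 23562317%:R * r) /
      80000%:R) + a * (((52297121%:R - 185488429%:R * r) / 640000%:R) + a * (((- 13239293%:R +
      47408857%:R * r) / 640000%:R) + a * (((- 12063%:R + 42963%:R * r) / 256) + a * (((- 4021 +
      14321%:R * r) / 256)))))))) by field.
  apply: (gap_lower_gt0 a12); apply/andP; split; lra.
have -> : 180216%:R / 10000%:R * ((11 - 39 * r) / 8 * (1 + a * (3 + a * (2 + a * (- 2 + a * (- 3 + a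
  * (- 1 + a * (0 + a * 0)))))))) - (- 2032 + 8240%:R * r + a * (- 5584%:R + 20112%:R * r + a *
  (9592%:R - 34328%:R * r + a * (34152%:R - 121672%:R * r + a * (7553%:R - 26893%:R * r + a * (-
  46557%:R + 165817%:R * r + a * (- 48252%:R + 171852%:R * r + a * (- 16084%:R + 57284%:R *
  r)))))))) / 1024
    = ((1070563%:R - 3836087%:R * r) / 40000%:R) + a * (((3191689%:R - 11328261%:R * r) / 40000%:R)
      + a * (((3215377%:R - 11374973%:R * r) / 80000%:R) + a * (((- 6632877%:R + 23562473%:R * r) /
      80000%:R) + a * (((- 52297649%:R + 185490301%:R * r) / 640000%:R) + a * (((13239117%:R -
      47408233%:R * r) / 640000%:R) + a * (((12063%:R - 42963%:R * r) / 256) + a * (((4021 -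
      14321%:R * r) / 256)))))))) by field.
apply: (gap_upper_gt0 a12); apply/andP; split; lra.
Qed.

Local Notation gap_ratio := (fun x : R => gap_num rad x / gap_den x).

Lemma gap_weight_gt0 (x : R) : 0 <= x < 1 ->
  0 < (1 + x) ^+ 3 * (1 - (1 - 3 * rad) / 2 * x ^+ 2) / gap_den x ^+ 2.
Proof.
move=> x01; have /andP[x0 x1] := x01; have d0 := gap_den_gt0 x01.
have /andP[rl rh] := bohr_radius_bounds R; move: (rad) rl rh => r rl rh.
have p0 : 0 < 1 + x by lra.
have x2 : x ^+ 2 <= 1 by apply: exprn_ile1 => //; apply: ltW.
have x2' : 0 <= x ^+ 2 by apply: sqr_ge0.
have r1 : 0 <= (1 - 3 * r) / 2 <= 1 / 2 by lra.
apply: divr_gt0; last exact: exprn_gt0.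
apply: mulr_gt0; first exact: exprn_gt0.
move: ((1 - 3 * r) / 2) r1 => k /andP[k0 k1].
have : k * x ^+ 2 <= k * 1 by rewrite ler_wpM2l.
clear -k1; lra.
Qed.

Lemma gap_deriveE (x : R) : 0 <= x < 1 -> exists2 k, 0 < k &
  is_derive x 1 gap_ratio (crit rad x * k).
Proof.
move=> x01; exists ((1 + x) ^+ 3 * (1 - (1 - 3 * rad) / 2 * x ^+ 2) / gap_den x ^+ 2 / 64).
  by rewrite divr_gt0 ?gap_weight_gt0.
apply: is_derive_eq (gap_derive x01) _.
move: (crit rad x) ((1 + x) ^+ 3) (1 - (1 - 3 * rad) / 2 * x ^+ 2) (gap_den x ^+ 2)^-1 => a b c d.
by field.
Qed.

Lemma gap_mvt (x y : R) : 0 <= x -> x < y -> y < 1 -> exists c k,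
  [/\ x < c < y, 0 < k & gap_ratio y - gap_ratio x = crit rad c * k].
Proof.
move=> x0 xy y1.
have gd z : z \in `]x, y[%R -> is_derive z 1 gap_ratio (derive1 gap_ratio z).
  rewrite in_itv /= => /andP[xz zy].
  have [|k k0 hk] := @gap_deriveE z; first by apply/andP; split; lra.
  by apply: DeriveDef; [case: hk|rewrite derive1E].
have [|c] := MVT xy gd.
  apply: derivable_within_continuous => z; rewrite in_itv /= => /andP[xz zy].
  by have [|k k0 []] := @gap_deriveE z; first by apply/andP; split; lra.
rewrite in_itv /= => /andP[xc cy] ->.
have [|k k0 hk] := @gap_deriveE c; first by apply/andP; split; lra.
exists c, (k * (y - x)); split; [by rewrite xc|by rewrite mulr_gt0 ?subr_gt0|].
by rewrite derive1E (@derive_val _ _ _ _ _ _ _ hk) mulrA.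
Qed.

(** By the mean value theorem, since crit is increasing and vanishes at a. *)
Lemma gap_min (a x : R) : crit rad a = 0 -> 0 < a < 1 -> 0 <= x < 1 ->
  gap_num rad a / gap_den a <= gap_num rad x / gap_den x.
Proof.
move=> ca /andP[a0 a1] /andP[x0 x1]; have [xa|ax|->] := ltgtP x a; last exact: lexx.
- have [c [k [/andP[xc cy] k0 h]]] := gap_mvt x0 xa a1.
  rewrite -subr_le0 h; apply: mulr_le0_ge0; last exact: ltW.
  by rewrite -ca; apply/ltW/crit_increasing => //; [apply: ltW; apply: le_lt_trans xc|apply: ltW].
- have [c [k [/andP[xc cy] k0 h]]] := gap_mvt (ltW a0) ax x1.
  rewrite -subr_ge0 h; apply: mulr_ge0; last exact: ltW.
  rewrite -ca; apply/ltW/crit_increasing => //; first exact: ltW.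
  by apply/ltW/(lt_trans cy).
Qed.

Lemma bohr_radius_pow4 : rad ^+ 4 = (11 - 39 * rad) / 8.
Proof.
have h := bohr_radius_eq R; move: (rad) h => r h; apply/eqP; rewrite -subr_eq0; apply/eqP.
transitivity ((2 * r ^+ 2 + 3 * r - 1) * (r ^+ 2 / 2 - 3 / 4 * r + 11 / 8)); first by field.
by rewrite h mul0r.
Qed.

(** Modulo crit, the minimal value of gap_num / (r^4 gap_den) is the closed form [lambda_of]. The
    cofactor of crit is obtained by polynomial division over Q(sqrt 17). *)
Lemma lambda_identity (a : R) :
  (11 - 39 * rad) / 8 * A1 a * gap_den a - 128 * (1 + a) ^+ 3 * A2 a * gap_num rad a
  = 2 * crit rad a * ((- 976 + 3472 * rad + a * (544 - 1952 * rad + a * (7488%:R - 26688%:R * rad +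
    a * (- 1572 + 5588%:R * rad + a * (- 19759%:R + 70371%:R * rad + a * (- 3621 + 12897%:R * rad +
    a * (18403%:R - 65543%:R * rad + a * (9805%:R - 34921%:R * rad))))))))).
Proof.
have h := bohr_radius_eq R; rewrite /A1 /A2 sqrt17E /gap_num /gap_den /crit.
move: (rad) h => r h; apply/eqP; rewrite -subr_eq0; apply/eqP.
transitivity ((2 * r ^+ 2 + 3 * r - 1) * ((107008%:R + a * (210560%:R + a * (- 527296%:R + a * (-
  530176%:R + a * (315840%:R + a * (- 681640%:R + a * (345548%:R + a * (2314620%:R + a * (-
  562808%:R + a * (- 2634880%:R + a * (- 344452%:R + a * (1447516%:R + a * (1010224%:R + a *
  (218064%:R)))))))))))))))).
  by field.
by rewrite h mul0r.
Qed.

(** The expression in parentheses is (1 - x)^3 times a cubic in x; multiplying this cubic by (1 -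
    x^2 r^2)^2 gives [gap_num]. Both steps hold modulo 2 r^2 + 3 r - 1. *)
Lemma gap_identity (r x : R) : 2 * r ^+ 2 + 3 * r - 1 = 0 ->
  ((1 - x ^+ 2 * r ^+ 2) ^+ 2 - (x + r) * (1 + x * r) * (1 - x * r) ^+ 2
   - r * (1 - x ^+ 2) * (1 - x * r) ^+ 2 - (1 - 2 * r) / 4 * (1 - x ^+ 2) * (1 - x ^+ 2 * r ^+ 2) ^+
     2
   - (23 - 43 * r) / 16 * r ^+ 2 * (1 - x ^+ 2) ^+ 2) * (1 - x ^+ 2 * r ^+ 2) ^+ 2
  = (1 - x) ^+ 3 * gap_num r x.
Proof.
move=> h; have -> : gap_num r x = ((- 127 + 515 * r + x * (- 349 + 1257 * r + x * (- 300 + 1068 * r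
  + x * (- 100 + 356 * r))))) / 64 * (1 - x ^+ 2 * r ^+ 2) ^+ 2.
  rewrite /gap_num; apply/eqP; rewrite eq_sym -subr_eq0; apply/eqP.
  transitivity ((2 * r ^+ 2 + 3 * r - 1) * ((14392%:R * x ^+ 2 - 8240%:R * x ^+ 2 * r + 35752%:R * x
    ^+ 3 - 20112%:R * x ^+ 3 * r + 7553%:R * x ^+ 4 - 4234 * x ^+ 4 * r - 7196%:R * x ^+ 4 * r ^+ 2
    + 4120 * x ^+ 4 * r ^+ 3 - 46557%:R * x ^+ 5 + 26146%:R * x ^+ 5 * r - 17876%:R * x ^+ 5 * r ^+
    2 + 10056%:R * x ^+ 5 * r ^+ 3 - 48252%:R * x ^+ 6 + 27096%:R * x ^+ 6 * r - 15216%:R * x ^+ 6 *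
    r ^+ 2 + 8544%:R * x ^+ 6 * r ^+ 3 - 16084%:R * x ^+ 7 + 9032%:R * x ^+ 7 * r - 5072%:R * x ^+ 7
    * r ^+ 2 + 2848 * x ^+ 7 * r ^+ 3) / 1024)); first by field.
  by rewrite h mul0r.
rewrite mulrA; congr (_ * _); apply/eqP; rewrite -subr_eq0; apply/eqP.
transitivity ((2 * r ^+ 2 + 3 * r - 1) * ((- 175 + 86 * r + 96 * x + 350 * x ^+ 2 - 204 * x ^+ 2 * r
  - 120 * x ^+ 3 + 48 * x ^+ 3 * r - 32 * x ^+ 3 * r ^+ 2 - 251 * x ^+ 4 + 126 * x ^+ 4 * r + 16 * x
  ^+ 4 * r ^+ 3 + 100 * x ^+ 6 - 56 * x ^+ 6 * r + 32 * x ^+ 6 * r ^+ 2 - 16 * x ^+ 6 * r ^+ 3) /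
  64)); first by field.
by rewrite h mul0r.
Qed.

Lemma majorant_gap (lam x : R) : 0 <= x <= 1 ->
  1 - majorant lam x rad
  = (1 - x) ^+ 3 * (gap_num rad x - lam * rad ^+ 4 * gap_den x) / (1 - x ^+ 2 * rad ^+ 2) ^+ 4.
Proof.
move=> /andP[x0 x1]; have h := bohr_radius_eq R.
have /andP[rl rh] := bohr_radius_bounds R.
have r0 : 0 < rad by apply: lt_trans rl; clear; lra.
have r1 : rad < 1 by apply: lt_trans rh _; clear; lra.
rewrite /majorant sqrt17E /mobius_area; move: (rad) h r0 r1 {rl rh} => r h r0 r1.
have k : r ^+ 2 / (1 - r) = (1 - 2 * r) / 4.
  by apply/eqP; rewrite eqr_div ?pnatr_eq0 ?subr_eq0 ?(gt_eqF r1) //; apply/eqP; lra.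
have c : (221 - 43 * (4 * r + 3)) / 64 = (23 - 43 * r) / 16 by field.
have xr0 : 0 <= x * r by rewrite mulr_ge0 // ltW.
have xr1 : x * r < 1 by apply: le_lt_trans r1; rewrite ler_piMl // ltW.
have n1 : 1 + x * r != 0 by rewrite gt_eqF // ltr_wpDr.
have n2 : 1 - x ^+ 2 * r ^+ 2 != 0 by rewrite subr_eq0 -exprMn gt_eqF // exprn_ilt1.
rewrite -[(1 - x ^+ 2) * _ / (1 - r)]mulrA k c.
rewrite [(1 - x) ^+ 3 * (_ - _)]mulrBr -(gap_identity x h) /gap_den; field.
by rewrite n1 exprMn n2.
Qed.

End Extremal.

(** * The inequality *)

Section Conclusion.
Variable R : realType.
Local Open Scope classical_set_scope.
Local Open Scope ring_scope.
Local Notation rad := (@bohr_radius R).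
Local Notation crit := (@crit R).

Lemma cubic_lt0 (c0 c1 c2 c3 t : R) : 0 <= t <= 61 / 100 -> c0 <= - 4 ->
  0 <= c1 <= 37 / 10 -> 0 <= c2 <= 36 / 10 -> 0 <= c3 <= 64 / 100 ->
  c0 + c1 * t + c2 * t ^+ 2 + c3 * t ^+ 3 < 0.
Proof.
move=> /andP[t0 t1] h0 /andP[h1 h1'] /andP[h2 h2'] /andP[h3 h3'].
have k1 : t ^+ 2 <= (61 / 100) ^+ 2 by rewrite lerXn2r ?nnegrE //; lra.
have k2 : t ^+ 3 <= (61 / 100) ^+ 3 by rewrite lerXn2r ?nnegrE //; lra.
have p2 := exprn_ge0 2 t0; have p3 := exprn_ge0 3 t0.
have m1 : c1 * t <= 37 / 10 * (61 / 100) by apply: ler_pM.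
have m2 : c2 * t ^+ 2 <= 36 / 10 * (61 / 100) ^+ 2 by apply: ler_pM.
have m3 : c3 * t ^+ 3 <= 64 / 100 * (61 / 100) ^+ 3 by apply: ler_pM.
lra.
Qed.

Lemma A2_lt0 (t : R) : 0 <= t <= 61 / 100 -> A2 t < 0.
Proof.
move=> t01; have /andP[rl rh] := bohr_radius_bounds R; rewrite /A2 sqrt17E.
move: (rad) rl rh => r rl rh.
rewrite (_ : _ + _ = (544 - 1952 * r) + (9112%:R - 32440%:R * r) * t
  + (- 30108%:R + 107244%:R * r) * t ^+ 2 + (21644%:R - 77084%:R * r) * t ^+ 3); last ring.
by apply: (cubic_lt0 t01); clear t01; lra.
Qed.

Lemma lambda_eq (a : R) : crit rad a = 0 -> 0 < a <= 61 / 100 ->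
  lambda_of a = gap_num rad a / ((11 - 39 * rad) / 8 * gap_den a).
Proof.
move=> ca /andP[a0 a1]; have A0 : A2 a < 0 by apply: A2_lt0; rewrite (ltW a0) a1.
have d0 : 0 < gap_den a by apply: gap_den_gt0; apply/andP; split; [exact: ltW|lra].
have p0 : 0 < (1 + a) ^+ 3 by rewrite exprn_gt0 // ltr_wpDl // ltW.
have q0 : 0 < (11 - 39 * rad) / 8.
  have /andP[_ rh] := bohr_radius_bounds R; move: (rad) rh => r rh; clear -rh; lra.
have := lambda_identity a; rewrite ca mulr0 mul0r => /eqP; rewrite subr_eq0 => /eqP e.
rewrite /lambda_of; apply/eqP; rewrite eqr_div; last 2 first.
- by rewrite mulf_neq0 ?(lt_eqF A0) // mulf_neq0 ?(gt_eqF p0).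
- by rewrite mulf_neq0 ?gt_eqF.
by apply/eqP; rewrite mulrCA mulrA e [RHS]mulrC.
Qed.

Lemma crit_root_bounds (a : R) : 600975517%:R / 1000000000%:R <= a <= 600975518%:R / 1000000000%:R
  ->
  0 < a <= 61 / 100.
Proof. by move=> /andP[h1 h2]; apply/andP; split; lra. Qed.

Lemma lambda_bounds (a : R) : crit rad a = 0 ->
  600975517%:R / 1000000000%:R <= a <= 600975518%:R / 1000000000%:R ->
  180214%:R / 10000%:R < lambda_of a < 180216%:R / 10000%:R.
Proof.
move=> ca ab; have a01 := crit_root_bounds ab; rewrite (lambda_eq ca a01).
have [h1 h2] := gap_value_bounds ab; have /andP[a0 a1] := a01.
have d0 : 0 < (11 - 39 * rad) / 8 * gap_den a.
  apply: mulr_gt0; last by apply: gap_den_gt0; apply/andP; split; [exact: ltW|clear -a1; lra].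
  have /andP[_ rh] := bohr_radius_bounds R; move: (rad) rh => r rh; clear -rh; lra.
by rewrite (ltr_pdivlMr _ _ d0) (ltr_pdivrMr _ _ d0) h1 h2.
Qed.

Lemma majorant_le1 (a x : R) : crit rad a = 0 -> 0 < a <= 61 / 100 -> 0 <= x <= 1 ->
  majorant (lambda_of a) x rad <= 1.
Proof.
move=> ca a01 /andP[x0]; have /andP[a0 a1] := a01.
have q0 : 0 < (11 - 39 * rad) / 8.
  have /andP[_ rh] := bohr_radius_bounds R; move: (rad) rh => r rh; clear -rh; lra.
rewrite le_eqVlt => /predU1P[->|x1]; rewrite -subr_ge0.
  by rewrite majorant_gap ?ler01 ?lexx // subrr expr0n /= !mul0r.
rewrite majorant_gap ?x0 ?(ltW x1) // bohr_radius_pow4.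
have dx : 0 < gap_den x by apply: gap_den_gt0; rewrite x0 x1.
have a1' : a < 1 by clear -a1; lra.
have da : 0 < gap_den a by apply: gap_den_gt0; rewrite (ltW a0) a1'.
apply: divr_ge0; last by rewrite (exprM _ 2 2) sqr_ge0.
apply: mulr_ge0; first by rewrite exprn_ge0 // subr_ge0 ltW.
rewrite subr_ge0 -ler_pdivlMr // (lambda_eq ca a01).
have := gap_min ca _ _ (x := x); rewrite a0 a1' x0 x1 => /(_ isT isT); apply: le_trans.
move: (gap_num rad a) (gap_den a) da ((11 - 39 * rad) / 8) q0 => n d d0 q q0.
rewrite le_eqVlt; apply/orP; left; apply/eqP; field.
by rewrite !gt_eqF.
Qed.

Lemma majorant_eq1 (a : R) : crit rad a = 0 -> 0 < a <= 61 / 100 ->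
  majorant (lambda_of a) a rad = 1.
Proof.
move=> ca a01; have /andP[a0 a1] := a01.
have q0 : 0 < (11 - 39 * rad) / 8.
  have /andP[_ rh] := bohr_radius_bounds R; move: (rad) rh => r rh; clear -rh; lra.
have a1' : a < 1 by clear -a1; lra.
have da : 0 < gap_den a by apply: gap_den_gt0; rewrite (ltW a0) a1'.
apply/esym/eqP; rewrite -subr_eq0 majorant_gap ?(ltW a0) ?(ltW a1') //.
rewrite bohr_radius_pow4 (lambda_eq ca a01); apply/eqP.
rewrite [X in _ * X / _](_ : _ = 0) ?mulr0 ?mul0r //.
move: (gap_num rad a) (gap_den a) da ((11 - 39 * rad) / 8) q0 => n d d0 q q0.
by field; rewrite !gt_eqF.
Qed.

Lemma bohr_radius_gt0 : 0 < rad.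
Proof. by have /andP[rl rh] := bohr_radius_bounds R; apply: lt_trans rl; clear; lra. Qed.

Lemma bohr_radius_lt : rad < 3 / 10.
Proof. by have /andP[rl rh] := bohr_radius_bounds R; apply: lt_trans rh _; clear; lra. Qed.

Lemma area_weight_ge0 : 0 <= (221 - 43 * Num.sqrt 17) / 64 :> R.
Proof. by have h := bohr_radius_lt; rewrite sqrt17E; lra. Qed.

Lemma bohr_inequality (b : R) (a : nat -> R[i]) (f : R[i] -> R[i]) (z : R[i]) :
  crit rad b = 0 -> 600975517%:R / 1000000000%:R <= b <= 600975518%:R / 1000000000%:R ->
  power_series_in_disc a f -> (forall z, cabs z < 1 -> cabs (f z) <= 1) ->
  cabs z <= rad -> (bohr_sum (lambda_of b) a f z <= 1)%E.
Proof.
move=> cb bb af f1 zr; have b01 := crit_root_bounds bb.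
have lam0 : 0 <= lambda_of b.
  have /andP[l1 _] := lambda_bounds cb bb; apply: ltW; apply: le_lt_trans l1; clear; lra.
have r0 := cabs_ge0 z; have rr := bohr_radius_lt; have re := bohr_radius_eq R.
have c0 := area_weight_ge0.
apply: le_trans (bohr_sum_le_majorant lam0 c0 af f1 _) _.
  apply: le_trans (_ : _ <= rad ^+ 2 + 2 * rad) _; last first.
    by move: (rad) (bohr_radius_gt0) rr re => r; nra.
  by apply: lerD; [rewrite lerXn2r ?nnegrE // (le_trans r0 zr)|rewrite ler_pM2l].
have al0 := cabs_ge0 (a 0%N).
have al1 : cabs (a 0%N) <= 1.
  by rewrite -(power_series_at0 af); apply: f1; rewrite cabs_real normr0.
have al01 : 0 <= cabs (a 0%N) <= 1 by rewrite al0.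
rewrite lee_fin; apply: le_trans (majorant_le1 cb b01 al01).
have h1 : 0 <= cabs z <= rad by apply/andP; split.
have h2 : rad < 1 by apply: lt_trans rr _; clear; lra.
exact: majorant_mono lam0 c0 al01 h1 h2.
Qed.

End Conclusion.

(** * Equality for a disc automorphism *)

Section Mobius.
Variable R : realType.
Local Open Scope classical_set_scope.
Local Open Scope ring_scope.
Local Notation C := R[i].

Definition mobius_coef (b : R) (n : nat) : C :=
  (if n is k.+1 then - ((1 - b ^+ 2) * b ^+ k) else b)%:C.

Lemma mobius_den (b : R) (z : C) : 0 <= b < 1 -> cabs z < 1 -> 1 - b%:C * z != 0.
Proof.
move=> /andP[b0 b1] z1; apply/eqP => /subr0_eq e.
have : cabs (b%:C * z) < 1.
  by rewrite cabsM cabs_real ger0_norm // (le_lt_trans _ z1) // ler_piMl ?cabs_ge0 // ltW.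
by rewrite -e cabs_real normr1 ltxx.
Qed.

Lemma mobius_psum (b : R) (z : C) n : 0 <= b < 1 -> cabs z < 1 ->
  mobius b z - psum (mobius_coef b) n.+1 z
  = - ((1 - b ^+ 2)%:C * z * (b%:C * z) ^+ n / (1 - b%:C * z)).
Proof.
move=> b01 z1; have d0 := mobius_den b01 z1; rewrite /mobius.
elim: n => [|n IH].
  rewrite /psum big_ord1 /mobius_coef expr0 !mulr1 /= rmorphB rmorphXn rmorph1; field; exact: d0.
rewrite /psum big_ord_recr opprD addrA IH /mobius_coef /= rmorphN rmorphM rmorphB !rmorphXn rmorph1.
by rewrite !exprMn !exprS; field; exact: d0.
Qed.

Lemma ctends_cvg (u : nat -> C) (l : C) : ctends u l -> (u : nat -> C^o) @ \oo --> (l : C^o).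
Proof.
move=> ul; apply/cvgrPdist_lt => e e0.
have eR : e = (complex.Re e)%:C by rewrite RRe_real // gtr0_real.
rewrite eR ltcR in e0; have [N NP] := ul _ e0.
by exists N => // n /NP; rewrite /= eR normE ltcR.
Qed.

Lemma mobius_power_series (b : R) : 0 <= b < 1 -> power_series_in_disc (mobius_coef b) (mobius b).
Proof.
move=> b01 z z1; have /andP[b0 b1] := b01; apply: ctends_cvg => e e0.
have bz1 : 0 <= b * cabs z < 1.
  by rewrite mulr_ge0 ?cabs_ge0 //= (le_lt_trans _ z1) // ler_piMl ?cabs_ge0 // ltW.
have [N NP] := @expr_lt_eps R (b * cabs z) (cabs ((1 - b ^+ 2)%:C * z / (1 - b%:C * z))) e bz1 e0.
exists N.+1 => -[//|n] Nn; rewrite /series /= big_mkord -/(psum (mobius_coef b) n.+1 z).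
rewrite mobius_psum // cabsN; apply: le_lt_trans (NP n Nn).
rewrite -[in X in _ <= _ * (X * _) ^+ _](ger0_norm b0) -cabs_real -!cabsM -cabsX -cabsM.
by rewrite mulrAC.
Qed.

Lemma mobius_coef_le1 (b : R) n : 0 <= b < 1 -> cabs (mobius_coef b n) <= 1.
Proof.
move=> /andP[b0 b1]; case: n => [|n]; rewrite /mobius_coef cabs_real; first by rewrite ger0_norm //
  ltW.
have b2 : 0 <= b ^+ 2 <= 1 by rewrite exprn_ge0 ?exprn_ile1 // ltW.
have bn : 0 <= b ^+ n <= 1 by rewrite exprn_ge0 ?exprn_ile1 // ltW.
rewrite normrN ger0_norm; first by rewrite mulr_ile1 //; lra.
by apply: mulr_ge0; lra.
Qed.

Lemma cabs_mobius_coefS (b : R) n : 0 <= b < 1 ->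
  cabs (mobius_coef b n.+1) = (1 - b ^+ 2) * b ^+ n.
Proof.
move=> /andP[b0 b1]; rewrite /mobius_coef cabs_real normrN ger0_norm //.
by rewrite mulr_ge0 ?exprn_ge0 // subr_ge0 exprn_ile1 // ltW.
Qed.

Lemma mobius_neg (b r : R) : 0 <= b < 1 -> 0 <= r < 1 ->
  cabs (mobius b (- r%:C)) = (b + r) / (1 + b * r).
Proof.
move=> /andP[b0 b1] /andP[r0 r1]; have br : 0 <= b * r by rewrite mulr_ge0.
have -> : mobius b (- r%:C) = ((b + r) / (1 + b * r))%:C.
  by rewrite /mobius opprK mulrN opprK fmorph_div !rmorphD rmorphM rmorph1.
by rewrite cabs_real ger0_norm // divr_ge0 // ?addr_ge0.
Qed.

(** The explicit second order remainder of the automorphism, through [cderiv_unique]; its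
    denominator stays away from 0 because 1 + b r >= 1. *)
Lemma mobius_deriv_neg (b r : R) : 0 <= b < 1 -> 0 <= r < 1 ->
  cabs (cderiv (mobius b) (- r%:C)) = (1 - b ^+ 2) / (1 + b * r) ^+ 2.
Proof.
move=> /andP[b0 b1] /andP[r0 r1]; have br : 0 <= b * r by rewrite mulr_ge0.
have d0 : 1 + b * r != 0 by rewrite gt_eqF // ltr_wpDr.
have b2 : b ^+ 2 <= 1 by rewrite exprn_ile1 // ltW.
rewrite (@cderiv_unique _ _ _ (- ((1 - b ^+ 2) / (1 + b * r) ^+ 2))%:C 2 2^-1) //.
  by rewrite cabs_real normrN ger0_norm // divr_ge0 ?sqr_ge0 // subr_ge0.
move=> h h2.
pose p := 1 + b * r; have p1 : 1 <= p by rewrite lerDl.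
have pE : 1 + b%:C * r%:C = p%:C by rewrite rmorphD rmorph1 rmorphM.
have D : 2^-1 <= cabs (p%:C - b%:C * h).
  have := ler_cabsD (p%:C - b%:C * h) (b%:C * h).
  rewrite subrK cabsM !cabs_real !ger0_norm //; last by apply: le_trans p1.
  have : b * cabs h <= 1 * 2^-1 by apply: ler_pM => //; [exact: cabs_ge0|exact: ltW].
  lra.
have D0 : p%:C - b%:C * h != 0.
  by apply: contraTneq D => ->; rewrite cabs_real normr0 -ltNge invr_gt0.
have p0 : p%:C != 0 :> C by rewrite -(rmorph0 (real_complex R)) (inj_eq (@complexI R)).
have -> : mobius b (- r%:C + h) - mobius b (- r%:C) - h * (- ((1 - b ^+ 2) / p ^+ 2))%:C
  = - ((b * (1 - b ^+ 2) / p ^+ 2)%:C * h ^+ 2 / (p%:C - b%:C * h)).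
  have e1 : 1 - b%:C * (- r%:C + h) = p%:C - b%:C * h by rewrite -pE; ring.
  have e2 : 1 - b%:C * - r%:C = p%:C by rewrite -pE; ring.
  have e3 : (- ((1 - b ^+ 2) / p ^+ 2))%:C = - ((1 - b%:C ^+ 2) / p%:C ^+ 2).
    by rewrite rmorphN fmorph_div rmorphB rmorph1 !rmorphXn.
  have e4 : (b * (1 - b ^+ 2) / p ^+ 2)%:C = b%:C * (1 - b%:C ^+ 2) / p%:C ^+ 2.
    by rewrite fmorph_div rmorphM rmorphB rmorph1 !rmorphXn.
  rewrite /mobius e1 e2 e3 e4; move: D0 p0; rewrite -pE => D0 p0.
  by field; rewrite ?D0 ?p0.
have K0 : 0 <= b * (1 - b ^+ 2) / p ^+ 2 <= 1.
  have p2 : 1 <= p ^+ 2 by rewrite exprn_ege1.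
  apply/andP; split; first by apply: divr_ge0; [apply: mulr_ge0 => //; rewrite subr_ge0|exact:
    sqr_ge0].
  rewrite ler_pdivrMr ?(lt_le_trans ltr01) // mul1r; apply: le_trans p2.
  apply: mulr_ile1; [by []|by rewrite subr_ge0|exact: ltW|by rewrite gerBl sqr_ge0].
rewrite cabsN cabsM [cabs (_ * h ^+ 2)]cabsM cabsX cabs_real.
have -> : cabs (p%:C - b%:C * h)^-1 = (cabs (p%:C - b%:C * h))^-1.
  by apply: complexI; rewrite fmorphV -!normE normfV.
move: (cabs (p%:C - b%:C * h)) D => q q2; have q0 : 0 < q by apply: lt_le_trans q2; rewrite
  invr_gt0.
have /andP[K1 K2] := K0; rewrite (ger0_norm K1) ler_pdivrMr // [X in _ <= X]mulrAC.
apply: ler_wpM2r; first exact: sqr_ge0.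
by apply: le_trans K2 _; lra.
Qed.

Lemma cvg_geo_dist (u : nat -> R) (l B t : R) M : 0 <= t < 1 ->
  (forall n, (M <= n)%N -> `|l - u n| <= B * t ^+ n) -> u @ \oo --> l.
Proof.
move=> t01 ut; apply/cvgrPdist_lt => e e0; have [N NP] := expr_lt_eps B t01 e0.
exists (maxn M N) => // n; rewrite /= geq_max => /andP[Mn /NP]; apply: le_lt_trans.
exact: ut.
Qed.

Lemma nneseries_geo (A x : R) m : 0 <= x < 1 ->
  (\sum_(m <= n <oo) (A * x ^+ n)%:E = (A * x ^+ m / (1 - x))%:E)%E.
Proof.
move=> x01; have /andP[x0 x1] := x01; have d0 : 1 - x != 0 by rewrite subr_eq0 gt_eqF.
apply: nneseries_eq; apply: (@cvg_geo_dist _ _ `|A / (1 - x)| x m x01) => N mN.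
rewrite le_eqVlt; apply/orP; left; apply/eqP.
have E : \sum_(m <= n < N) A * x ^+ n = A / (1 - x) * (x ^+ m - x ^+ N).
  elim: N mN => [|N IH]; first by rewrite leqn0 => /eqP ->; rewrite big_geq // subrr mulr0.
  rewrite leq_eqVlt => /predU1P[->|mN]; first by rewrite big_geq // subrr mulr0.
  by rewrite big_nat_recr //= IH // exprS; field.
rewrite E (_ : _ - _ = A / (1 - x) * x ^+ N); last by field.
by rewrite normrM (ger0_norm (exprn_ge0 _ x0)).
Qed.

Lemma nneseries_natexp (A x : R) : 0 <= x < 1 ->
  (\sum_(0 <= n <oo) (A * (n.+1%:R * x ^+ n))%:E = (A / (1 - x) ^+ 2)%:E)%E.
Proof.
move=> x01; have /andP[x0 x1] := x01; have d0 : 1 - x != 0 by rewrite subr_eq0 gt_eqF.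
have [B B0 [t t01 Bt]] := natexp2_le x01.
apply: nneseries_eq; apply: (@cvg_geo_dist _ _ (`|A / (1 - x) ^+ 2| * B) t 0 t01) => N _.
have /andP[t0 t1] := t01.
have E := sum_natexp_eq x N; rewrite big_mkord -mulr_sumr.
move: (\sum_(_ < N) _) E => S E.
have -> : A / (1 - x) ^+ 2 - A * S = A / (1 - x) ^+ 2 * (N.+1%:R * x ^+ N - N%:R * x ^+ N.+1).
  have -> : S = (1 - N.+1%:R * x ^+ N + N%:R * x ^+ N.+1) / (1 - x) ^+ 2.
    by rewrite -E mulrAC mulfV ?mul1r // expf_neq0.
  by field.
rewrite normrM -mulrA; apply: ler_wpM2l => //; apply: le_trans (Bt N).
have xN := exprn_ge0 N x0.
have h1 : N%:R * x ^+ N.+1 <= N.+1%:R * x ^+ N.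
  by apply: ler_pM; rewrite ?ler0n ?exprn_ge0 ?ler_nat ?leqnSn // exprS ler_piMl // ltW.
rewrite ger0_norm ?subr_ge0 //; apply: le_trans (_ : _ <= N.+1%:R * x ^+ N) _.
  by rewrite gerBl mulr_ge0 // exprn_ge0.
by rewrite ler_wpM2r // expr2 ler_peMl // ler1n.
Qed.

Lemma eq_eseries_from (u v : nat -> \bar R) m : (forall n, (m <= n)%N -> u n = v n) ->
  (\sum_(m <= n <oo) u n = \sum_(m <= n <oo) v n)%E.
Proof.
move=> uv; congr (lim (_ @ \oo)); apply/funext => N.
by apply: eq_big_nat => n /andP[mn _]; exact: uv.
Qed.

(** All series are geometric or derivatives of geometric ones, and the factor 1 / (1 + b) + r / (1
    - r) makes B_2 + A collapse to (1 - b^2) r^2 / (1 - r). *)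
Lemma mobius_bohr_sum (lam b r : R) : 0 < b < 1 -> 0 < r < 1 ->
  bohr_sum lam (mobius_coef b) (mobius b) (- r%:C) = (majorant lam b r)%:E.
Proof.
move=> /andP[b0 b1] /andP[r0 r1].
have b01 : 0 <= b < 1 by rewrite (ltW b0). have r01 : 0 <= r < 1 by rewrite (ltW r0).
have r01' : 0 < r < 1 by rewrite r0.
have cz : cabs (- r%:C) = r by rewrite cabsN cabs_real gtr0_norm.
have br0 : 0 < b * r by rewrite mulr_gt0.
have br1 : b * r < 1 by apply: lt_trans r1; rewrite gtr_pMl.
have br01 : 0 <= b * r < 1 by rewrite (ltW br0).
have b2r0 : 0 <= (b * r) ^+ 2 < 1 by rewrite sqr_ge0 exprn_ilt1 // ltW.
have bn : b != 0 by rewrite gt_eqF.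
have b2p : 0 <= 1 - b ^+ 2 by rewrite subr_ge0 exprn_ile1 // ltW.
have B2E : B2 (mobius_coef b) r = ((1 - b ^+ 2) / b * (b * r) ^+ 2 / (1 - b * r))%:E.
  rewrite -nneseries_geo //; apply: eq_eseries_from => -[//|n] _.
  by rewrite cabs_mobius_coefS // [(b * r) ^+ _]exprMn [b ^+ n.+1]exprS; congr (_%:E); field.
have sqE : sqnorm_f0 (mobius_coef b) r
    = (((1 - b ^+ 2) / b) ^+ 2 * ((b * r) ^+ 2) ^+ 1 / (1 - (b * r) ^+ 2))%:E.
  rewrite -nneseries_geo //; apply: eq_eseries_from => -[//|n] _.
  rewrite cabs_mobius_coefS // [r ^+ (2 * _)]exprM [(b * r) ^+ 2]exprMn.
  rewrite [(b ^+ 2 * r ^+ 2) ^+ n.+1]exprMn [(b ^+ 2) ^+ n.+1]exprS -[(b ^+ 2) ^+ n]exprM.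
  by rewrite mulnC [b ^+ (n * 2)]exprM; congr (_%:E); field.
have areaE : (area (mobius b) r * (pi^-1)%:E = (mobius_area b r)%:E)%E.
  rewrite (area_series (mobius_power_series b01)) //; last by move=> n; apply: mobius_coef_le1.
  have pin : pi != 0 :> R by rewrite gt_eqF ?pi_gt0.
  transitivity ((\sum_(0 <= n <oo) (pi * (1 - b ^+ 2) ^+ 2 * r ^+ 2 *
     (n.+1%:R * ((b * r) ^+ 2) ^+ n))%:E) * (pi^-1)%:E)%E.
    congr (_ * _)%E; apply: eq_eseries_from => n _.
    rewrite cabs_mobius_coefS // [r ^+ (2 * _)]exprM [(r ^+ 2) ^+ n.+1]exprS [(b * r) ^+ 2]exprMn.
    rewrite [(b ^+ 2 * r ^+ 2) ^+ n]exprMn -[(b ^+ 2) ^+ n]exprM [(2 * n)%N]mulnC.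
    by rewrite [b ^+ (n * 2)]exprM; congr (_%:E); ring.
  rewrite nneseries_natexp // -EFinM /mobius_area [(b * r) ^+ 2]exprMn; congr (_%:E).
  by rewrite mulrC !mulrA mulVf ?mul1r.
have al : cabs (mobius_coef b 0) = b by rewrite cabs_real ger0_norm // ltW.
rewrite /bohr_sum cz areaE B2E /A_f0 sqE mobius_neg // mobius_deriv_neg // al.
rewrite -!EFinM -!EFinD; congr (_%:E); rewrite /majorant.
move: (mobius_area b r) ((221 - 43 * Num.sqrt 17) / 64) => S c.
have n1 : 1 + b != 0 by rewrite gt_eqF // addr_gt0.
have n2 : 1 - r != 0 by rewrite subr_eq0 gt_eqF.
have n3 : 1 - b * r != 0 by rewrite subr_eq0 gt_eqF.
have n4 : 1 - (b * r) ^+ 2 != 0 by rewrite subr_eq0 gt_eqF // exprn_ilt1 // ltW.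
have n5 : 1 + b * r != 0 by rewrite gt_eqF // addr_gt0.
by field; rewrite n1 n2 n3 n4 n5 bn.
Qed.

End Mobius.

Theorem theorem2p1 (R : realType) :
  exists a_star : R,
    [/\ (0 < a_star < 1 /\ Psi1 a_star = 0)
          /\ (forall t : R, 0 < t < 1 -> Psi1 t = 0 -> t = a_star),
        `|a_star - 600976%:R / 1000000%:R| < 5 / 10000000%:R,
        `|lambda_of a_star - 180215%:R / 10000%:R| < 1 / 10000%:R,
        (forall (a : nat -> R[i]) (f : R[i] -> R[i]),
           power_series_in_disc a f ->
           (forall z : R[i], cabs z < 1 -> cabs (f z) <= 1) ->
           forall z : R[i], cabs z < 1 -> cabs z <= (Num.sqrt 17 - 3) / 4 ->
             (bohr_sum (lambda_of a_star) a f z <= 1)%E)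
      & (exists (b : R) (c : nat -> R[i]) (z : R[i]),
           [/\ 0 <= b < 1,
               power_series_in_disc c (mobius b),
               cabs z <= (Num.sqrt 17 - 3) / 4
             & bohr_sum (lambda_of a_star) c (mobius b) z = 1%E])].
Proof.
have [a ab ca] := crit_root R; have a01 := crit_root_bounds ab.
have /andP[a0 a61] := a01; have a1 : a < 1 by clear -a61; lra.
have /andP[l1 l2] := lambda_bounds ca ab.
have r0 := bohr_radius_gt0 R; have r1 : bohr_radius R < 1.
  by have h := bohr_radius_lt R; clear -h; lra.
exists a; split.
- split; first by rewrite Psi1_factor ca mulr0 mul0r a0 a1.
  move=> t /andP[t0 t1]; rewrite Psi1_factor => /eqP; rewrite mulf_eq0 mulf_eq0.
  have t01 : 0 <= t <= 1 by rewrite !ltW.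
  rewrite [crit_cofactor _ _ == 0](lt_eqF (crit_cofactor_lt0 t01)) orbF pnatr_eq0 /= => /eqP ct.
  have [ta|at_|//] := ltgtP t a.
    by have := crit_increasing (ltW t0) ta (ltW a1); rewrite ct ca ltxx.
  by have := crit_increasing (ltW a0) at_ (ltW t1); rewrite ct ca ltxx.
- by have /andP[h1 h2] := ab; clear -h1 h2; rewrite ltr_distl; apply/andP; split; lra.
- by clear -l1 l2; rewrite ltr_distl; apply/andP; split; lra.
- by move=> c f cf f1 z _ zr; apply: bohr_inequality.
exists a, (mobius_coef a), (- (bohr_radius R)%:C); split.
- by rewrite (ltW a0).
- by apply: mobius_power_series; rewrite (ltW a0).
- by rewrite cabsN cabs_real gtr0_norm.
by rewrite mobius_bohr_sum ?a0 ?r0 // majorant_eq1.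
Qed.
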